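(* Let $H(n_1,\ldots,n_r)=\dim_K(K[X])_{n_1,\ldots,n_r}$ be the Hilbert function of the $\mathbb{N}^r$-graded algebra $K[X]$. If $\sum_in_ip_i\ne\sum_in_iq_i$ then $H(n_1,\ldots,n_r)=0$. If $n=\sum_in_ip_i=\sum_in_iq_i$ then $$H(n_1,\ldots,n_r)=\sum_{\lambda\vdash n,\ \underline{\mu},\ \underline{\nu},\ \underline{\rho}}c^{\lambda}_{\underline{\mu}}\,c^{\lambda}_{\underline{\nu}}\prod_{i=1}^r g(\mu_{i1},\mu_{i2},\ldots,\mu_{ip_i},\rho_i)\,\prod_{i=1}^r g(\nu_{i1},\nu_{i2},\ldots,\nu_{iq_i},\rho_i),$$ where the sum is over all partitions $\lambda\vdash n$ and all tuples of partitions $\underline\mu=(\mu_{ij})_{1\le i\le r,\,1\le j\le p_i}$, $\underline\nu=(\nu_{ij})_{1\le i\le r,\,1\le j\le q_i}$, $\underline\rho=(\rho_i)_{1\le i\le r}$ with $\mu_{ij},\nu_{ij},\rho_i\vdash n_i$. For $d\geq 0$, the Hilbert function of $K[X]/I_d$ is given by the same formula, except that the sum is taken only over those partitions $\lambda\vdash n$ whose number of rows is at most $d$.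
   Context: $K$ is an algebraically closed field of characteristic zero and a type $((p_1,q_1),\ldots,(p_r,q_r))\in(\mathbb{N}^2)^r$ is fixed. **The algebra $K[X]$.** A closed diagram is a finite list of boxes, each labelled by one of $x_1,\ldots,x_r$, where a box labelled $x_i$ has $q_i$ ordered input strings and $p_i$ ordered output strings, together with a bijection (connection) from the set of all output strings to the set of all input strings. Diagrams differing by permuting the boxes (carrying along strings and connections) are considered equal. $K[X]$ is the free $K$-vector space on closed diagrams, with product given by juxtaposition. It is graded by $\mathbb{N}^r$: a diagram with $n_i$ boxes labelled $x_i$ for each $i$ has degree $(n_1,\ldots,n_r)$. For $\sum_i n_ip_i=\sum_in_iq_i=n$ and $\sigma\in S_n$, $p(n,\sigma,n_1,\ldots,n_r)$ denotes the diagram with $n_1$ boxes $x_1$, ..., $n_r$ boxes $x_r$ in this order, with output strings and input strings each numbered $1,\ldots,n$ from left to right, and output string $j$ connected to input string $\sigma(j)$. These span $(K[X])_{n_1,\ldots,n_r}$. **The ideal $I_d$.** $I_d$ is the span of all elements $\sum_{\sigma\in S_{d+1}}(-1)^\sigma p(n,\tau_1\sigma\tau_2,n_1,\ldots,n_r)$ with $n=\sum_ip_in_i=\sum_iq_in_i>d$ and $\tau_1,\tau_2\in S_n$. Equivalently, it is the kernel of the surjective algebra map $K[X]\to K[U_d]^{\mathrm{GL}_d(K)}$, $U_d=\bigoplus_i(K^d)^{\otimes p_i}\otimes((K^d)^* )^{\otimes q_i}$, sending $p(n,\sigma,n_1,\ldots,n_r)$ to the invariant polynomial $(x_i)\mapsto\mathrm{Tr}(L^{(n)}_\sigma\circ(x_1^{\otimes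 n_1}\otimes\cdots\otimes x_r^{\otimes n_r}))$, where $x_i\in\mathrm{Hom}((K^d)^{\otimes q_i},(K^d)^{\otimes p_i})$ and $L^{(n)}_\sigma(w_1\otimes\cdots\otimes w_n)=w_{\sigma^{-1}(1)}\otimes\cdots\otimes w_{\sigma^{-1}(n)}$. **Coefficients.** $\mathbb{S}_\lambda$ is the Specht module (irreducible $S_n$-representation) of $\lambda\vdash n$. For $n=m_1+\cdots+m_k$, the iterated Littlewood–Richardson coefficient $c^\lambda_{(\lambda_1,\ldots,\lambda_k)}$ ($\lambda_i\vdash m_i$) is the multiplicity of $\mathbb{S}_{\lambda_1}\boxtimes\cdots\boxtimes\mathbb{S}_{\lambda_k}$ in the restriction of $\mathbb{S}_\lambda$ to $S_{m_1}\times\cdots\times S_{m_k}\subseteq S_n$. Here $\underline\mu$ is regarded as the list $\mu_{11},\ldots,\mu_{1p_1},\ldots,\mu_{r1},\ldots,\mu_{rp_r}$, and similarly $\underline\nu$. For partitions $\lambda_1,\ldots,\lambda_k\vdash m$, the iterated Kronecker coefficient is $g(\lambda_1,\ldots,\lambda_k)=\dim\mathrm{Hom}_{S_m}(\mathbb{S}_{\lambda_1}\otimes\cdots\otimes\mathbb{S}_{\lambda_k},\mathbf{1})$, with $\mathbf 1$ the trivial representation. *)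

(* Defs.v *)
From HB Require Import structures.
From mathcomp Require Import all_boot all_order all_fingroup all_algebra.
From mathcomp Require Import mxrepresentation generic_quotient.
From mathcomp Require Import boolp finmap monalg.

Set Implicit Arguments.
Unset Strict Implicit.
Unset Printing Implicit Defensive.

Import GRing.Theory.
Import GroupScope.
Local Open Scope quotient_scope.

Section Diagrams.
Variables (r : nat) (p q : 'I_r -> nat).

(* A list of boxes w together with a connection s. The output strings of the
   boxes of w, and likewise their input strings, are numbered from 0 from left
   to right, and output string j is connected to input string nth 0 s j. *)
Definition is_diagram (D : seq 'I_r * seq nat) :=
  (sumn (map p D.1) == sumn (map q D.1))
  && perm_eq D.2 (iota 0 (sumn (map p D.1))).

Record diagram := Diagram {
  diagram_val :> seq 'I_r * seq nat;
  diagramP : is_diagram diagram_val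
}.

HB.instance Definition _ := [isSub for diagram_val].
HB.instance Definition _ := [Choice of diagram by <:].

Definition boxes (D : diagram) := (diagram_val D).1.
Definition conn (D : diagram) := (diagram_val D).2.

(* The a-th output string of the k-th box is connected to the b-th input
   string of the l-th box. This is false when one of these does not exist. *)
Definition joins (D : diagram) (k a l b : nat) : bool :=
  let outs := map p (boxes D) in
  let ins := map q (boxes D) in
  [&& a < nth 0 outs k, b < nth 0 ins l
    & nth 0 (conn D) (flatten_index outs k a) == flatten_index ins l b].

(* D and E differ by the permutation f of the boxes, which carries along the
   labels, the strings and the connection. *)
Definition box_perm (D E : diagram) : Prop :=
  exists f g : nat -> nat,
    [/\ forall k, k < size (boxes D) -> f k < size (boxes E) /\ g (f k) = k,
        forall k, k < size (boxes E) -> g k < size (boxes D) /\ f (g k) = k,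
        forall k, k < size (boxes D) -> onth (boxes E) (f k) = onth (boxes D) k
      & forall k a l b, k < size (boxes D) -> l < size (boxes D) ->
          joins E (f k) a (f l) b = joins D k a l b].

Lemma box_perm_refl D : box_perm D D.
Proof. by exists id, id. Qed.

Lemma box_perm_sym D E : box_perm D E -> box_perm E D.
Proof.
case=> f [g [fP gP lab jn]]; exists g, f; split=> // [k ltk | k a l b ltk ltl].
  by have [gk fgk] := gP k ltk; rewrite -lab // fgk.
have [gk fgk] := gP k ltk; have [gl fgl] := gP l ltl.
by rewrite -jn // fgk fgl.
Qed.

Lemma box_perm_trans E D F : box_perm D E -> box_perm E F -> box_perm D F.
Proof.
case=> f [g [fP gP lab jn]] [f' [g' [fP' gP' lab' jn']]].
exists (f' \o f), (g \o g'); split=> /= [k ltk|k ltk|k ltk|k a l b ltk ltl].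
- have [fk gfk] := fP k ltk; have [f'k gf'k] := fP' _ fk.
  by rewrite gf'k.
- have [fk gfk] := gP' k ltk; have [f'k gf'k] := gP _ fk.
  by rewrite gf'k.
- by rewrite lab' ?lab //; case: (fP k ltk).
- by rewrite jn' ?jn //; [case: (fP k ltk) | case: (fP l ltl)].
Qed.

Definition box_permb : rel diagram := fun D E => `[< box_perm D E >].

Lemma box_permb_equiv : equiv_class_of box_permb.
Proof.
split=> [D|D E|E D F].
- exact/asboolP/box_perm_refl.
- by apply/asboolP/asboolP; apply: box_perm_sym.
- by move=> /asboolP DE /asboolP EF; apply/asboolP; apply: box_perm_trans DE EF.
Qed.

Canonical box_perm_equiv := EquivRelPack box_permb_equiv.

Definition closed_diagram := {eq_quot box_permb}.
HB.instance Definition _ := Choice.on closed_diagram.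
HB.instance Definition _ := EqQuotient.on closed_diagram.

Lemma eq_closed_diagram (D E : diagram) :
  \pi_closed_diagram D = \pi_closed_diagram E <-> box_perm D E.
Proof.
split=> [/eqquotP/asboolP //|DE].
by apply/eqquotP/asboolP.
Qed.

Lemma repr_closed_diagram (D : diagram) :
  box_perm (repr (\pi_closed_diagram D)) D.
Proof. by apply/eq_closed_diagram; rewrite reprK. Qed.

Lemma diagram0_proof : is_diagram ([::], [::]).
Proof. by []. Qed.

Definition diagram0 := Diagram diagram0_proof.

Definition juxt_val (D E : diagram) : seq 'I_r * seq nat :=
  (boxes D ++ boxes E,
   conn D ++ [seq sumn (map p (boxes D)) + j | j <- conn E]).

Lemma juxt_proof D E : is_diagram (juxt_val D E).
Proof.
have /andP[/eqP D1 D2] := diagramP D; have /andP[/eqP E1 E2] := diagramP E.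
rewrite /is_diagram /juxt_val /= !map_cat !sumn_cat /boxes D1 E1 eqxx /=.
rewrite -D1 -E1 iotaD perm_cat // add0n.
by rewrite -[X in iota X _]addn0 iotaDl perm_map.
Qed.

Definition juxt D E := Diagram (juxt_proof D E).

Lemma boxes_juxt D E : boxes (juxt D E) = boxes D ++ boxes E.
Proof. by []. Qed.

Lemma conn_juxt D E :
  conn (juxt D E) = conn D ++ [seq sumn (map p (boxes D)) + j | j <- conn E].
Proof. by []. Qed.

Lemma size_conn D : size (conn D) = sumn (map p (boxes D)).
Proof. by case/andP: (diagramP D) => _ /perm_size; rewrite size_iota. Qed.

Lemma sumn_boxes D : sumn (map q (boxes D)) = sumn (map p (boxes D)).
Proof. by case/andP: (diagramP D) => /eqP ->. Qed.

Lemma conn_lt D j : j < size (conn D) -> nth 0 (conn D) j < size (conn D).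
Proof.
move=> ltj; rewrite size_conn; have := mem_nth 0 ltj.
by case/andP: (diagramP D) => _ /perm_mem ->; rewrite mem_iota.
Qed.

Lemma joins_lt D k a l b :
  joins D k a l b -> k < size (boxes D) /\ l < size (boxes D).
Proof.
case/and3P=> ak bl _; split; rewrite ltnNge; apply/negP=> le.
  by rewrite nth_default ?size_map in ak.
by rewrite nth_default ?size_map in bl.
Qed.

Lemma flatten_index_cat (s t : seq nat) k a : 
  flatten_index (s ++ t) k a =
    if k < size s then flatten_index s k a
    else sumn s + flatten_index t (k - size s) a.
Proof.
rewrite /flatten_index take_cat; case: ifP => // _.
by rewrite sumn_cat addnA.
Qed.

Lemma joins_juxt D E k a l b :
  joins (juxt D E) k a l b =
    if k < size (boxes D) then (l < size (boxes D)) && joins D k a l b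
    else (size (boxes D) <= l)
         && joins E (k - size (boxes D)) a (l - size (boxes D)) b.
Proof.
rewrite /joins boxes_juxt conn_juxt !map_cat !nth_cat !size_map.
rewrite !flatten_index_cat !size_map.
case: (ltnP k) => ltk; case: (ltnP l) => ltl /=.
- apply: andb_id2l => ak; apply: andb_id2l => bl.
  by rewrite size_conn flatten_indexP.
- apply/negbTE/and3P; case=> ak bl; rewrite size_conn flatten_indexP //.
  apply/negP; rewrite neq_ltn; apply/orP; left.
  apply: leq_trans (conn_lt _) _; first by rewrite size_conn flatten_indexP.
  by rewrite size_conn sumn_boxes leq_addr.
- apply/negbTE/and3P; case=> ak bl; rewrite size_conn ltnNge leq_addr /=.
  rewrite addKn (nth_map 0) ?size_conn ?flatten_indexP //.
  apply/negP; rewrite neq_ltn; apply/orP; right.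
  by rewrite ltn_addr // -sumn_boxes flatten_indexP.
- apply: andb_id2l => ak; apply: andb_id2l => bl.
  rewrite size_conn ltnNge leq_addr /= addKn.
  by rewrite (nth_map 0) ?size_conn ?flatten_indexP // sumn_boxes eqn_add2l.
Qed.

Lemma juxt_box_perm D D' E E' :
  box_perm D D' -> box_perm E E' -> box_perm (juxt D E) (juxt D' E').
Proof.
case=> f [g [fP gP lab jn]] [f' [g' [fP' gP' lab' jn']]].
set m := size (boxes D); set m' := size (boxes D').
have sz A B : size (boxes (juxt A B)) = size (boxes A) + size (boxes B).
  by rewrite boxes_juxt size_cat.
exists (fun k => if k < m then f k else m' + f' (k - m)).
exists (fun k => if k < m' then g k else m + g' (k - m')).
have sub (x y z : nat) : x <= y -> y < x + z -> y - x < z.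
  by move=> xy yz; rewrite ltn_subLR.
split.
- move=> k; rewrite !sz; case: (ltnP k m) => ltk lt.
    have [fk gfk] := fP k ltk; rewrite fk gfk; split=> //.
    exact: ltn_addr.
  have [fk gfk] := fP' _ (sub _ _ _ ltk lt).
  rewrite ltn_add2l fk; split=> //.
  by rewrite ltnNge leq_addr /= addKn gfk subnKC.
- move=> k; rewrite !sz; case: (ltnP k m') => ltk lt.
    have [fk gfk] := gP k ltk; rewrite fk gfk; split=> //.
    exact: ltn_addr.
  have [fk gfk] := gP' _ (sub _ _ _ ltk lt).
  rewrite ltn_add2l fk; split=> //.
  by rewrite ltnNge leq_addr /= addKn gfk subnKC.
- move=> k; rewrite !sz !boxes_juxt !onth_cat.
  rewrite -/m -/m'; case: (ltnP k m) => ltk lt.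
    by have [fk gfk] := fP k ltk; rewrite fk lab.
  by rewrite ltnNge leq_addr /= addKn lab' // sub.
- move=> k a l b; rewrite !sz !joins_juxt -/m -/m'.
  case: (ltnP k m) => ltk ltk'; case: (ltnP l m) => ltl ltl'.
  + by have [-> _] := fP k ltk; have [-> _] := fP l ltl; rewrite jn.
  + by have [-> _] := fP k ltk; rewrite ltnNge leq_addr.
  + have [fl _] := fP l ltl.
    by rewrite [m' + _ < m']ltnNge leq_addr /= leqNgt fl.
  + by rewrite ltnNge !leq_addr /= !addKn jn' ?sub.
Qed.

Lemma eq_diagram D E : boxes D = boxes E -> conn D = conn E -> D = E.
Proof.
move=> eb ec; apply: val_inj => /=; move: eb ec; rewrite /boxes /conn.
by case: (diagram_val D) => ? ?; case: (diagram_val E) => ? ? /= -> ->.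
Qed.

Lemma juxtA : associative juxt.
Proof.
move=> D E F; apply: eq_diagram; first by rewrite !boxes_juxt catA.
rewrite !conn_juxt boxes_juxt !map_cat sumn_cat catA -map_comp.
by congr (_ ++ _); apply: eq_map => j; rewrite /= addnA.
Qed.

Lemma juxt0D : left_id diagram0 juxt.
Proof.
by move=> D; apply: eq_diagram; rewrite /boxes /conn //= map_id.
Qed.

Lemma juxtD0 : right_id diagram0 juxt.
Proof. by move=> D; apply: eq_diagram; rewrite /boxes /conn /= cats0. Qed.

Lemma juxtC D E : box_perm (juxt D E) (juxt E D).
Proof.
have sz A B : size (boxes (juxt A B)) = size (boxes A) + size (boxes B).
  by rewrite boxes_juxt size_cat.
set m := size (boxes D); set n := size (boxes E).
exists (fun k => if k < m then n + k else k - m).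
exists (fun k => if k < n then m + k else k - n).
split; rewrite ?sz -/m -/n.
- move=> k; case: (ltnP k m) => ltk lt.
    by rewrite ltn_add2l ltk ltnNge leq_addr /= addKn.
  have kn: k - m < n by rewrite ltn_subLR.
  by rewrite kn subnKC // ltn_addr.
- move=> k; case: (ltnP k n) => ltk lt.
    by rewrite ltn_add2l ltk ltnNge leq_addr /= addKn.
  have kn: k - n < m by rewrite ltn_subLR.
  by rewrite kn subnKC // ltn_addr.
- move=> k lt; rewrite !boxes_juxt !onth_cat -/m -/n.
  case: (ltnP k m) => ltk; first by rewrite ltnNge leq_addr /= addKn.
  by rewrite ltn_subLR // lt.
- move=> k a l b; rewrite !joins_juxt -/m -/n.
  case: (ltnP k m) => ltk ltk'; case: (ltnP l m) => ltl ltl'.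
  + by rewrite ltnNge !leq_addr /= !addKn.
  + by rewrite ltnNge leq_addr /= leqNgt ltn_subLR // ltl'.
  + by rewrite ltn_subLR // ltk' /= ltnNge leq_addr.
  + by rewrite !ltn_subLR // ltk' ltl'.
Qed.

Definition cd1 : closed_diagram := \pi_closed_diagram diagram0.
Definition cdmul (x y : closed_diagram) : closed_diagram :=
  \pi_closed_diagram (juxt (repr x) (repr y)).

Lemma cdmul_pi D E :
  cdmul (\pi_closed_diagram D) (\pi_closed_diagram E) = \pi_closed_diagram (juxt D E).
Proof.
by apply/eq_closed_diagram/juxt_box_perm; apply: repr_closed_diagram.
Qed.

Lemma cdmulA : associative cdmul.
Proof.
move=> x y z; rewrite -[x]reprK -[y]reprK -[z]reprK.
move: (repr x) (repr y) (repr z) => D E F.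
by rewrite (cdmul_pi E F) (cdmul_pi D E) (cdmul_pi D) (cdmul_pi _ F) juxtA.
Qed.

Lemma cdmulC : commutative cdmul.
Proof.
move=> x y; rewrite -[x]reprK -[y]reprK !cdmul_pi.
exact/eq_closed_diagram/juxtC.
Qed.

Lemma cdmul1 : left_id cd1 cdmul.
Proof. by move=> x; rewrite -[x]reprK cdmul_pi juxt0D. Qed.

Lemma cdmul1r : right_id cd1 cdmul.
Proof. by move=> x; rewrite cdmulC cdmul1. Qed.

Lemma cdmul_unit x y : cdmul x y = cd1 -> x = cd1 /\ y = cd1.
Proof.
rewrite -[x]reprK -[y]reprK cdmul_pi.
case/eq_closed_diagram=> f [g [fP _ _ _]].
have nil (D : diagram) : boxes D = [::] -> \pi_closed_diagram D = cd1.
  move=> D0; congr (\pi_closed_diagram _); apply: eq_diagram => //.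
  by apply: size0nil; rewrite size_conn D0.
have: size (boxes (repr x) ++ boxes (repr y)) = 0.
  by apply/eqP; rewrite -leqn0 leqNgt; apply/negP => lt0; case: (fP 0 lt0).
rewrite size_cat => /eqP; rewrite addn_eq0 => /andP[/nilP x0 /nilP y0].
by split; apply: nil.
Qed.

HB.instance Definition _ :=
  Choice_isMonomialDef.Build closed_diagram cdmulA cdmul1 cdmul1r cdmul_unit.
HB.instance Definition _ := MonomialDef_isConomialDef.Build closed_diagram cdmulC.

Definition cdeg (x : closed_diagram) (i : 'I_r) : nat :=
  count_mem i (boxes (repr x)).

Lemma box_perm_boxes D E : box_perm D E -> perm_eq (boxes D) (boxes E).
Proof.
case=> f [g [fP gP lab _]].
have tab (w : seq 'I_r) : map Some w = [seq onth w k | k <- iota 0 (size w)].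
  apply: (@eq_from_nth _ None); rewrite ?size_map ?size_iota // => k lt.
  by rewrite -onthE (nth_map 0) ?size_iota // nth_iota.
apply: (@perm_map_inj _ _ Some); first by move=> ? ? [].
rewrite !tab.
rewrite (_ : [seq _ | k <- _] =
             map (onth (boxes E)) (map f (iota 0 (size (boxes D))))).
  apply: perm_map; apply: uniq_perm; rewrite ?iota_uniq //.
    rewrite map_inj_in_uniq ?iota_uniq // => k l; rewrite !mem_iota /=.
    by move=> /fP[_ {2}<-] /fP[_ {2}<-] ->.
  move=> k; rewrite mem_iota /= add0n; apply/mapP/idP.
    by case=> l; rewrite mem_iota => /fP[? _] ->.
  by case/gP=> gk fgk; exists (g k); rewrite ?mem_iota.
rewrite -map_comp; apply/eq_in_map => k; rewrite mem_iota => ltk /=.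
by rewrite lab.
Qed.

Lemma cdeg_pi D i : cdeg (\pi_closed_diagram D) i = count_mem i (boxes D).
Proof. exact/seq.permP/box_perm_boxes/repr_closed_diagram. Qed.

Lemma cdegM x y i : cdeg (cdmul x y) i = cdeg x i + cdeg y i.
Proof.
rewrite -[x]reprK -[y]reprK cdmul_pi !cdeg_pi boxes_juxt.
exact: count_cat.
Qed.

Section StandardDiagrams.
Variable nn : 'I_r -> nat.
Hypothesis balanced : \sum_i nn i * p i = \sum_i nn i * q i.

Definition std_boxes : seq 'I_r := flatten [seq nseq (nn i) i | i <- enum 'I_r].

Lemma sumn_std_boxes (t : 'I_r -> nat) :
  sumn (map t std_boxes) = \sum_i nn i * t i.
Proof.
rewrite /std_boxes map_flatten sumn_flatten sumnE 3!big_map big_enum.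
by apply: eq_bigr => i _; rewrite /= map_nseq sumn_nseq mulnC.
Qed.

Lemma std_proof (s : 'S_(\sum_i nn i * p i)) :
  is_diagram (std_boxes, [seq val (s j) | j <- enum 'I_(\sum_i nn i * p i)]).
Proof.
rewrite /is_diagram /= !sumn_std_boxes -balanced eqxx /=.
rewrite -val_enum_ord (map_comp val) perm_map //.
apply: uniq_perm; rewrite ?enum_uniq ?(map_inj_uniq perm_inj) ?enum_uniq //.
move=> j; rewrite mem_enum; apply/mapP; exists (s^-1 j); rewrite ?mem_enum //.
by rewrite permKV.
Qed.

Definition std_diagram (s : 'S_(\sum_i nn i * p i)) : closed_diagram :=
  \pi_closed_diagram (Diagram (std_proof s)).

End StandardDiagrams.

End Diagrams.

Arguments closed_diagram {r} p q.

Local Open Scope ring_scope.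

(* Since closed_diagram is a conomType for juxtaposition, this is a commutative
   K-algebra with juxtaposition of diagrams as product. *)
Definition diagram_alg (K : fieldType) (r : nat) (p q : 'I_r -> nat) :=
  {malg K[closed_diagram p q]}.

Section Dimension.
Variables (K : fieldType) (V : lmodType K).

Definition linear_span (S : V -> Prop) (v : V) : Prop :=
  exists (m : nat) (c : 'I_m -> K) (b : 'I_m -> V),
    (forall i, S (b i)) /\ v = \sum_i c i *: b i.

(* For subspaces S and I of V, the image of S in V / I has dimension N: the
   classes of b form a basis of it. *)
Definition has_dim_mod (I S : V -> Prop) (N : nat) : Prop :=
  exists b : 'I_N -> V,
    (forall i, S (b i)) /\
    (forall v, S v -> exists! c : {ffun 'I_N -> K}, I (v - \sum_i c i *: b i)).

Definition has_dim (S : V -> Prop) (N : nat) : Prop :=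
  has_dim_mod (fun v => v = 0) S N.

End Dimension.

Section IdealsAndGrading.
Variables (K : fieldType) (r : nat) (p q : 'I_r -> nat).

Definition homogeneous (nn : 'I_r -> nat) (x : diagram_alg K p q) : Prop :=
  forall D, D \in msupp x -> forall i, cdeg D i = nn i.

(* Products of permutations are read from left to right in MathComp, so
   t2 * s * t1 is the composite of t1, s and t2, with t2 applied first. *)
Definition ideal_d_generator (d : nat) (x : diagram_alg K p q) : Prop :=
  exists (nn : 'I_r -> nat)
    (e : (\sum_i nn i * p i = \sum_i nn i * q i)%N)
    (t1 t2 : 'S_(\sum_i nn i * p i)%N),
    (d < \sum_i nn i * p i)%N /\
    x = \sum_(s : 'S_(\sum_i nn i * p i)%N
               | perm_on [set j : 'I_(\sum_i nn i * p i)%N | (j <= d)%N] s)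
          (-1) ^+ (odd_perm s) *: << std_diagram e (t2 * s * t1)%g >>.

Definition ideal_d (d : nat) : diagram_alg K p q -> Prop := linear_span (ideal_d_generator d).

End IdealsAndGrading.

(* The value at nn of the Hilbert function of K[X], respectively of K[X]/I_d,
   is N. *)
Definition hilbert (K : fieldType) (r : nat) (p q nn : 'I_r -> nat) (N : nat) :=
  has_dim (@homogeneous K r p q nn) N.

Definition hilbert_mod (K : fieldType) (r : nat) (p q : 'I_r -> nat) (d : nat)
    (nn : 'I_r -> nat) (N : nat) :=
  has_dim_mod (@ideal_d K r p q d) (@homogeneous K r p q nn) N.

Definition is_partition (n : nat) (la : seq nat) :=
  [&& sorted geq la, 0%N \notin la & sumn la == n].

(* The bounds on the number and the size of the parts hold for every
   partition of n, and make this a finite type. *)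
Record partition (n : nat) := Partition {
  partition_bseq : n.-bseq 'I_n.+1;
  _ : is_partition n (map val partition_bseq)
}.

HB.instance Definition _ n := [isSub for @partition_bseq n].
HB.instance Definition _ n := [Finite of partition n by <:].

Definition parts n (la : partition n) : seq nat := map val (partition_bseq la).

Section Specht.
Variables (K : fieldType) (n : nat) (la : seq nat).

(* The boxes of la are numbered from 0, row by row, so that j lies in row
   reshape_index la j and in column reshape_offset la j. *)
Definition row_stab : {set 'S_n} :=
  [set s : 'S_n | [forall j, reshape_index la (s j) == reshape_index la j]].
Definition col_stab : {set 'S_n} :=
  [set s : 'S_n | [forall j, reshape_offset la (s j) == reshape_offset la j]].

Definition gring_elt (s : 'S_n) : 'rV[K]_#|[set: 'S_n]| :=
  delta_mx 0 (gring_index [set: 'S_n]%G s).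

(* The action on row vectors is on the right and products of permutations are
   read from left to right: for the usual composition of permutations this is
   the left ideal of K[S_n] generated by the Young symmetrizer. *)
Definition young_symmetrizer : 'rV[K]_#|[set: 'S_n]| :=
  \sum_(a in row_stab) \sum_(b in col_stab)
    (-1) ^+ (odd_perm b) *: gring_elt (b * a)%g.

Definition specht_mx := cyclic_mx (regular_repr K [set: 'S_n]) young_symmetrizer.

Definition specht_dim := \rank specht_mx.

Definition specht : mx_representation K [set: 'S_n] specht_dim :=
  submod_repr (cyclic_mx_module (regular_repr K [set: 'S_n]) young_symmetrizer).

End Specht.

Section TensorMatrix.
Variables (K : fieldType) (I : finType) (d : I -> nat).

(* The rows and columns of the tensor product are indexed by the families of
   indices of the factors. *)
Definition tensor_dim := #|{dffun forall i, 'I_(d i)}|.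

Definition tensor_index (a : 'I_tensor_dim) : {dffun forall i, 'I_(d i)} :=
  enum_val a.

Definition tensor_mx (A : forall i, 'M[K]_(d i)) : 'M[K]_tensor_dim :=
  \matrix_(a, b) \prod_i A i (tensor_index a i) (tensor_index b i).

Lemma tensor_mx1 (A : forall i, 'M[K]_(d i)) :
  (forall i, A i = 1%:M) -> tensor_mx A = 1%:M.
Proof.
move=> A1; apply/matrixP=> a b; rewrite !mxE.
have [<- | /eqP neq] := eqVneq a b.
  by apply: big1 => i _; rewrite A1 mxE eqxx.
have [i nei]: exists i, tensor_index a i != tensor_index b i.
  apply/existsP; apply: contra_notT neq; rewrite negb_exists => /forallP eqi.
  apply: enum_val_inj; apply/ffunP=> i; apply/eqP.
  by rewrite -[_ == _]negbK eqi.
by rewrite (bigD1 i) //= A1 mxE (negbTE nei) mul0r.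
Qed.

Lemma sum_dffun_prod (F : forall i, 'I_(d i) -> K) :
  \sum_(f : {dffun forall i, 'I_(d i)}) \prod_i F i (f i) =
  \prod_i \sum_j F i j.
Proof.
pose T i : finType := 'I_(d i).
rewrite (reindex (@dffun_of_fprod I T)); last first.
  exact/onW_bij/dffun_of_fprod_bij.
pose P i : {ffun T i -> K} := [ffun j => F i j].
transitivity (\sum_(t : fprod T) \prod_(i in I) P i (t i)).
  by apply: eq_bigr => t _; apply: eq_bigr => i _; rewrite !ffunE.
rewrite big_fprod.
rewrite -(bigA_distr_big_dep _ (fun i j => untag 0 (P i) j)).
apply: eq_bigr => i _; rewrite -(big_tag (fun i j => P i j)).
by apply: eq_bigr => j _; rewrite ffunE.
Qed.

Lemma tensor_mxM (A B C : forall i, 'M[K]_(d i)) :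
  (forall i, C i = A i *m B i) -> tensor_mx C = tensor_mx A *m tensor_mx B.
Proof.
move=> CE; apply/matrixP=> a b; rewrite !mxE.
under eq_bigr do rewrite CE mxE.
rewrite -(sum_dffun_prod (fun i j => A i _ j * B i j _)) big_enum_val.
by apply: eq_bigr => c _; rewrite !mxE -big_split.
Qed.

End TensorMatrix.

Section Tensor.
Variables (K : fieldType) (I : finType).

Section Inner.
Variables (gT : finGroupType) (G : {group gT}) (d : I -> nat).
Variable rho : forall i, mx_representation K G (d i).

Lemma tensor_mx_repr : mx_repr G (fun x => tensor_mx (fun i => rho i x)).
Proof.
split=> [|x y Gx Gy]; first by apply: tensor_mx1 => i; rewrite repr_mx1.
by apply: tensor_mxM => i; rewrite repr_mxM.
Qed.

Definition tensor_repr := MxRepresentation tensor_mx_repr.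
End Inner.

Section Outer.
Variables (gT : I -> finGroupType) (d : I -> nat).
Variable rho : forall i, mx_representation K [set: gT i] (d i).

Lemma box_tensor_mx_repr :
  mx_repr [set: {dffun forall i, gT i}]
    (fun x => tensor_mx (fun i => rho i (x i))).
Proof.
split=> [|x y _ _].
  by apply: tensor_mx1 => i; rewrite ffunE repr_mx1.
by apply: tensor_mxM => i; rewrite ffunE repr_mxM ?inE.
Qed.

Definition box_tensor_repr := MxRepresentation box_tensor_mx_repr.
End Outer.

End Tensor.

Section YoungSubgroup.
Variables (k : nat) (m : 'I_k -> nat).

(* The permutation of the \sum_i m i points which acts by s i on the i-th of
   the consecutive blocks of sizes m i. *)
Definition young_fun (s : {dffun forall i, 'S_(m i)}) (x : 'I_(\sum_i m i)) :=
  tagnat.Rank (tagnat.sig1 x) (s (tagnat.sig1 x) (tagnat.sig2 x)).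

Lemma young_funE (s : {dffun forall i, 'S_(m i)}) i (j : 'I_(m i)) :
  young_fun s (tagnat.Rank i j) = tagnat.Rank i (s i j).
Proof. by rewrite /young_fun /tagnat.sig2 /tagnat.sig1 tagnat.rankK. Qed.

Lemma young_fun_inj s : injective (young_fun s).
Proof.
move=> x y; rewrite -[x]tagnat.sig2K -[y]tagnat.sig2K.
move: (tagnat.sig1 x) (tagnat.sig2 x) (tagnat.sig1 y) (tagnat.sig2 y).
move=> i a j b; rewrite !young_funE => /(@tagnat.rank_inj _ _) e.
have ij: i = j by case: e.
case: j / ij b e => b /eqP; rewrite eq_Tagged => /eqP e.
by congr (tagnat.Rank _ _); apply: (@perm_inj _ (s i)).
Qed.

Definition young_perm s : 'S_(\sum_i m i) := perm (@young_fun_inj s).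

Lemma young_perm1 : young_perm 1%g = 1%g.
Proof.
by apply/permP=> x; rewrite permE perm1 /young_fun ffunE perm1 tagnat.sig2K.
Qed.

Lemma young_permM s t : young_perm (s * t)%g = (young_perm s * young_perm t)%g.
Proof.
apply/permP=> x; rewrite permM !permE -[x]tagnat.sig2K !young_funE.
by rewrite ffunE permM.
Qed.

Section Restriction.
Variables (K : fieldType) (d : nat).
Variable rho : mx_representation K [set: 'S_(\sum_i m i)] d.

Lemma young_mx_repr :
  mx_repr [set: {dffun forall i, 'S_(m i)}] (fun s => rho (young_perm s)).
Proof.
split=> [|s t _ _]; first by rewrite young_perm1 repr_mx1.
by rewrite young_permM repr_mxM ?inE.
Qed.

Definition young_restriction := MxRepresentation young_mx_repr.
End Restriction.

End YoungSubgroup.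

Section Multiplicity.
Variables (K : decFieldType) (gT : finGroupType) (G : {group gT}).

(* The index ranges over the isotypic components of W: at most one of them
   has its simple submodules isomorphic to the irreducible module V. *)
Definition multiplicity (dV dW : nat) (V : mx_representation K G dV)
    (W : mx_representation K G dW) : nat :=
  (\sum_(C : DecSocleType W | `[< mx_rsim V (socle_repr C) >]) socle_mult C)%N.

End Multiplicity.

Section Homs.
Variables (K : fieldType) (gT : finGroupType) (G : {group gT}).

Definition hom_space (dV dW : nat) (V : mx_representation K G dV)
    (W : mx_representation K G dW) : {vspace 'M[K]_(dV, dW)} :=
  (\bigcap_(x in G) lker (linfun (fun B => V x *m B - B *m W x)))%VS.

Lemma triv_mx_repr : mx_repr G (fun=> 1%:M : 'M[K]_1).
Proof. by split=> // x y _ _; rewrite mulmx1. Qed.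

Definition triv_repr := MxRepresentation triv_mx_repr.

Lemma mem_hom_space (dV dW : nat) (V : mx_representation K G dV)
    (W : mx_representation K G dW) (B : 'M[K]_(dV, dW)) :
  reflect (forall x, x \in G -> V x *m B = B *m W x) (B \in hom_space V W).
Proof.
have lin x : linear (fun B : 'M[K]_(dV, dW) => V x *m B - B *m W x).
  move=> a A C; rewrite mulmxDr mulmxDl -scalemxAr -scalemxAl scalerBr.
  by rewrite opprD addrACA.
have kerE x : (B \in lker (linfun (fun B => V x *m B - B *m W x)))
              = (V x *m B == B *m W x).
  pose L := GRing.isLinear.Build K _ _ _ _ (lin x).
  pose F : {linear _ -> _} := HB.pack (fun B => V x *m B - B *m W x) L.
  by rewrite memv_ker (lfunE F) /= subr_eq0.
apply: (iffP idP) => [BH x Gx | BH].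
  apply/eqP; rewrite -kerE; move: BH; rewrite memvE => /subv_bigcapP/(_ x Gx).
  by rewrite -memvE.
by rewrite memvE; apply/subv_bigcapP => x Gx; rewrite -memvE kerE BH.
Qed.

End Homs.

Section Coefficients.
Variable K : closedFieldType.

Definition nth_part (ls : seq (seq nat)) (i : 'I_(size ls)) : seq nat :=
  nth [::] ls i.

(* The multiplicity is that of a module in a representation of the product of
   the groups S_(m i), where m i is the size of the i-th partition of ls. *)
Definition lr_coef (la : seq nat) (ls : seq (seq nat)) : nat :=
  let m (i : 'I_(size ls)) := sumn (nth_part i) in
  multiplicity (box_tensor_repr (fun i => specht K (m i) (nth_part i)))
    (young_restriction (specht K (\sum_i m i)%N la)).

Definition kronecker_coef (m : nat) (ls : seq (seq nat)) : nat :=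
  \dim (hom_space
    (tensor_repr (fun i : 'I_(size ls) => specht K m (nth_part i)))
    (triv_repr K [set: 'S_m])).

End Coefficients.

Section HilbertSum.
Variables (K : closedFieldType) (r : nat) (p q nn : 'I_r -> nat).

Definition partition_families (t : 'I_r -> nat) :=
  {dffun forall i, (t i).-tuple (partition (nn i))}.

Definition flat_parts (t : 'I_r -> nat) (mu : partition_families t) :
    seq (seq nat) :=
  flatten [seq [seq parts x | x <- mu i] | i <- enum 'I_r].

Definition hilbert_sum (P : pred (seq nat)) : nat :=
  (\sum_(la : partition (\sum_i nn i * p i) | P (parts la))
   \sum_(mu : partition_families p)
   \sum_(nu : partition_families q)
   \sum_(rho : {dffun forall i, partition (nn i)})
     lr_coef K (parts la) (flat_parts mu)
     * lr_coef K (parts la) (flat_parts nu)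
     * (\prod_i kronecker_coef K (nn i)
                  (rcons [seq parts x | x <- mu i] (parts (rho i))))
     * (\prod_i kronecker_coef K (nn i)
                  (rcons [seq parts x | x <- nu i] (parts (rho i)))))%N.

End HilbertSum.

(* Main.v *)
(* In degree n_1, ..., n_r the closed diagrams are the orbits in S_n of
   H = S_{n_1} x ... x S_{n_r}, which acts on the left through the output strings
   and on the right through the input strings of the boxes. So this component of
   K[X] is the space of H-coinvariants of K[S_n], and I_d corresponds to the
   two-sided ideal generated by the antisymmetrizer on d+1 points. This ideal is
   the sum of the isotypic components of the partitions with more than d rows:
   the antisymmetrizer kills the row symmetrizer of a partition with at most d
   rows by the pigeonhole principle, and divides the column antisymmetrizer of a
   longer one. The quotient is therefore the image of an explicit idempotent
   endomorphism of K[S_n], whose trace is the sum over the partitions la with at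
   most d rows of the average over h in H of chi_la(out h) chi_la(in h). Expanding
   chi_la on Young subgroups and products of characters on S_{n_i} in irreducible
   characters turns this average into the sum of products of coefficients. In
   characteristic 0 it is enough to prove the equality in K. *)
From HB Require Import structures.
From mathcomp Require Import all_boot all_order all_fingroup all_algebra.
From mathcomp Require Import mxrepresentation generic_quotient pgroup ring.
From mathcomp Require Import boolp finmap monalg.
Require Import Defs.

Set Implicit Arguments.
Unset Strict Implicit.
Unset Printing Implicit Defensive.

Import GRing.Theory.
Import GroupScope.
Local Open Scope nat_scope.

(** * Tableaux and the dominance order *)

(** One bilinear form carries the count: [tau u v], the trace of x |-> u x v on K[S_n]. Identities
    for it stand in for the structure theory of K[S_n]: a Young symmetrizer has nonzero square
    because a square-zero endomorphism has trace 0; the inner product of two Specht characters is,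
    up to a scalar, [tau] of two Young symmetrizers; and [tau] of two permutations g, h is the sum
    of all chi_la(g) chi_la(h). That these characters exhaust the class functions comes from
    counting, since cycle types are again partitions of n. A permutation and its inverse have the
    same cycle type, so chi_la(out h) appears without an inverse although h acts by s |-> out(h)^-1
    s in(h). A string is a pair of a box and a place in it. A permutation of the n_i boxes is
    repeated at every place, so out h and in h are diagonal elements of Young subgroups with one
    block for each label and place. *)

Section Shape.
Variables (n : nat) (la : seq nat).
Hypothesis laP : is_partition n la.

Lemma partition_sumn : sumn la = n.
Proof. by case/and3P: laP => _ _ /eqP. Qed.

Lemma nth_partition_le r r' : r <= r' -> nth 0 la r' <= nth 0 la r.
Proof.
move=> le; case: (ltnP r' (size la)) => [lt|ge]; last by rewrite nth_default.
case/and3P: laP => srt _ _.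
have trg : transitive geq by move=> a b c ba cb; apply: leq_trans cb ba.
by apply: (sorted_leq_nth trg _ 0 srt) => //; rewrite ?inE ?(leq_ltn_trans le) //; apply: leqnn.
Qed.

Lemma shape_inj (i j : 'I_n) :
  reshape_index la i = reshape_index la j ->
  reshape_offset la i = reshape_offset la j -> i = j.
Proof.
by move=> er ec; apply: val_inj; rewrite /= -(reshape_indexK la i) er ec reshape_indexK.
Qed.

Lemma shape_lt (j : 'I_n) : reshape_offset la j < nth 0 la (reshape_index la j).
Proof. by apply: reshape_offsetP; rewrite partition_sumn. Qed.

Lemma shape_row_lt (j : 'I_n) : reshape_index la j < size la.
Proof. by apply: reshape_indexP; rewrite partition_sumn. Qed.

Lemma shape_off_lt (j : 'I_n) : reshape_offset la j < n.
Proof. by apply: leq_ltn_trans (ltn_ord j); apply: leq_subr. Qed.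

Lemma card_shape_row r : #|[set j : 'I_n | reshape_index la j == r]| = nth 0 la r.
Proof.
have ltn (c : 'I_(nth 0 la r)) : flatten_index la r c < n.
  by rewrite -partition_sumn flatten_indexP.
rewrite -[RHS]card_ord -(@card_imset _ _ (fun c => Ordinal (ltn c))).
  apply: eq_card => j; rewrite inE; apply/eqP/imsetP => [jr | [c _ ->]].
    have lt : reshape_offset la j < nth 0 la r by rewrite -jr shape_lt.
    exists (Ordinal lt) => //; apply: val_inj => /=.
    by rewrite -jr reshape_indexK.
  by rewrite /= flatten_indexKl.
by move=> c c' [] /addnI /val_inj.
Qed.
End Shape.

(** Zero is not a part, so the default 0 of [nth] marks the end of the list and equal entries force
    equal sizes. *)
Lemma partition_eq n la mu : is_partition n la -> is_partition n mu ->
  (forall k, nth 0 la k = nth 0 mu k) -> la = mu.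
Proof.
move=> laP muP e.
have szle la' mu' : is_partition n la' -> (forall k, nth 0 la' k = nth 0 mu' k) ->
    size la' <= size mu'.
  case/and3P=> _ l0 _ e'; rewrite leqNgt; apply/negP => lt.
  by case/negP: l0; rewrite -(nth_default 0 (leqnn (size mu'))) -e' mem_nth.
apply: (@eq_from_nth _ 0) => //.
by apply/eqP; rewrite eqn_leq !szle.
Qed.

Section Dominance.
Variables (n : nat) (la mu : seq nat) (x : 'S_n).
Hypotheses (laP : is_partition n la) (muP : is_partition n mu).
Local Notation rowl := (reshape_index la).
Local Notation rowm := (reshape_index mu).
Local Notation colm := (reshape_offset mu).

Hypothesis goodx : forall i j : 'I_n,
  rowl i = rowl j -> colm (x i) = colm (x j) -> i = j.

Let f k c := #|[set j : 'I_n | (rowl j < k) && (colm (x j) == c)]|.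
Let g k c := #|[set j : 'I_n | (rowm j < k) && (colm j == c)]|.

(* If x sends the cells of each row of la to distinct columns of mu, then each
   column c of mu contains at most min(k, height of c) images of cells from the
   first k rows of la, and this is the number of its own cells in these rows. *)
Lemma dominance_col k c : f k c <= g k c.
Proof.
have [/existsP[j0 /andP[kj0 /eqP cj0]] | /existsPn none] :=
  boolP [exists j : 'I_n, (k <= rowm j) && (colm j == c)].
  apply: (@leq_trans k).
    rewrite /f -[k in _ <= k]card_ord -(@card_in_imset _ _ (fun j : 'I_n => inord (rowl j) : 'I_k.-1.+1)).
      case: (k) => [|k']; last by apply: leq_trans (max_card _) _; rewrite !card_ord.
      by rewrite (_ : [set _ | _] = set0) ?imset0 ?cards0 //; apply/setP=> j; rewrite !inE.
    move=> i j; rewrite !inE => /andP[ki /eqP ci] /andP[kj /eqP cj].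
    move/(congr1 val); rewrite /= !inordK ?(ltn_predK ki) //.
    by move=> /goodx; apply; rewrite ci cj.
  have pt (r : 'I_k) : flatten_index mu r c < n.
    rewrite -(partition_sumn muP) flatten_indexP // -cj0.
    apply: leq_trans (shape_lt muP j0) _; apply: nth_partition_le muP _ _ _.
    exact: leq_trans (ltnW (ltn_ord r)) kj0.
  have lt (r : 'I_k) : c < nth 0 mu r.
    rewrite -cj0.
    apply: leq_trans (shape_lt muP j0) _; apply: nth_partition_le muP _ _ _.
    exact: leq_trans (ltnW (ltn_ord r)) kj0.
  rewrite -[k in k <= _]card_ord -(@card_imset _ _ (fun r => Ordinal (pt r))).
    apply/subset_leq_card/subsetP=> _ /imsetP[r _ ->]; rewrite inE /=.
    by rewrite flatten_indexKl // flatten_indexKr // ltn_ord eqxx.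
  move=> r r' [] /(congr1 (reshape_index mu)).
  by rewrite !flatten_indexKl // => /val_inj.
rewrite /f -(card_imset _ (@perm_inj _ x)); apply/subset_leq_card/subsetP=> _ /imsetP[j + ->].
rewrite !inE => /andP[_ cj]; rewrite cj andbT ltnNge.
by have := none (x j); rewrite cj andbT.
Qed.

Let sum_f k : \sum_(c < n) f k c = #|[set j : 'I_n | rowl j < k]|.
Proof.
rewrite -[RHS]sum1_card [RHS](partition_big (fun j : 'I_n => Ordinal (shape_off_lt mu (x j))) predT) //=.
apply: eq_bigr => c _; rewrite /f -sum1_card; apply: eq_bigl => j.
by rewrite !inE -val_eqE.
Qed.

Let sum_g k : \sum_(c < n) g k c = #|[set j : 'I_n | rowm j < k]|.
Proof.
rewrite -[RHS]sum1_card [RHS](partition_big (fun j : 'I_n => Ordinal (shape_off_lt mu j)) predT) //=.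
apply: eq_bigr => c _; rewrite /g -sum1_card; apply: eq_bigl => j.
by rewrite !inE -val_eqE.
Qed.

Lemma dominance k : #|[set j : 'I_n | rowl j < k]| <= #|[set j : 'I_n | rowm j < k]|.
Proof. by rewrite -sum_f -sum_g; apply: leq_sum => c _; apply: dominance_col. Qed.

(** For equal shapes the inequalities of [dominance_col] have equal sums over the columns, so all
    are equalities. The cell [j] makes [f] grow at row [rowl j] in the column of [x j], so [g] grows
    there too: that column has a cell in this row. *)
Lemma dominance_pt (e : la = mu) (j : 'I_n) :
  exists i : 'I_n, rowl i = rowl j /\ colm i = colm (x j).
Proof.
pose c := Ordinal (shape_off_lt mu (x j)).
have fg k : f k c = g k c.
  apply/eqP; rewrite eqn_leq dominance_col leqNgt; apply/negP => lt.
  have: \sum_(c < n) f k c < \sum_(c < n) g k c.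
    rewrite (bigD1 c) //= [in ltnRHS](bigD1 c) //= -addSn leq_add //.
    by apply: leq_sum => c' _; apply: dominance_col.
  by rewrite sum_f sum_g e ltnn.
have: f (rowl j) c < f (rowl j).+1 c.
  apply: proper_card; apply/properP; split.
    by apply/subsetP => i; rewrite !inE => /andP[/ltnW lt ->]; rewrite ltnS lt.
  by exists j; rewrite !inE ?ltnn // leqnn eqxx.
rewrite !fg => lt.
have [i iS iN]: exists2 i, i \in [set i : 'I_n | (rowm i < (rowl j).+1) && (colm i == c)]
                & i \notin [set i : 'I_n | (rowm i < rowl j) && (colm i == c)].
  by apply/subsetPn; apply: contraL lt => /subset_leq_card; rewrite -leqNgt.
move: iS iN; rewrite !inE => /andP[le /eqP ci]; rewrite ci eqxx andbT -leqNgt => ge.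
rewrite e in le ge *; exists i; split=> //; apply/eqP.
by rewrite eqn_leq -ltnS le ge.
Qed.
End Dominance.

Lemma dominance_anti n la mu (laP : is_partition n la) (muP : is_partition n mu) :
  (forall k, #|[set j : 'I_n | reshape_index la j < k]|
             = #|[set j : 'I_n | reshape_index mu j < k]|) -> la = mu.
Proof.
move=> e; apply: (partition_eq laP muP) => k.
have S nu (nuP : is_partition n nu) : #|[set j : 'I_n | reshape_index nu j < k.+1]| =
   (#|[set j : 'I_n | reshape_index nu j < k]| + nth 0 nu k)%N.
  rewrite -(card_shape_row nuP) -cardsUI [X in _ = (_ + X)%N](_ : _ = 0) ?addn0.
    by apply: eq_card => j; rewrite !inE ltnS leq_eqVlt orbC.
  by apply: eq_card0 => j; rewrite !inE; case: ltngtP.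
by have := e k.+1; rewrite !S // e => /addnI.
Qed.

(** * Diagrams with a fixed set of boxes *)

Section Positions.
Variables (B : finType) (L : seq B) (c : B -> nat).
Hypotheses (uL : uniq L) (cL : forall b, b \in L).
Local Notation P := {b : B & 'I_(c b)}.

Definition string_pos (u : P) := flatten_index (map c L) (index (tag u) L) (tagged u).

Lemma nth_index_map b : nth 0 (map c L) (index b L) = c b.
Proof. by rewrite (nth_map b) ?index_mem // nth_index. Qed.

Lemma string_pos_lt u : string_pos u < sumn (map c L).
Proof. by apply: flatten_indexP; rewrite nth_index_map. Qed.

Lemma string_pos_inj : injective string_pos.
Proof.
move=> [b a] [b' a'] e.
have := congr1 (reshape_index (map c L)) e; have := congr1 (reshape_offset (map c L)) e.
rewrite /string_pos !flatten_indexKl ?flatten_indexKr ?nth_index_map //=.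
move=> ea /(congr1 (nth b L)); rewrite !nth_index // => eb.
by case: b' / eb a' ea {e} => a' /val_inj ->.
Qed.

Lemma string_pos_surj x : x < sumn (map c L) -> exists u, string_pos u = x.
Proof.
move=> lt; have := reshape_indexP lt; rewrite size_map => ltr.
have [b0 _] : exists b : B, True by case: (L) ltr => // b s _; exists b.
have lto := reshape_offsetP lt; rewrite (nth_map b0) // in lto.
exists (existT _ (nth b0 L (reshape_index (map c L) x)) (Ordinal lto)).
by rewrite /string_pos /= index_uniq // reshape_indexK.
Qed.

Lemma sumn_map_uniq : sumn (map c L) = \sum_b c b.
Proof.
rewrite sumnE big_map big_uniq //=; apply: eq_bigl => b.
by rewrite cL.
Qed.
End Positions.

(** This attaches distinct elements of a fixed box set to the boxes of a diagram, which are known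
    only by their labels. *)
Lemma perm_map_lift (T : eqType) (U : eqType) (f : T -> U) (v : seq U) (L : seq T) :
  perm_eq v (map f L) -> exists2 L', perm_eq L' L & v = map f L'.
Proof.
elim: v L => [|x v IH] L.
  by rewrite perm_sym => /perm_nilP/(congr1 size); rewrite size_map => /size0nil ->; exists [::].
move=> pv; have : x \in map f L by rewrite -(perm_mem pv) mem_head.
case/mapP => y yL ex; have pL := perm_to_rem yL.
have : perm_eq v (map f (rem y L)).
  by rewrite -(perm_cons x) (perm_trans pv) // ex -map_cons; apply: perm_map.
case/IH => L' pL' ->; exists (y :: L'); last by rewrite /= ex.
by rewrite perm_sym (perm_trans pL) // perm_cons perm_sym.
Qed.

Section PresentedDiagrams.
Variables (r : nat) (p q nn : 'I_r -> nat).
Local Notation B := {i : 'I_r & 'I_(nn i)}.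
Local Notation S := {dffun forall i : 'I_r, 'S_(nn i)}.
Local Notation strings t := {b : B & 'I_(t (tag b))}.

Definition box_act (h : S) (b : B) : B :=
  Tagged (fun i => 'I_(nn i)) (h (tag b) (tagged b)).

Definition string_act (t : 'I_r -> nat) (h : S) (u : strings t) : strings t :=
  existT (fun b : B => 'I_(t (tag b))) (box_act h (tag u)) (tagged u).

Lemma box_actM h h' b : box_act (h * h')%g b = box_act h' (box_act h b).
Proof. by rewrite /box_act /= ffunE permM. Qed.

Lemma box_act1 b : box_act 1%g b = b.
Proof. by case: b => i k; rewrite /box_act /= ffunE perm1. Qed.

Lemma string_actM t h h' (u : strings t) :
  string_act (h * h')%g u = string_act h' (string_act h u).
Proof.
case: u => [[i k] a]; rewrite /string_act /=.
by rewrite /box_act /= ffunE permM.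
Qed.

Lemma string_act1 t (u : strings t) : string_act 1%g u = u.
Proof. by case: u => [[i k] a]; rewrite /string_act /box_act /= ffunE perm1. Qed.

Lemma string_act_inj t h : injective (@string_act t h).
Proof.
by apply: (can_inj (g := string_act h^-1)) => u; rewrite -string_actM mulgV string_act1.
Qed.

(* The k-th box labelled i is the pair (i, k), and strings t is the set of pairs
   of a box and one of its t i strings. The boxes of E are listed by L, and k
   maps output strings to the input strings that E connects them to. *)
Definition presents (E : diagram p q) (L : seq B) (k : strings p -> strings q) :=
  [/\ uniq L, forall b, b \in L, boxes E = map tag L &
      forall b a b' a', joins E (index b L) a (index b' L) a' =
        [exists u : strings p, [&& tag u == b, val (tagged u) == a,
            tag (k u) == b' & val (tagged (k u)) == a']]].

Lemma presents_exists E L : uniq L -> (forall b, b \in L) -> boxes E = map tag L ->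
  exists k : strings p -> strings q, presents E L k /\
   forall u, nth 0 (conn E) (string_pos L u) = string_pos L (k u).
Proof.
move=> uL cL eE.
have mapE (t : 'I_r -> nat) : map t (boxes E) = map (fun b : B => t (tag b)) L.
  by rewrite eE -map_comp.
have ex (u : strings p) : exists v : strings q, string_pos L v = nth 0 (conn E) (string_pos L u).
  apply: string_pos_surj => //.
  have lt := string_pos_lt cL u.
  rewrite -(mapE q) sumn_boxes -size_conn; apply: conn_lt.
  by rewrite size_conn mapE.
have [k kP] := choice ex; exists k; split; last by move=> u; rewrite kP.
split=> // b a b' a'; rewrite /joins !mapE.
rewrite !(nth_index_map (fun b : B => _ (tag b)) cL).
apply/and3P/existsP => [[lta lta' /eqP e]|[u /and4P[/eqP <- /eqP <- /eqP <- /eqP <-]]].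
  pose u : strings p := existT (fun b : B => 'I_(p (tag b))) b (Ordinal lta).
  pose v : strings q := existT (fun b : B => 'I_(q (tag b))) b' (Ordinal lta').
  have kuv : k u = v by apply: (string_pos_inj cL); rewrite kP.
  by exists u; rewrite kuv /= !eqxx.
split; [exact: ltn_ord | exact: ltn_ord | apply/eqP].
by rewrite -[RHS]/(string_pos L (k u)) kP.
Qed.

(** Read through the lists [L] and [L'], the label-preserving [h] becomes a map of box positions,
    and [h^-1] gives its inverse. *)
Lemma presents_box_perm E E' L L' k k' h : presents E L k -> presents E' L' k' ->
  (forall u, k' (string_act h u) = string_act h (k u)) -> box_perm E E'.
Proof.
move=> [uL cL eE kP] [uL' cL' eE' kP'] hk.
have szE : size (boxes E) = size L by rewrite eE size_map.
have szE' : size (boxes E') = size L' by rewrite eE' size_map.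
pose f K := nth 0 [seq index (box_act h b) L' | b <- L] K.
pose g K := nth 0 [seq index (box_act h^-1 b) L | b <- L'] K.
have fE b : f (index b L) = index (box_act h b) L'.
  by rewrite /f (nth_map b) ?index_mem // nth_index.
have gE b : g (index b L') = index (box_act h^-1 b) L.
  by rewrite /g (nth_map b) ?index_mem // nth_index.
have getb (M : seq B) K : uniq M -> K < size M -> exists b, K = index b M.
  move=> uM lt; have [b0 _] : exists b : B, True by case: M uM lt => // b s _ _; exists b.
  by exists (nth b0 M K); rewrite index_uniq.
exists f, g; split.
- rewrite szE szE' => _ /(getb _ _ uL)[b ->].
  by rewrite fE index_mem gE -box_actM mulgV box_act1.
- rewrite szE szE' => _ /(getb _ _ uL')[b ->].
  by rewrite gE index_mem fE -box_actM mulVg box_act1.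
- rewrite szE => _ /(getb _ _ uL)[b ->].
  rewrite fE eE eE' !onthE (nth_map (tag b)) ?size_map ?index_mem //.
  rewrite [RHS](nth_map (tag b)) ?size_map ?index_mem //.
  by rewrite !(nth_map b) ?index_mem // !nth_index.
- rewrite szE => K a l b /(getb _ _ uL)[{}K ->] /(getb _ _ uL)[{}l ->].
  rewrite !fE kP kP'; apply/existsP/existsP => -[u /and4P[/eqP e1 /eqP e2 /eqP e3 /eqP e4]].
    have [u0 eu] : exists u0, u = string_act h u0.
      by exists (string_act h^-1 u); rewrite -string_actM mulVg string_act1.
    have inj : injective (box_act h).
      by apply: (can_inj (g := box_act h^-1)) => c; rewrite -box_actM mulgV box_act1.
    rewrite eu hk in e1 e2 e3 e4; exists u0.
    by apply/and4P; split; apply/eqP => //; [exact: inj e1 | exact: inj e3].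
  exists (string_act h u); rewrite hk; apply/and4P; split; apply/eqP => //=.
    by rewrite e1.
  by rewrite e3.
Qed.

(** A box permutation preserves labels, so it restricts to a permutation of the boxes of each label;
    these restrictions make up [h]. As [joins] determines where an output string ends, [h] carries
    [k] to [k']. *)
Lemma box_perm_presents E E' L L' k k' : presents E L k -> presents E' L' k' ->
  box_perm E E' -> exists h, forall u, k' (string_act h u) = string_act h (k u).
Proof.
move=> [uL cL eE kP] [uL' cL' eE' kP'] [f [g [fP gP lab jn]]].
have szE : size (boxes E) = size L by rewrite eE size_map.
have szE' : size (boxes E') = size L' by rewrite eE' size_map.
have tagE (c : B) i : tag c = i -> exists y, c = Tagged (fun i => 'I_(nn i)) (y : 'I_(nn i)).
  by case: c => j y /= <-; exists y.
have ex i (x : 'I_(nn i)) : exists y : 'I_(nn i),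
    f (index (Tagged (fun i => 'I_(nn i)) x) L) = index (Tagged (fun i => 'I_(nn i)) y) L'.
  set b := Tagged (fun i => 'I_(nn i)) x; have ltb : index b L < size (boxes E) by rewrite szE index_mem.
  have [ltf _] := fP _ ltb; rewrite szE' in ltf.
  have := lab _ ltb; rewrite eE eE' !onthE.
  rewrite (nth_map (tag b)) ?size_map // [in RHS](nth_map (tag b)) ?size_map ?index_mem //.
  rewrite !(nth_map b) ?index_mem // nth_index // => -[ej].
  have [y ey] := tagE _ _ ej; exists y.
  by rewrite -ey index_uniq.
pose H i x := sval (cid (ex i x)).
have HP i x : f (index (Tagged (fun i => 'I_(nn i)) x) L) = index (Tagged (fun i => 'I_(nn i)) (H i x)) L'.
  exact: svalP (cid (ex i x)).
have Hinj i : injective (H i).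
  move=> x y e; have := HP i x; rewrite e -HP.
  have ltx : index (Tagged (fun i => 'I_(nn i)) x) L < size (boxes E) by rewrite szE index_mem.
  have lty : index (Tagged (fun i => 'I_(nn i)) y) L < size (boxes E) by rewrite szE index_mem.
  move/(congr1 g); rewrite (fP _ ltx).2 (fP _ lty).2.
  move/(congr1 (nth (Tagged (fun i => 'I_(nn i)) x) L)); rewrite !nth_index // => /eqP.
  by rewrite eq_Tagged => /eqP.
pose h : S := [ffun i => perm (@Hinj i)].
have fh b : f (index b L) = index (box_act h b) L'.
  by case: b => i x; rewrite HP /box_act ffunE permE.
exists h => u.
have ltk b : index b L < size (boxes E) by rewrite szE index_mem.
have : joins E (index (tag u) L) (tagged u) (index (tag (k u)) L) (tagged (k u)).
  by rewrite kP; apply/existsP; exists u; rewrite !eqxx.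
rewrite -jn ?ltk // !fh kP' => /existsP[u' /and4P[/eqP e1 /eqP e2 /eqP e3 /eqP e4]].
have eqs (t : 'I_r -> nat) (x y : strings t) : tag x = tag y ->
    val (tagged x) = val (tagged y) -> x = y.
  by case: x y => [b a] [b' a'] /= eb; case: b' / eb a' => a' /val_inj ->.
have -> : string_act h u = u' by apply: eqs.
by apply: eqs.
Qed.
End PresentedDiagrams.

Local Open Scope ring_scope.

(** * Group algebras and traces *)

(* For any system of coordinates, not necessarily a basis: the trace of an
   endomorphism may be computed on a basis of its image. *)
Section Trace.
Variables (K : fieldType) (V : vectType K) (I : finType).
Variables (e : I -> V) (co : I -> {linear V -> K^o}).
Hypothesis coE : forall v, v = \sum_i co i v *: e i.
Variables (T : 'End(V)).

(** Expanding [T (e i)] in a basis of the image, and each basis vector back in the [e i], turns both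
    sides into the same double sum. *)
Lemma trace_limg : 
  \sum_i co i (T (e i)) =
  \sum_(k < \dim (limg T)) coord (vbasis (limg T)) k (T (vbasis (limg T))`_k).
Proof.
set X := vbasis _.
have TE v : T v = \sum_k coord X k (T v) *: X`_k.
  by apply: coord_vbasis; rewrite memv_img ?memvf.
transitivity (\sum_i \sum_k coord X k (T (e i)) * co i X`_k).
  apply: eq_bigr => i _; rewrite {1}TE linear_sum; apply: eq_bigr => k _.
  by rewrite linearZ.
rewrite exchange_big; apply: eq_bigr => k _ /=.
rewrite {2}[X`_k]coE !linear_sum; apply: eq_bigr => i _ /=.
by rewrite !linearZ /= mulrC.
Qed.

Lemma trace_idem : (T \o T)%VF = T -> \sum_i co i (T (e i)) = (\dim (limg T))%:R.
Proof.
move=> TT; rewrite trace_limg.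
have Tid v : v \in limg T -> T v = v.
  by case/memv_imgP=> u _ ->; rewrite -comp_lfunE TT.
rewrite (eq_bigr (fun=> 1)) ?sumr_const ?card_ord // => k _.
rewrite Tid; last by apply: vbasis_mem; rewrite mem_nth ?size_tuple.
by rewrite coord_free ?eqxx //; apply: basis_free (vbasisP _).
Qed.

Lemma trace_sq0 : (T \o T)%VF = 0 -> \sum_i co i (T (e i)) = 0.
Proof.
move=> TT; rewrite trace_limg big1 // => k _.
have /memv_imgP[u _ ->] : (vbasis (limg T))`_k \in limg T.
  by apply: vbasis_mem; rewrite mem_nth ?size_tuple.
by rewrite -comp_lfunE TT lfunE /= linear0.
Qed.
End Trace.

Definition galg (K : fieldType) (gT : finGroupType) := {ffun gT -> K^o}.

Section GroupAlgebra.
Variables (K : fieldType) (gT : finGroupType).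
Local Notation A := (galg K gT).
HB.instance Definition _ := GRing.Lmodule.on A.
HB.instance Definition _ := Vector.on A.

Definition gelt (g : gT) : A := [ffun x => (x == g)%:R].
Definition gmul (u v : A) : A := [ffun z => \sum_x u x * v (x^-1 * z)%g].

Lemma gmulE u v z : gmul u v z = \sum_x u x * v (x^-1 * z)%g.
Proof. by rewrite ffunE. Qed.

Lemma gmulA : associative gmul.
Proof.
move=> u v w; apply/ffunP=> z; rewrite !gmulE.
under eq_bigr do rewrite gmulE mulr_sumr.
under [RHS]eq_bigr do rewrite gmulE mulr_suml.
rewrite [RHS]exchange_big /=; apply: eq_bigr => x _.
rewrite [RHS](reindex_inj (mulgI x)); apply: eq_bigr => y _ /=.
by rewrite mulKg invMg !mulgA mulrA.
Qed.

Lemma gmul1 : left_id (gelt 1) gmul.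
Proof.
move=> u; apply/ffunP=> z; rewrite gmulE (bigD1 1%g) //= !ffunE eqxx.
rewrite mul1r invg1 mul1g big1 ?addr0 // => x /negbTE x1.
by rewrite ffunE x1 mul0r.
Qed.

Lemma gmulr1 : right_id (gelt 1) gmul.
Proof.
move=> u; apply/ffunP=> z; rewrite gmulE (bigD1 z) //= !ffunE mulVg eqxx.
rewrite mulr1 big1 ?addr0 // => x /negbTE x1.
by rewrite ffunE -eq_mulVg1 x1 mulr0.
Qed.

Lemma gmulDl : left_distributive gmul +%R.
Proof.
move=> u v w; apply/ffunP=> z; rewrite [RHS]ffunE !gmulE -big_split /=.
by apply: eq_bigr => x _; rewrite ffunE mulrDl.
Qed.

Lemma gmulDr : right_distributive gmul +%R.
Proof.
move=> u v w; apply/ffunP=> z; rewrite [RHS]ffunE !gmulE -big_split /=.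
by apply: eq_bigr => x _; rewrite ffunE mulrDr.
Qed.

Lemma gelt1_neq0 : gelt 1 != 0.
Proof.
apply/eqP => /ffunP/(_ 1%g); rewrite !ffunE eqxx => /eqP.
by rewrite oner_eq0.
Qed.

HB.instance Definition _ :=
  GRing.Zmodule_isNzRing.Build A gmulA gmul1 gmulr1 gmulDl gmulDr gelt1_neq0.

Lemma gscalerAl (a : K) (u v : A) : a *: (u * v) = (a *: u) * v.
Proof.
apply/ffunP=> z; rewrite [LHS]ffunE !gmulE scaler_sumr.
by apply: eq_bigr => x _; rewrite ffunE -scalerAl.
Qed.

Lemma gscalerAr (a : K) (u v : A) : a *: (u * v) = u * (a *: v).
Proof.
apply/ffunP=> z; rewrite [LHS]ffunE !gmulE scaler_sumr.
by apply: eq_bigr => x _; rewrite ffunE -scalerAr.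
Qed.

HB.instance Definition _ := GRing.Lmodule_isLalgebra.Build K A gscalerAl.
HB.instance Definition _ := GRing.Lalgebra_isAlgebra.Build K A gscalerAr.

Lemma mul_galgE (u v : A) z : (u * v) z = \sum_x u x * v (x^-1 * z)%g.
Proof. exact: gmulE. Qed.

Lemma geltE g x : gelt g x = (x == g)%:R.
Proof. by rewrite ffunE. Qed.

Lemma scale_galgE a (u : A) x : (a *: u) x = a * u x.
Proof. by rewrite ffunE. Qed.

Lemma gelt1 : gelt 1 = 1. Proof. by []. Qed.

Lemma gelt_mulE g (u : A) x : (gelt g * u) x = u (g^-1 * x)%g.
Proof.
rewrite mul_galgE (bigD1 g) //= geltE eqxx mul1r big1 ?addr0 // => y /negbTE yg.
by rewrite geltE yg mul0r.
Qed.

Lemma mul_geltE g (u : A) x : (u * gelt g) x = u (x * g^-1)%g.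
Proof.
rewrite mul_galgE (bigD1 (x * g^-1)%g) //= geltE invMg invgK mulgKV eqxx mulr1.
rewrite big1 ?addr0 // => y yg.
rewrite geltE (_ : _ == _ = false) ?mulr0 //; apply: contraNF yg => /eqP <-.
by rewrite invMg invgK mulKVg.
Qed.

Lemma geltM g h : gelt (g * h) = gelt g * gelt h.
Proof.
apply/ffunP=> x; rewrite gelt_mulE !geltE; congr ((_ : bool)%:R).
by apply/eqP/eqP => [->|<-]; rewrite ?mulKg ?mulKVg.
Qed.

Lemma galg_sumE (u : A) : u = \sum_g u g *: gelt g.
Proof.
apply/ffunP=> x; rewrite sum_ffunE (bigD1 x) //= ffunE geltE eqxx.
rewrite big1 ?addr0 => [|y /negbTE yx]; first by rewrite /GRing.scale /= mulr1.
by rewrite ffunE geltE eq_sym yx scaler0.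
Qed.

Lemma galg_linear_ext (V : lmodType K) (f g : {linear A -> V}) :
  (forall x, f (gelt x) = g (gelt x)) -> f =1 g.
Proof.
move=> fg u; rewrite [u]galg_sumE !linear_sum; apply: eq_bigr => x _.
by rewrite !linearZ /= fg.
Qed.

Definition coeff (x : gT) (u : A) : K^o := u x.
Lemma coeff_linear x : linear (coeff x).
Proof. by move=> a u v; rewrite /coeff !ffunE. Qed.
HB.instance Definition _ x :=
  GRing.isLinear.Build K A K^o *:%R (coeff x) (coeff_linear x).

Lemma mid_sumE (a b u : A) : a * u * b = \sum_x u x *: (a * gelt x * b).
Proof.
rewrite {1}[u]galg_sumE mulr_sumr mulr_suml; apply: eq_bigr => x _.
by rewrite -scalerAr -scalerAl.
Qed.

Lemma functional_sumE (f : {linear A -> K^o}) u : f u = \sum_x u x * f (gelt x).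
Proof.
rewrite {1}[u]galg_sumE linear_sum; apply: eq_bigr => x _.
by rewrite linearZ.
Qed.

Lemma galg_functional (k : gT -> K) :
  exists f : {linear A -> K^o}, forall x, f (gelt x) = k x.
Proof.
pose f (u : A) : K^o := \sum_x u x * k x.
have lin : linear f.
  move=> a u v; rewrite /f scaler_sumr -big_split /=; apply: eq_bigr => x _.
  by rewrite !ffunE mulrDl scalerAl.
pose F : {linear A -> K^o} := HB.pack f (GRing.isLinear.Build K A K^o *:%R f lin).
exists F => x; rewrite /F /= /f (bigD1 x) //= geltE eqxx mul1r.
by rewrite big1 ?addr0 // => y /negbTE yx; rewrite geltE yx mul0r.
Qed.

Definition mul2 (u v x : A) : A := u * x * v.
Lemma mul2_linear u v : linear (mul2 u v).
Proof.
by move=> a x y; rewrite /mul2 mulrDr mulrDl -scalerAr -scalerAl.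
Qed.
HB.instance Definition _ u v :=
  GRing.isLinear.Build K A A *:%R (mul2 u v) (mul2_linear u v).

(* The trace of the endomorphism x |-> u * x * v of the group algebra. *)
Definition tau (u v : A) : K := \sum_x (u * gelt x * v) x.

Definition taul v u := tau u v.
Lemma tau_linearl v : linear (taul v : A -> K^o).
Proof.
move=> a u w; rewrite /taul /tau scaler_sumr -big_split /=; apply: eq_bigr => x _.
by rewrite !mulrDl -!scalerAl !ffunE.
Qed.
Lemma tau_linearr u : linear (tau u : A -> K^o).
Proof.
move=> a v w; rewrite /tau scaler_sumr -big_split /=; apply: eq_bigr => x _.
by rewrite !mulrDr -!scalerAr !ffunE.
Qed.
HB.instance Definition _ u :=
  GRing.isLinear.Build K A K^o *:%R (tau u) (tau_linearr u).
HB.instance Definition _ v :=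
  GRing.isLinear.Build K A K^o *:%R (taul v) (tau_linearl v).

Lemma tau_sq0 u v (T : 'End(A)) :
  (forall x, T x = u * x * v) -> (T \o T)%VF = 0 -> tau u v = 0.
Proof.
move=> TE TT; rewrite -(trace_sq0 (e := gelt) (co := coeff) galg_sumE TT).
by apply: eq_bigr => x _; rewrite TE.
Qed.

Lemma tau_gelt u g : tau u (gelt g) = \sum_x u (x * g^-1 * x^-1)%g.
Proof.
by apply: eq_bigr => x _; rewrite !mul_geltE.
Qed.

Lemma tauE u v : tau u v = \sum_x \sum_y u (y * x^-1)%g * v (y^-1 * x)%g.
Proof.
apply: eq_bigr => x _; rewrite mul_galgE; apply: eq_bigr => y _.
by rewrite mul_geltE.
Qed.

(** Inverting both summation variables of [tauE] exchanges the two coefficients. *)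
Lemma tauC u v : tau u v = tau v u.
Proof.
rewrite !tauE (reindex_inj invg_inj); apply: eq_bigr => x _ /=.
rewrite (reindex_inj invg_inj); apply: eq_bigr => y _ /=.
by rewrite !invgK mulrC.
Qed.

(** The endomorphism has rank at most one, and x |-> f(x) w has trace f(w). *)
Lemma tau_scalar (u v w : A) (f : {linear A -> K^o}) :
  (forall x, u * x * v = f x *: w) -> tau u v = f w.
Proof.
move=> fE; rewrite /tau [w in RHS]galg_sumE linear_sum /=; apply: eq_bigr => x _.
by rewrite fE linearZ ffunE /= /GRing.scale /= mulrC.
Qed.

End GroupAlgebra.

(** * Young symmetrizers and Specht modules *)

Section YoungSymmetrizer.
Variables (K : fieldType) (n : nat).
Hypothesis charK : [pchar K] =i pred0.
Local Notation A := (galg K 'S_n).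
Local Notation "[: g ]" := (gelt K g) (format "[: g ]").

Definition row_sym la : A := \sum_(a in row_stab n la) [: a].
Definition col_sym la : A := \sum_(b in col_stab n la) (-1) ^+ (odd_perm b) *: [: b].
Definition ysym la : A := col_sym la * row_sym la.

Lemma row_stabP la (s : 'S_n) :
  reflect (forall j, reshape_index la (s j) = reshape_index la j) (s \in row_stab n la).
Proof. by rewrite inE; apply: (iffP forallP) => h j; apply/eqP. Qed.

Lemma col_stabP la (s : 'S_n) :
  reflect (forall j, reshape_offset la (s j) = reshape_offset la j) (s \in col_stab n la).
Proof. by rewrite inE; apply: (iffP forallP) => h j; apply/eqP. Qed.

Lemma row_stab_group la : group_set (row_stab n la).
Proof.
apply/group_setP; split=> [|s t /row_stabP sR /row_stabP tR].
  by apply/row_stabP => j; rewrite perm1.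
by apply/row_stabP => j; rewrite permM tR sR.
Qed.
Canonical row_group la := Group (row_stab_group la).

Lemma col_stab_group la : group_set (col_stab n la).
Proof.
apply/group_setP; split=> [|s t /col_stabP sR /col_stabP tR].
  by apply/col_stabP => j; rewrite perm1.
by apply/col_stabP => j; rewrite permM tR sR.
Qed.
Canonical col_group la := Group (col_stab_group la).

Lemma row_col_trivial la s : s \in row_stab n la -> s \in col_stab n la -> s = 1%g.
Proof.
move=> /row_stabP sR /col_stabP sC; apply/permP => j; rewrite perm1.
exact: (@shape_inj n la).
Qed.

Lemma row_symMl la t : t \in row_stab n la -> [: t] * row_sym la = row_sym la.
Proof.
move=> tR; rewrite /row_sym mulr_sumr [RHS](reindex_inj (mulgI t)).
by apply: eq_big => a; rewrite ?groupMl // geltM.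
Qed.

Lemma row_symMr la t : t \in row_stab n la -> row_sym la * [: t] = row_sym la.
Proof.
move=> tR; rewrite /row_sym mulr_suml [RHS](reindex_inj (mulIg t)).
by apply: eq_big => a; rewrite ?groupMr // geltM.
Qed.

Lemma col_symMl la t : t \in col_stab n la ->
  [: t] * col_sym la = (-1) ^+ (odd_perm t) *: col_sym la.
Proof.
move=> tR; rewrite /col_sym mulr_sumr [in RHS](reindex_inj (mulgI t)) scaler_sumr.
apply: eq_big => a; rewrite ?groupMl // => _.
by rewrite geltM scalerA -scalerAr odd_permM signr_addb mulrA -expr2 sqrr_sign mul1r.
Qed.

Lemma col_symMr la t : t \in col_stab n la ->
  col_sym la * [: t] = (-1) ^+ (odd_perm t) *: col_sym la.
Proof.
move=> tR; rewrite /col_sym mulr_suml [in RHS](reindex_inj (mulIg t)) scaler_sumr.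
apply: eq_big => a; rewrite ?groupMr // => _.
by rewrite geltM scalerA -scalerAl odd_permM signr_addb mulrCA -expr2 sqrr_sign mulr1.
Qed.

Lemma opp_self_eq0 (V : lmodType K) (v : V) : v = - v -> v = 0.
Proof.
move=> e; apply/eqP; have: 2%:R *: v == 0 by rewrite scaler_nat mulr2n {2}e subrr.
by rewrite scaler_eq0 => /orP[|//]; rewrite (pcharf0P K).1.
Qed.

(** The row symmetrizer absorbs the transposition of [i] and [j]; moved past [x], this becomes a
    transposition in the column group, which gives a sign. So the product is its own negative. *)
Lemma row_col_pair0 la mu (x : 'S_n) (i j : 'I_n) : i != j ->
  reshape_index la i = reshape_index la j ->
  reshape_offset mu (x i) = reshape_offset mu (x j) ->
  row_sym la * [: x] * col_sym mu = 0.
Proof.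
move=> ij er ec; have tR : tperm i j \in row_stab n la.
  by apply/row_stabP => k; case: tpermP => // ->.
have tC : tperm (x i) (x j) \in col_stab n mu.
  by apply/col_stabP => k; case: tpermP => // ->.
apply: opp_self_eq0.
rewrite -{1}(row_symMr tR) -[_ * [: x]]mulrA -geltM.
rewrite (_ : (_ * _)%g = x * tperm (x i) (x j))%g.
  rewrite geltM -!mulrA (col_symMl tC) odd_tperm (inj_eq perm_inj) ij.
  by rewrite expr1 scaleN1r !mulrN.
by rewrite -tpermJ conjgE !mulgA mulgV mul1g.
Qed.

Lemma col_row_pair0 la mu (y : 'S_n) (i j : 'I_n) : i != j ->
  reshape_offset mu i = reshape_offset mu j ->
  reshape_index la (y i) = reshape_index la (y j) ->
  col_sym mu * [: y] * row_sym la = 0.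
Proof.
move=> ij ec er; have tR : tperm (y i) (y j) \in row_stab n la.
  by apply/row_stabP => k; case: tpermP => // ->.
have tC : tperm i j \in col_stab n mu.
  by apply/col_stabP => k; case: tpermP => // ->.
apply: opp_self_eq0.
rewrite -{1}(row_symMl tR) mulrA -[_ * [: y] * _]mulrA -geltM.
rewrite (_ : (_ * _)%g = tperm i j * y)%g.
  rewrite geltM mulrA (col_symMr tC) odd_tperm ij.
  by rewrite expr1 scaleN1r !mulNr.
by rewrite -tpermJ conjgE !mulgA mulgV mul1g.
Qed.

(** The permutations that [row_col_pair0] leaves open; for them the dominance inequality holds. *)
Definition good la mu (x : 'S_n) := forall i j : 'I_n,
  reshape_index la i = reshape_index la j ->
  reshape_offset mu (x i) = reshape_offset mu (x j) -> i = j.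

Lemma pair_or_good la mu (x : 'S_n) : good la mu x \/
  exists i j : 'I_n, [/\ i != j, reshape_index la i = reshape_index la j &
    reshape_offset mu (x i) = reshape_offset mu (x j)].
Proof.
have [/existsP[i /existsP[j /and3P[ij /eqP e1 /eqP e2]]]|no] :=
  boolP [exists i : 'I_n, exists j : 'I_n, [&& i != j, reshape_index la i == reshape_index la j &
    reshape_offset mu (x i) == reshape_offset mu (x j)]].
  by right; exists i, j.
left=> i j e1 e2; apply/eqP; apply: contraNT no => ij.
by apply/existsP; exists i; apply/existsP; exists j; rewrite ij e1 e2 !eqxx.
Qed.

(** [a] moves each cell inside its row to the column of its image under [x], which is possible by
    [dominance_pt]; the remaining factor then preserves columns. *)
Lemma good_factor la (laP : is_partition n la) (x : 'S_n) : good la la x ->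
  exists a b, [/\ a \in row_stab n la, b \in col_stab n la & x = (a * b)%g].
Proof.
move=> gx; have pt := dominance_pt laP gx erefl.
pose a0 (j : 'I_n) := odflt j [pick i : 'I_n | (reshape_index la i == reshape_index la j)
                        && (reshape_offset la i == reshape_offset la (x j))].
have aP j : reshape_index la (a0 j) = reshape_index la j
            /\ reshape_offset la (a0 j) = reshape_offset la (x j).
  rewrite /a0; case: pickP => [i /andP[/eqP ? /eqP ?] // | no].
  by have [i [e1 e2]] := pt j; have := no i; rewrite e1 e2 !eqxx.
have a_inj : injective a0.
  move=> i j e; apply: gx; first by rewrite -(aP i).1 e (aP j).1.
  by rewrite -(aP i).2 e (aP j).2.
exists (perm a_inj), ((perm a_inj)^-1 * x)%g; split; last by rewrite mulKVg.
  by apply/row_stabP => j; rewrite permE (aP j).1.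
apply/col_stabP => j; rewrite -[in RHS](permKV (perm a_inj) j) permM.
by rewrite [in RHS]permE (aP _).2.
Qed.

Lemma row_mid_col la (laP : is_partition n la) x :
  exists k, row_sym la * [: x] * col_sym la = k *: (row_sym la * col_sym la).
Proof.
case: (pair_or_good la la x) => [/(good_factor laP)[a [b [aR bC ->]]] | [i [j [ij er ec]]]].
  exists ((-1) ^+ odd_perm b).
  by rewrite geltM mulrA (row_symMr aR) -mulrA (col_symMl bC) -scalerAr.
by exists 0; rewrite scale0r (row_col_pair0 ij).
Qed.

Lemma col_mid_row la (laP : is_partition n la) x :
  exists k, col_sym la * [: x] * row_sym la = k *: (col_sym la * row_sym la).
Proof.
(* The factorization is applied to [x^-1], since inverting [a * b] puts the column factor on the
   left. *)
case: (pair_or_good la la x^-1) => [/(good_factor laP)[a [b [aR bC e]]] | [i [j [ij er ec]]]].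
  exists ((-1) ^+ odd_perm b^-1).
  rewrite -[x]invgK e invMg geltM mulrA (col_symMr (groupVr bC)) -mulrA.
  by rewrite (row_symMl (groupVr aR)) -scalerAl.
exists 0; rewrite scale0r (@col_row_pair0 _ _ _ (x^-1 i)%g (x^-1 j)%g) ?(inj_eq perm_inj) //.
by rewrite !permKV.
Qed.

(** Write C and R for the two symmetrizers. In C R u C R the middle R u C is a multiple of R C by
    [row_mid_col], and C (R C) R is a multiple of C R by [col_mid_row]. *)
Lemma ysym_mid la (laP : is_partition n la) :
  exists h : {linear A -> K^o}, forall u, ysym la * u * ysym la = h u *: ysym la.
Proof.
have [k1 k1P] := choice (row_mid_col laP); have [k2 k2P] := choice (col_mid_row laP).
have [f2 f2P] := galg_functional k2.
have BA u : col_sym la * u * row_sym la = f2 u *: ysym la.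
  rewrite mid_sumE functional_sumE scaler_suml.
  by apply: eq_bigr => x _; rewrite k2P f2P scalerA.
have [h hP] := galg_functional (fun x => k1 x * f2 (row_sym la * col_sym la)).
exists h => u; rewrite mid_sumE functional_sumE scaler_suml.
apply: eq_bigr => x _; rewrite -[RHS]scalerA hP; congr (_ *: _).
rewrite -scalerA -BA.
have -> : ysym la * [: x] * ysym la
          = col_sym la * (row_sym la * [: x] * col_sym la) * row_sym la.
  by rewrite /ysym !mulrA.
by rewrite k1P -scalerAr -scalerAl.
Qed.

Lemma row_symE la x : row_sym la x = (x \in row_stab n la)%:R.
Proof.
rewrite /row_sym sum_ffunE; case: (boolP (x \in _)) => [xR | xR].
  rewrite (bigD1 x) //= geltE eqxx big1 ?addr0 // => y /andP[_ /negbTE yx].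
  by rewrite geltE eq_sym yx.
by rewrite big1 // => y yR; rewrite geltE; case: eqP => // e; rewrite e yR in xR.
Qed.

(** The row and column groups meet only in 1, so the product 1 arises from a single pair. *)
Lemma ysym1 la : ysym la 1%g = 1.
Proof.
rewrite /ysym /col_sym mulr_suml sum_ffunE (bigD1 1%g) ?group1 //=.
rewrite odd_perm1 expr0 scale1r gelt_mulE invg1 mulg1 row_symE group1.
rewrite big1 ?addr0 // => b /andP[bC b1].
rewrite -scalerAl ffunE gelt_mulE mulg1 row_symE groupV.
case: (boolP (b \in _)) => [bR|]; last by rewrite scaler0.
by rewrite (row_col_trivial bR bC) eqxx in b1.
Qed.

(** The scalar by which squaring multiplies [ysym], read off at 1 where [ysym] has value 1. It is n!
    over the dimension of the Specht module, the product of the hook lengths. *)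
Definition kappa la : K := (ysym la * ysym la) 1%g.

Lemma ysym_sq la (laP : is_partition n la) : ysym la * ysym la = kappa la *: ysym la.
Proof.
have [h hP] := ysym_mid laP; have := hP 1; rewrite mulr1 => e.
by rewrite /kappa e scale_galgE ysym1 mulr1.
Qed.

Lemma tau_ysym1 la : tau (ysym la) 1 = n`!%:R.
Proof.
rewrite -gelt1 tau_gelt; under eq_bigr do rewrite invg1 mulg1 mulgV ysym1.
by rewrite sumr_const card_Sn.
Qed.

Lemma natr_neq0 m : (0 < m)%N -> m%:R != 0 :> K.
Proof. by move/pcharf0P: charK => -> ; rewrite -lt0n. Qed.

(** Otherwise left multiplication by [ysym] would square to zero and have trace 0, but its trace is
    n! times the coefficient of 1, that is n!. *)
Lemma kappa_neq0 la (laP : is_partition n la) : kappa la != 0.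
Proof.
apply/negP => /eqP k0; have := ysym_sq laP; rewrite k0 scale0r => sq0.
have := @tau_sq0 K 'S_n (ysym la) 1 (linfun (mul2 (ysym la) 1)).
rewrite tau_ysym1 => e; have /eqP := natr_neq0 (fact_gt0 n); apply; apply: e.
  by move=> x; rewrite lfunE.
apply/lfunP => x; by rewrite comp_lfunE !lfunE /= /mul2 !mulr1 mulrA sq0 mul0r.
Qed.

(** By [ysym_mid] the endomorphism has rank at most one, and its trace is the factor between the
    cube of [ysym] and [ysym]. *)
Lemma tau_ysym la (laP : is_partition n la) : tau (ysym la) (ysym la) = kappa la ^+ 2.
Proof.
have [h hP] := ysym_mid laP; rewrite (tau_scalar hP).
have := hP (ysym la); rewrite ysym_sq // -scalerAl ysym_sq // scalerA.
move=> /ffunP/(_ 1%g); rewrite !scale_galgE ysym1 !mulr1 => <-.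
by rewrite expr2.
Qed.

(** A nonzero product requires a good permutation, hence a dominance inequality; by antisymmetry of
    dominance this cannot happen in both orders. One vanishing order suffices later because [tau] is
    symmetric and the isotypic elements are central. *)
Lemma ysym_orth la mu (laP : is_partition n la) (muP : is_partition n mu) :
  la <> mu -> (forall u, ysym la * u * ysym mu = 0) \/
              (forall u, ysym mu * u * ysym la = 0).
Proof.
move=> neq.
have orth al be : (forall x, ~ good al be x) -> forall u, ysym al * u * ysym be = 0.
  move=> no u; rewrite mid_sumE big1 // => x _; case: (pair_or_good al be x) => [/no //|[i [j [ij er ec]]]].
  have -> : ysym al * [: x] * ysym be
            = col_sym al * (row_sym al * [: x] * col_sym be) * row_sym be.
    by rewrite /ysym !mulrA.
  by rewrite (row_col_pair0 ij) // mulr0 mul0r scaler0.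
have [[k k1] | no1] := pselect (exists k : nat, (#|[set j : 'I_n | (reshape_index mu j < k)%N]|
    < #|[set j : 'I_n | (reshape_index la j < k)%N]|)%N).
  by left; apply: orth => x /(dominance muP)/(_ k); rewrite leqNgt k1.
right; apply: orth => x gx; case: neq; apply: (dominance_anti laP muP) => k.
apply/eqP; rewrite eqn_leq (dominance laP gx) andbT leqNgt.
by apply/negP => lt; case: no1; exists k.
Qed.
End YoungSymmetrizer.

(** * Specht characters as traces on the group algebra *)

Section SubmoduleTrace.
Variables (K : fieldType) (gT : finGroupType) (G : {group gT}) (n : nat).
Variables (rG : mx_representation K G n) (U E : 'M[K]_n).
Variable Umod : mxmodule rG U.
Hypothesis EE : E *m E = E.
Hypothesis EU : (E :=: U)%MS.

(** [Q], the projection built into [submod_repr], and [E] have the same image, so [Q *m E = Q] and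
    [E *m Q = E]. As [E] commutes with the action, it can replace [Q] under the trace. *)
Lemma mxtrace_submod_idem x : E *m rG x = rG x *m E ->
  \tr (submod_repr Umod x) = \tr (E *m rG x).
Proof.
move=> cEx; pose Q := in_submod U 1%:M *m val_submod 1%:M.
have projE m (W : 'M_(m, n)) : (W <= U)%MS -> W *m E = W.
  by rewrite -EU => /submxP[W' ->]; rewrite -mulmxA EE.
have QE : Q *m E = Q by apply: projE; rewrite /Q -val_submodE val_submodP.
have EQ : E *m Q = E.
  by rewrite /Q mulmxA -in_submodE -val_submodE in_submodK // EU.
transitivity (\tr (rG x *m Q)).
  by rewrite /= /submod_mx in_submodE mxtrace_mulC [RHS]mxtrace_mulC /Q mulmxA.
by rewrite -QE mulmxA mxtrace_mulC mulmxA cEx -mulmxA EQ.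
Qed.
End SubmoduleTrace.

Section RowVectors.
Variables (K : fieldType) (n : nat).
Local Notation A := (galg K 'S_n).
Local Notation G := [set: 'S_n]%G.
Local Notation aG := (regular_repr K G).

Definition grow (u : A) : 'rV[K]_#|G| := \row_i u (enum_val i).

Lemma grow_linear : linear grow.
Proof. by move=> a u v; apply/rowP => i; rewrite !mxE !ffunE. Qed.
HB.instance Definition _ := GRing.isLinear.Build K A 'rV[K]_#|G| *:%R grow grow_linear.

Lemma grow_gelt g : grow (gelt K g) = gring_elt K g.
Proof.
apply/rowP => i; rewrite !mxE geltE eqxx /=; congr ((_ : bool)%:R).
by rewrite -(inj_eq enum_val_inj) gring_indexK ?inE.
Qed.

Lemma grow_mulr (u : A) x : grow (u * gelt K x) = grow u *m aG x.
Proof.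
rewrite [u]galg_sumE mulr_suml !linear_sum mulmx_suml; apply: eq_bigr => g _.
rewrite -scalerAl !linearZ -scalemxAl -geltM /= !grow_gelt /gring_elt.
by rewrite -rowE rowK gring_indexK ?inE.
Qed.

Definition lmul_mx (w : A) : 'M[K]_#|G| := \matrix_i grow (w * gelt K (enum_val i)).

Lemma grow_mull (w u : A) : grow u *m lmul_mx w = grow (w * u).
Proof.
rewrite [u]galg_sumE mulr_sumr !linear_sum mulmx_suml; apply: eq_bigr => g _.
rewrite -scalerAr !linearZ -scalemxAl /= grow_gelt /gring_elt.
by rewrite -rowE rowK gring_indexK ?inE.
Qed.

Lemma grow_ext m (M N : 'M[K]_(#|G|, m)) :
  (forall u, grow u *m M = grow u *m N) -> M = N.
Proof.
move=> e; apply/row_matrixP => i; rewrite !rowE.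
by have := e (gelt K (enum_val i)); rewrite grow_gelt /gring_elt gring_valK.
Qed.

Lemma lmul_mxM w w' : lmul_mx w *m lmul_mx w' = lmul_mx (w' * w).
Proof. by apply: grow_ext => u; rewrite mulmxA !grow_mull mulrA. Qed.

Lemma lmul_mxC w x : lmul_mx w *m aG x = aG x *m lmul_mx w.
Proof.
by apply: grow_ext => u; rewrite !mulmxA grow_mull -!grow_mulr grow_mull mulrA.
Qed.

Lemma young_symmetrizerE la : young_symmetrizer K n la = grow (ysym K n la).
Proof.
rewrite /ysym /col_sym /row_sym mulr_suml linear_sum /young_symmetrizer exchange_big /=.
apply: eq_bigr => b _; rewrite mulr_sumr linear_sum; apply: eq_bigr => a _.
by rewrite -scalerAl linearZ /= -geltM grow_gelt.
Qed.

Hypothesis charK : [pchar K] =i pred0.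

(* ysym la divided by kappa is an idempotent whose left multiplication projects
   onto the Specht module. *)
Definition chi la (g : 'S_n) : K := (kappa K n la)^-1 * tau (ysym K n la) (gelt K g).

Lemma specht_trace la (laP : is_partition n la) g : \tr (specht K n la g) = chi la g.
Proof.
pose c := ysym K n la; pose k := kappa K n la.
have k0 : k != 0 by apply: kappa_neq0.
pose E := lmul_mx (k^-1 *: c).
have EE : E *m E = E.
  rewrite lmul_mxM -scalerAl -scalerAr (ysym_sq charK laP) !scalerA -/k.
  by rewrite -mulrA mulVf // mulr1.
have cE : grow c *m E = grow c.
  by rewrite grow_mull -scalerAl (ysym_sq charK laP) scalerA mulVf ?scale1r.
have EU : (E :=: specht_mx K n la)%MS.
  apply/eqmxP/andP; split.
    apply/row_subP => i; rewrite rowK -scalerAl linearZ /= scalemx_sub //.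
    rewrite grow_mulr mxmodule_trans ?cyclic_mx_module ?inE //.
    by rewrite -/c -young_symmetrizerE cyclic_mx_id.
  apply: cyclic_mx_sub; last by rewrite young_symmetrizerE -/c -cE submxMl.
  by apply/mxmoduleP => x Gx; rewrite lmul_mxC submxMl.
rewrite /specht (mxtrace_submod_idem _ EE EU (lmul_mxC _ _)).
rewrite /mxtrace /chi -/c -/k /tau mulr_sumr.
rewrite (reindex (@enum_val _ (mem G))) /=; last first.
  by apply/onW_bij/(Bijective (@gring_valK _ G)) => x; rewrite gring_indexK ?inE.
apply: eq_bigr => i _.
transitivity (row i (E *m aG g) 0 i); first by rewrite [RHS]mxE.
rewrite rowE -(gring_valK i) mulmxA.
rewrite (_ : delta_mx _ _ = grow (gelt K (enum_val i))); last by rewrite grow_gelt.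
by rewrite grow_mull -grow_mulr mxE gring_valK -!scalerAl scale_galgE.
Qed.
End RowVectors.

(** * Characters of symmetric groups *)

Section CycleType.
Variable T : finType.
Implicit Types (s t : {perm T}) (x y : T).

Lemma perm_pow_eq s x i j :
  ((s ^+ i)%g x == (s ^+ j)%g x) = (i == j %[mod #|porbit s x|])%N.
Proof.
have c0 : (0 < #|porbit s x|)%N by rewrite lt0n card_porbit_neq0.
have red k : (s ^+ k)%g x = nth x (traject s x #|porbit s x|) (k %% #|porbit s x|)%N.
  rewrite nth_traject ?ltn_pmod // -permX {1}(divn_eq k #|porbit s x|) addnC expgD permM.
  have fixa a : (s ^+ (a * #|porbit s x|))%g x = x.
    by rewrite mulnC expgM permX iter_fix // permX iter_porbit.
  by rewrite -permM -expgD addnC expgD permM fixa.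
by rewrite !red nth_uniq ?uniq_traject_porbit ?size_traject ?ltn_pmod.
Qed.

Definition cycle_type s : seq nat :=
  sort geq [seq #|X| | X : {set T} <- enum (porbits s)].

Lemma cycle_typeV s : cycle_type s^-1 = cycle_type s.
Proof. by rewrite /cycle_type porbitsV. Qed.

Lemma mem_porbits s x : porbit s x \in porbits s.
Proof. exact: imset_f. Qed.

Lemma cycle_type_partition s : is_partition #|T| (cycle_type s).
Proof.
have geq_total : total geq by move=> a b; apply: leq_total.
have sortP : perm_eq (cycle_type s) [seq #|X| | X : {set T} <- enum (porbits s)].
  by rewrite perm_sort.
rewrite /is_partition sort_sorted //= (perm_mem sortP) (perm_sumn sortP); apply/andP; split.
  apply/negP => /mapP[X]; rewrite mem_enum => /imsetP[x _ ->] /esym/eqP.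
  by rewrite (negbTE (card_porbit_neq0 s x)).
rewrite sumnE big_map big_enum /= -(@card_partition _ _ setT) ?cardsT //.
apply/and3P; split.
- rewrite eqEsubset subsetT; apply/subsetP => x _; apply/bigcupP.
  by exists (porbit s x); rewrite ?mem_porbits ?porbit_id.
- apply/trivIsetP => _ _ /imsetP[x _ ->] /imsetP[y _ ->] neq.
  rewrite disjoint_subset; apply/subsetP => z; rewrite inE => zx; apply: contra neq => zy.
  by move: zx zy; rewrite -!eq_porbit_mem => /eqP <-.
- apply/negP => /imsetP[x _] /setP/(_ x).
  by rewrite porbit_id inE.
Qed.

(** Sorting by length pairs each cycle of [s] with a cycle of [t] of equal length. The i-th iterate
    of a representative under [s] is sent to the i-th iterate under [t] of the representative of the
    paired cycle. *)
Lemma cycle_type_conj s t : cycle_type s = cycle_type t -> exists u, t = (s ^ u)%g.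
Proof.
have geq_total : total geq by move=> a b; apply: leq_total.
pose lec (X Y : {set T}) := geq #|X| #|Y|.
have lec_sort v : cycle_type v = map (fun X : {set T} => #|X|) (sort lec (enum (porbits v))).
  by rewrite /cycle_type sort_map.
rewrite !lec_sort; set rs := sort _ _; set rt := sort _ _ => e.
have szE : size rs = size rt by rewrite -(size_map (fun X : {set T} => #|X|)) e size_map.
pose be X := nth set0 rt (index X rs).
have mems X : (X \in rs) = (X \in porbits s) by rewrite mem_sort mem_enum.
have memt X : (X \in rt) = (X \in porbits t) by rewrite mem_sort mem_enum.
have beP X : X \in porbits s -> be X \in porbits t /\ #|be X| = #|X|.
  rewrite -mems -memt => Xs; have lt : (index X rs < size rt)%N by rewrite -szE index_mem.
  split; first by rewrite mem_nth.
  rewrite /be -(nth_map set0 0 (fun X : {set T} => #|X|)) // -e (nth_map set0) ?szE //.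
  by rewrite nth_index.
have be_inj : {in porbits s &, injective be}.
  move=> X Y; rewrite -!mems => Xs Ys /eqP.
  rewrite nth_uniq ?sort_uniq ?enum_uniq -?szE ?index_mem // => /eqP ei.
  by rewrite -(nth_index set0 Xs) ei nth_index.
(* Cycles are nonempty, so on them the default [x0] is never returned; [rp_irr] below records
   this. *)
pose rp x0 (X : {set T}) := odflt x0 [pick x in X].
have rpP x0 v X : X \in porbits v -> porbit v (rp x0 X) = X.
  case/imsetP => x _ ->; rewrite /rp; case: pickP => [y yX | /(_ x)].
    by apply/eqP; rewrite eq_porbit_mem.
  by rewrite porbit_id.
(* The exponent [i] is determined only modulo the cycle length; paired cycles have equal length, so
   every choice gives the same [y]. *)
have ex x : exists y, exists i, x = (s ^+ i)%g (rp x (porbit s x)) /\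
                           y = (t ^+ i)%g (rp x (be (porbit s x))).
  have: x \in porbit s (rp x (porbit s x)).
    by rewrite rpP ?mem_porbits // porbit_id.
  by case/porbitP => i ei; exists ((t ^+ i)%g (rp x (be (porbit s x)))), i.
have [u uP] := choice ex.
have rp_irr x y v X : X \in porbits v -> rp x X = rp y X.
  case/imsetP => z _ ->; rewrite /rp; case: pickP => // /(_ z).
  by rewrite porbit_id.
have crd x : #|porbit t (rp x (be (porbit s x)))| = #|porbit s (rp x (porbit s x))|.
  have [b1 b2] := beP _ (mem_porbits s x).
  by rewrite !rpP ?mem_porbits.
have uinj : injective u.
  move=> x y exy; have [i [xi ui]] := uP x; have [j [yj uj]] := uP y.
  have [b1 _] := beP _ (mem_porbits s x); have [b2 _] := beP _ (mem_porbits s y).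
  have exy' : porbit s x = porbit s y.
    apply: be_inj; rewrite ?mem_porbits //.
    by have := congr1 (porbit t) exy; rewrite ui uj !porbit_perm !rpP.
  have rxy : rp y (porbit s y) = rp x (porbit s x).
    by rewrite exy'; apply: rp_irr (mem_porbits s y).
  have bxy : rp y (be (porbit s y)) = rp x (be (porbit s x)).
    by rewrite exy'; apply: rp_irr b2.
  rewrite xi yj rxy; apply/eqP; rewrite perm_pow_eq -crd -perm_pow_eq.
  by rewrite -ui -bxy -uj exy.
have uequiv x : u (s x) = t (u x).
  have [i [xi ui]] := uP x; have [j [yj uj]] := uP (s x).
  have porb : porbit s (s x) = porbit s x by have := porbit_perm s 1 x; rewrite expg1.
  have [b1 _] := beP _ (mem_porbits s x).
  rewrite porb in yj uj.
  rewrite uj ui -permM -expgSr (rp_irr _ x _ _ b1); apply/eqP.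
  rewrite perm_pow_eq crd -perm_pow_eq expgSr permM -xi yj.
  by rewrite (rp_irr _ x _ _ (mem_porbits s x)).
exists (perm uinj); apply/permP => y; rewrite -[y](permKV (perm uinj)).
set x := _ y; by rewrite permJ !permE uequiv.
Qed.
End CycleType.

Section Partition.
Variable n : nat.

Lemma partsP (la : partition n) : is_partition n (parts la).
Proof. by case: la. Qed.

Lemma parts_inj : injective (@parts n).
Proof.
move=> la mu /(inj_map val_inj) e; apply: val_inj => /=.
exact: val_inj.
Qed.

Lemma partition_size la : is_partition n la -> (size la <= n)%N.
Proof.
case/and3P => _ + /eqP <-; elim: la => //= a la IH; rewrite inE negb_or => /andP[a0 /IH le].
by rewrite -add1n leq_add // lt0n eq_sym.
Qed.

Lemma partitionE la : is_partition n la -> exists p : partition n, parts p = la.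
Proof.
move=> laP; have sz := partition_size laP.
have sz' : (size [seq inord i : 'I_n.+1 | i <- la] <= n)%N by rewrite size_map.
have e : map val (Bseq sz') = la.
  rewrite /= -map_comp map_id_in // => i ila /=; rewrite inordK // ltnS.
  case/and3P: laP => _ _ /eqP <-.
  by rewrite (perm_sumn (perm_to_rem ila)) /= leq_addr.
have pP : is_partition n (map val (Bseq sz')) by rewrite e.
by exists (Partition pP).
Qed.

Lemma cycle_type_exists (s : 'S_n) : exists p : partition n, parts p == cycle_type s.
Proof.
have [|p pE] := @partitionE (cycle_type s); last by exists p; apply/eqP.
by have := cycle_type_partition s; rewrite card_ord.
Qed.

Definition ctype (s : 'S_n) : partition n := xchoose (cycle_type_exists s).

Lemma ctypeE s : parts (ctype s) = cycle_type s.
Proof. exact/eqP/(xchooseP (cycle_type_exists s)). Qed.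

Lemma ctype_conj s t : ctype s = ctype t -> exists u, t = (s ^ u)%g.
Proof. by move=> e; apply: cycle_type_conj; rewrite -!ctypeE e. Qed.

Lemma ctypeV s : ctype s^-1 = ctype s.
Proof. by apply: parts_inj; rewrite !ctypeE cycle_typeV. Qed.
End Partition.

(** * Orthogonality relations and isotypic idempotents *)

Section TraceForm.
Variables (K : fieldType) (gT : finGroupType).
Local Notation A := (galg K gT).

(** [tau u g] sums [u] over the conjugates of [g^-1]. The other factor is a class function of [g],
    so each conjugating element contributes [tau u v]. *)
Lemma tau_conv (u v : A) :
  \sum_g tau u (gelt K g) * tau v (gelt K g^-1) = #|gT|%:R * tau u v.
Proof.
have shift x : \sum_g u (x * g^-1 * x^-1)%g * tau v (gelt K g^-1) = tau u v.
  rewrite (reindex_inj (conjg_inj x)) (reindex_inj invg_inj) /=.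
  under eq_bigr do rewrite tau_gelt mulr_sumr.
  rewrite tauE exchange_big [RHS](reindex_inj invg_inj) /=.
  rewrite (reindex_inj (mulIg x)) /=; apply: eq_bigr => y _.
  rewrite [RHS](reindex_inj (mulIg (y^-1)%g)) /=; apply: eq_bigr => k _.
  congr (u _ * v _); first by rewrite -conjVg !invgK conjgE !mulgA mulgV mul1g mulgK mulgKV.
  by rewrite conjgE !invMg !invgK !mulgA !mulgK.
under eq_bigr do rewrite tau_gelt mulr_suml.
rewrite exchange_big /=; under eq_bigr do rewrite shift.
by rewrite sumr_const mulr_natl.
Qed.

Lemma tau_geltJ (u : A) g h : tau u (gelt K (g ^ h)%g) = tau u (gelt K g).
Proof.
rewrite !tau_gelt (reindex_inj (mulIg h)); apply: eq_bigr => x _ /=.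
by rewrite conjgE !invMg invgK !mulgA mulgK mulgK.
Qed.

Lemma tau_sumr (u v : A) : tau u v = \sum_g v g * tau u (gelt K g).
Proof. exact: (functional_sumE (GRing.Linear.clone K A K^o *:%R (tau u) _)). Qed.

Lemma tau_suml (u v : A) : tau v u = \sum_g v g * tau (gelt K g) u.
Proof. by rewrite tauC tau_sumr; apply: eq_bigr => g _; rewrite tauC. Qed.

Lemma tau_linear_suml (I : finType) (P : pred I) (F : I -> A) v :
  tau (\sum_(i | P i) F i) v = \sum_(i | P i) tau (F i) v.
Proof. exact: (linear_sum (GRing.Linear.clone K A K^o *:%R (taul v) _)). Qed.

Lemma tau_central (u v z : A) : (forall w, z * w = w * z) -> tau u (z * v) = tau (u * z) v.
Proof.
by move=> zC; apply: eq_bigr => x _; rewrite !mulrA -[u * _ * z]mulrA -zC mulrA.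
Qed.
End TraceForm.

Lemma sumr_const_set (R : nmodType) (T : finType) (P : pred T) (x : R) :
  \sum_(i | P i) x = x *+ #|[set i | P i]|.
Proof. by rewrite sumr_const; congr (_ *+ _); apply: eq_card => i; rewrite inE. Qed.

Section Characters.
Variables (K : fieldType) (n : nat).
Hypothesis charK : [pchar K] =i pred0.
Local Notation A := (galg K 'S_n).
Local Notation "[: g ]" := (gelt K g) (format "[: g ]").
Implicit Types (la mu : partition n) (g h : 'S_n).
Local Notation ch la := (@chi K n (@parts n la)).
Local Notation kap la := (kappa K n (@parts n la)).
Local Notation c la := (ysym K n (@parts n la)).

Lemma kap_neq0 la : kap la != 0.
Proof. exact: (kappa_neq0 charK (partsP la)). Qed.

Lemma fact_neq0 : n`!%:R != 0 :> K.
Proof. exact: (natr_neq0 charK (fact_gt0 n)). Qed.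

Lemma chi_ctype la g h : ctype g = ctype h -> ch la g = ch la h.
Proof. by case/ctype_conj => x ->; rewrite /chi tau_geltJ. Qed.

Lemma chiV la g : ch la g^-1 = ch la g.
Proof. exact/chi_ctype/ctypeV. Qed.

(** [tau_conv] reduces the sum to [tau] of two Young symmetrizers, which is the square of [kappa] or
    0. *)
Lemma chi_orth la mu :
  n`!%:R^-1 * (\sum_g ch la g * ch mu g) = (la == mu)%:R.
Proof.
have -> : \sum_g ch la g * ch mu g
          = (kap la)^-1 * (kap mu)^-1 * (n`!%:R * tau (c la) (c mu)).
  under eq_bigr do rewrite -(chiV mu) /chi mulrACA.
  by rewrite -mulr_sumr tau_conv card_Sn.
rewrite mulrCA mulKf ?fact_neq0 //; have [<-|neq] := eqVneq la mu.
  rewrite (tau_ysym charK (partsP la)) expr2 mulrACA !mulVf ?mulr1 ?kap_neq0 //.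
suff -> : tau (c la) (c mu) = 0 by rewrite mulr0.
have neq' : parts la <> parts mu by move/parts_inj; apply/eqP.
case: (ysym_orth charK (partsP la) (partsP mu) neq') => orth; last rewrite tauC.
  by apply: big1 => x _; rewrite orth ffunE.
by apply: big1 => x _; rewrite orth ffunE.
Qed.

Definition class_size g : nat := #|[set k : 'S_n | ctype k == ctype g]|.

Lemma class_size_neq0 g : (class_size g)%:R != 0 :> K.
Proof. by apply: natr_neq0 => //; apply/card_gt0P; exists g; rewrite inE. Qed.

(* Values on classes are indexed by cycle types, hence by partitions of n: the
   character table is square, so row orthogonality gives column orthogonality. *)
Lemma chi_orth2 g h :
  \sum_la ch la g * ch la h
   = (ctype g == ctype h)%:R * n`!%:R / (class_size h)%:R.
Proof.
(* A type without permutations gets 0, consistent with its empty class, on which [D] is 0 too. *)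
pose at_type (la tau : partition n) : K :=
  if [pick k : 'S_n | ctype k == tau] is Some k then ch la k else 0.
have at_ctype la k : at_type la (ctype k) = ch la k.
  rewrite /at_type; case: pickP => [k' /eqP e | /(_ k)]; last by rewrite eqxx.
  exact: chi_ctype.
pose N := #|{: partition n}|.
pose X : 'M[K]_N := \matrix_(i, j) at_type (enum_val i) (enum_val j).
pose D (ta : partition n) : K := #|[set k : 'S_n | ctype k == ta]|%:R / n`!%:R.
pose Y : 'M[K]_N := \matrix_(j, i) (D (enum_val j) * X i j).
have XY : X *m Y = 1%:M.
  apply/matrixP => i i'; rewrite !mxE -(inj_eq enum_val_inj) -chi_orth.
  rewrite (partition_big (@ctype n) predT) //= mulr_sumr.
  rewrite [RHS](reindex (@enum_val _ {: partition n})) /=; last first.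
    exact/onW_bij/enum_val_bij.
  apply: eq_bigr => j _; rewrite !mxE.
  set ta := enum_val j; transitivity (n`!%:R^-1 *
     \sum_(k | ctype k == ta) at_type (enum_val i) ta * at_type (enum_val i') ta).
    by rewrite sumr_const_set /D -mulr_natl; ring.
  by congr (_ * _); apply: eq_bigr => k /eqP <-; rewrite !at_ctype.
have YX := mulmx1C XY.
have := congr1 (fun M : 'M[K]_N => M (enum_rank (ctype h)) (enum_rank (ctype g))) YX.
rewrite !mxE (inj_eq enum_rank_inj) eq_sym => <-.
rewrite mulr_suml mulr_suml (reindex (@enum_val _ {: partition n})) /=; last first.
  exact/onW_bij/enum_val_bij.
apply: eq_bigr => i _; rewrite !mxE !enum_rankK !at_ctype /D -/(class_size h).
rewrite mulrC; field.
by rewrite class_size_neq0 fact_neq0.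
Qed.

(** Column orthogonality collapses the double sum to the class of [g]. *)
Lemma chi_expand (f : 'S_n -> K) g : (forall k h, f (k ^ h)%g = f k) ->
  f g = \sum_la (n`!%:R^-1 * \sum_h f h * ch la h) * ch la g.
Proof.
move=> fJ; have fc h : ctype h = ctype g -> f h = f g.
  by move/esym/ctype_conj => [x ->].
under eq_bigr do rewrite -mulrA mulr_suml.
rewrite -mulr_sumr exchange_big /=.
have -> : \sum_h \sum_la f h * ch la h * ch la g
   = \sum_(h | ctype h == ctype g) f g * n`!%:R / (class_size g)%:R.
  rewrite [RHS]big_mkcond; apply: eq_bigr => h _.
  under eq_bigr do rewrite -mulrA.
  rewrite -mulr_sumr chi_orth2; case: eqP => [/fc -> | _].
    by rewrite mul1r mulrA.
  by rewrite !mul0r mulr0.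
rewrite sumr_const_set -/(class_size g) -mulr_natr.
field; by rewrite class_size_neq0 fact_neq0.
Qed.

(** The left side counts the x with g x h = x: it is the character of the bimodule K[S_n]. Expanded
    as a class function of [g], its coefficient at [la] is the value of the character at [h]. *)
Lemma tau_gelt2 g h : tau [: g] [: h] = \sum_la ch la g * ch la h.
Proof.
rewrite (@chi_expand (fun g => tau [: g] [: h])); last first.
  by move=> k x; rewrite tauC tau_geltJ tauC.
apply: eq_bigr => la _; rewrite mulrC; congr (_ * _).
rewrite [X in _ * X](_ : _ = n`!%:R * ch la h^-1).
  by rewrite mulKf ?fact_neq0 // chiV.
under eq_bigr do rewrite tau_gelt mulr_suml.
rewrite exchange_big /= -card_Sn mulr_natl -sumr_const; apply: eq_bigr => x _.
rewrite (bigD1 (x * h^-1 * x^-1)%g) //= geltE eqxx mul1r big1 ?addr0.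
  by rewrite /chi -(tau_geltJ _ h^-1 x^-1) conjgE invgK mulgA.
by move=> k /negbTE kx; rewrite geltE eq_sym kx mul0r.
Qed.

(* The central idempotent chi(1) / n! * \sum_g chi(g^-1) g, since chi(1) is n! / kappa. *)
Definition isotypic la : A := (kap la)^-1 *: \sum_g ch la g^-1 *: [: g].

(** Values of the character are sums of values of [ysym] over conjugates, so the idempotent is a
    multiple of the sum of the conjugates of [ysym]. In this form it inherits the products of Young
    symmetrizers. *)
Lemma isotypicE la : 
  isotypic la = ((kap la)^-1 * (kap la)^-1) *: \sum_x [: x^-1] * c la * [: x].
Proof.
rewrite -scalerA; congr (_ *: _); apply/ffunP => g.
rewrite [RHS]ffunE !sum_ffunE (bigD1 g) //= ffunE geltE eqxx big1 => [|h /negbTE hg].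
  rewrite addr0 {1}/GRing.scale /= mulr1 /chi; congr (_ * _).
  rewrite tau_gelt; apply: eq_bigr => x _; rewrite mul_geltE gelt_mulE.
  by rewrite !invgK mulgA.
by rewrite ffunE geltE eq_sym hg scaler0.
Qed.

Lemma isotypic_central la u : isotypic la * u = u * isotypic la.
Proof.
have cx x : [: x^-1] * isotypic la * [: x] = isotypic la.
  rewrite isotypicE -scalerAr -scalerAl mulr_sumr mulr_suml; congr (_ *: _).
  rewrite [RHS](reindex_inj (mulIg x)); apply: eq_bigr => y _.
  by rewrite invMg !geltM !mulrA.
have ex x : [: x] * isotypic la = isotypic la * [: x].
  by rewrite -{1}(cx x) !mulrA -geltM mulgV gelt1 mul1r.
rewrite -[_ * u]mulr1 -[u * _]mul1r mulrA !mid_sumE; apply: eq_bigr => x _.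
by rewrite mulr1 mul1r ex.
Qed.

(** The coefficients at [g] are chi(g) chi(1) / n!; by [tau_gelt2] they add up to the number of x
    with g x = x, divided by n!. *)
Lemma sum_isotypic : \sum_la isotypic la = 1.
Proof.
apply/ffunP => g; rewrite sum_ffunE -gelt1 geltE.
have coe la : isotypic la g = n`!%:R^-1 * (ch la g * ch la 1%g).
  rewrite /isotypic scale_galgE sum_ffunE (bigD1 g) //= ffunE geltE eqxx.
  rewrite big1 ?addr0 => [|h /negbTE hg]; last by rewrite ffunE geltE eq_sym hg scaler0.
  have -> : ch la 1%g = (kap la)^-1 * n`!%:R by rewrite /chi gelt1 tau_ysym1.
  rewrite {1}/GRing.scale /= mulr1 chiV; field.
  by rewrite fact_neq0 kap_neq0.
under eq_bigr do rewrite coe.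
rewrite -mulr_sumr -tau_gelt2 tau_gelt.
under eq_bigr do rewrite invg1 mulg1 mulgV geltE.
rewrite sumr_const card_Sn -[(1%g == g)%:R *+ _]mulr_natr mulrC mulfK ?fact_neq0 //.
by rewrite eq_sym.
Qed.

Lemma ysym_isotypic0 la mu : la != mu -> c mu * isotypic la = 0.
Proof.
move=> neq; have neq' : parts la <> parts mu by move/parts_inj; apply/eqP.
case: (ysym_orth charK (partsP la) (partsP mu) neq') => orth.
  rewrite -isotypic_central isotypicE -scalerAl mulr_suml big1 ?scaler0 // => x _.
  have -> : [: x^-1] * c la * [: x] * c mu = [: x^-1] * (c la * [: x] * c mu).
    by rewrite !mulrA.
  by rewrite orth mulr0.
rewrite isotypicE -scalerAr mulr_sumr big1 ?scaler0 // => x _.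
have -> : c mu * ([: x^-1] * c la * [: x]) = (c mu * [: x^-1] * c la) * [: x].
  by rewrite !mulrA.
by rewrite orth mul0r.
Qed.

Lemma ysym_isotypic la : c la * isotypic la = c la.
Proof.
rewrite -[RHS]mulr1 -sum_isotypic mulr_sumr (bigD1 la) //= big1 ?addr0 // => mu neq.
exact: ysym_isotypic0.
Qed.

(** In the expansion given by [tau_gelt2] the central factor moves onto [ysym], where it acts as the
    identity for mu = la and as 0 otherwise. *)
Lemma tau_isotypic la g h :
  tau (isotypic la * [: g]) [: h] = ch la g * ch la h.
Proof.
rewrite tau_suml; under eq_bigr do rewrite tau_gelt2 mulr_sumr.
rewrite exchange_big /=.
have aux mu : \sum_k (isotypic la * [: g]) k * (ch mu k * ch mu h)
    = (kap mu)^-1 * tau (c mu * isotypic la) [: g] * ch mu h.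
  under eq_bigr do rewrite mulrA.
  rewrite -mulr_suml; congr (_ * _).
  under eq_bigr do rewrite /chi mulrCA.
  by rewrite -mulr_sumr -tau_sumr tau_central //; apply: isotypic_central.
under eq_bigr do rewrite aux.
rewrite (bigD1 la) //= ysym_isotypic [X in _ + X]big1 ?addr0 // => mu neq.
rewrite ysym_isotypic0 1?eq_sym // /tau.
by under eq_bigr do rewrite !mul0r ffunE; rewrite big1 ?mulr0 ?mul0r.
Qed.
End Characters.

(** * The ideal of the antisymmetrizer *)

Section LinearSpan.
Variables (K : fieldType) (V : lmodType K) (S : V -> Prop).

Lemma linear_span0 : linear_span S 0.
Proof.
by exists 0%N, (fun=> 0), (fun=> 0); split=> [[]//|]; rewrite big_ord0.
Qed.

Lemma linear_spanD u v : linear_span S u -> linear_span S v -> linear_span S (u + v).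
Proof.
move=> [m [c [b [bS ->]]]] [m' [c' [b' [bS' ->]]]].
exists (m + m')%N, (fun i => match split i with inl j => c j | inr j => c' j end),
  (fun i => match split i with inl j => b j | inr j => b' j end).
split; first by move=> i; case: (split i).
rewrite big_split_ord /=; congr (_ + _); apply: eq_bigr => i _.
  by rewrite -[lshift _ _]/(unsplit (inl i)) unsplitK.
by rewrite -[rshift _ _]/(unsplit (inr i)) unsplitK.
Qed.

Lemma linear_spanZ a v : linear_span S v -> linear_span S (a *: v).
Proof.
move=> [m [c [b [bS ->]]]]; exists m, (fun i => a * c i), b; split=> //.
by rewrite scaler_sumr; apply: eq_bigr => i _; rewrite scalerA.
Qed.

Lemma linear_span_gen v : S v -> linear_span S v.
Proof.
by move=> Sv; exists 1%N, (fun=> 1), (fun=> v); rewrite big_ord1 scale1r.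
Qed.

Lemma linear_span_sum (I : finType) (P : pred I) (F : I -> V) :
  (forall i, P i -> linear_span S (F i)) -> linear_span S (\sum_(i | P i) F i).
Proof.
move=> FS; elim/big_ind: _ => //; [exact: linear_span0 | exact: linear_spanD].
Qed.

Lemma linear_span_ker (W : lmodType K) (f : {linear V -> W}) v :
  (forall u, S u -> f u = 0) -> linear_span S v -> f v = 0.
Proof.
move=> f0 [m [c [b [bS ->]]]]; rewrite linear_sum big1 // => i _.
by rewrite linearZ /= f0 ?scaler0.
Qed.
End LinearSpan.

Lemma linear_span_map (K : fieldType) (V W : lmodType K) (f : {linear V -> W})
    (S : V -> Prop) (S' : W -> Prop) v :
  (forall u, S u -> S' (f u)) -> linear_span S v -> linear_span S' (f v).
Proof.
move=> fS [m [c [b [bS ->]]]]; rewrite linear_sum; apply: linear_span_sum => i _.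
by rewrite linearZ; apply: linear_spanZ; apply: linear_span_gen; apply: fS.
Qed.

Section Antisymmetrizer.
Variables (K : fieldType) (n d : nat).
Hypothesis charK : [pchar K] =i pred0.
Local Notation A := (galg K 'S_n).
Local Notation "[: g ]" := (gelt K g) (format "[: g ]").
Local Notation first := [set j : 'I_n | (j <= d)%N].

Definition asym : A := \sum_(s | perm_on first s) (-1) ^+ (odd_perm s) *: [: s].
Definition asym_gen (u : A) := exists t1 t2 : 'S_n, u = [: t2] * asym * [: t1].

Lemma asym_tperm (i j : 'I_n) : i != j -> (i <= d)%N -> (j <= d)%N ->
  [: tperm i j] * asym = - asym.
Proof.
move=> ij id jd; have ton : perm_on first (tperm i j).
  by apply/subsetP => k; rewrite !inE; case: tpermP => [->|->|_ _] //; rewrite eqxx.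
rewrite /asym mulr_sumr [in RHS](reindex_inj (mulgI (tperm i j))) -sumrN.
apply: eq_big => s => [|_].
  apply/idP/idP => sS; first exact: perm_onM.
  by rewrite -(mulKg (tperm i j) s) tpermV; apply: perm_onM.
by rewrite geltM -scalerAr odd_permM odd_tperm ij signr_addb expr1 mulN1r scaleNr opprK.
Qed.

(* Two of the d+1 antisymmetrized points lie in the same row of la, and their
   transposition acts by 1 on one side and by -1 on the other. *)
Lemma short_row_asym0 la (laP : is_partition n la) (y : 'S_n) :
  (size la <= d)%N -> (d < n)%N -> row_sym K n la * [: y] * asym = 0.
Proof.
move=> szd dn.
have lt (j : 'I_d.+1) : (j < n)%N by apply: leq_trans (ltn_ord j) dn.
pose pt j := (y^-1)%g (Ordinal (lt j)).
have rlt j : (reshape_index la (pt j) < d)%N by apply: leq_trans (shape_row_lt laP _) szd.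
have [i [j [neq er]]] : exists i j : 'I_d.+1, i != j /\
    reshape_index la (pt i) = reshape_index la (pt j).
  have [/injectiveP/leq_card|/injectivePn] := boolP (injectiveb (fun j => Ordinal (rlt j))).
    by rewrite !card_ord ltnn.
  by case=> i [j neq e]; exists i, j; split; last by case: e.
have tR : tperm (pt i) (pt j) \in row_stab n la.
  by apply/row_stabP => k; case: tpermP => // ->.
have neq' : Ordinal (lt i) != Ordinal (lt j) by rewrite -val_eqE.
apply: (opp_self_eq0 charK).
rewrite -{1}(row_symMr K tR) -[_ * [: y]]mulrA -geltM.
rewrite (_ : (_ * _)%g = y * tperm (Ordinal (lt i)) (Ordinal (lt j)))%g.
  by rewrite geltM -!mulrA asym_tperm ?mulrN //= -ltnS.
have <- : (tperm (pt i) (pt j) ^ y)%g = tperm (Ordinal (lt i)) (Ordinal (lt j)).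
  by rewrite tpermJ !permKV.
by rewrite conjgE mulKVg.
Qed.

(** By [isotypicE] each term ends in a translate of a row symmetrizer, which [short_row_asym0]
    annihilates against [asym]. *)
Lemma short_isotypic_asym0 (la : partition n) u :
  (size (parts la) <= d)%N -> (d < n)%N -> isotypic K la * (u * asym) = 0.
Proof.
move=> szd dn; rewrite isotypicE -scalerAl mulr_suml big1 ?scaler0 // => x _.
have -> : [: x^-1] * ysym K n (parts la) * [: x] * (u * asym) =
   [: x^-1] * col_sym K n (parts la) * (row_sym K n (parts la) * ([: x] * u) * asym).
  by rewrite /ysym !mulrA.
rewrite [row_sym _ _ _ * _ * _]mid_sumE big1 ?mulr0 // => y _.
by rewrite (short_row_asym0 (partsP la)) ?scaler0.
Qed.

(** The first column has more than [d] cells; listing them before all others defines [y]. *)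
Lemma first_column la (laP : is_partition n la) : (d < size la)%N ->
  exists y : 'S_n, forall i : 'I_n, (i <= d)%N -> reshape_offset la (y i) = 0%N.
Proof.
move=> dsz; pose F := [set j : 'I_n | reshape_offset la j == 0%N].
have cF : (d < #|F|)%N.
  apply: leq_trans dsz _.
  have ok (k : 'I_(size la)) : (0 < nth 0 la k)%N.
    by case/and3P: laP => _ l0 _; rewrite lt0n; apply: contra l0 => /eqP <-; rewrite mem_nth.
  have lt (k : 'I_(size la)) : (flatten_index la k 0 < n)%N.
    by rewrite -(partition_sumn laP) flatten_indexP.
  rewrite -[X in (X <= _)%N]card_ord -(@card_imset _ _ (fun k => Ordinal (lt k))).
    apply/subset_leq_card/subsetP => _ /imsetP[k _ ->].
    by rewrite inE /= flatten_indexKr.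
  by move=> k k' [] /(congr1 (reshape_index la)); rewrite !flatten_indexKl // => /val_inj.
pose L := enum F ++ enum (~: F).
have szL : size L = n by rewrite size_cat -!cardE cardsC card_ord.
have uL : uniq L.
  rewrite cat_uniq !enum_uniq andbT /=; apply/hasPn => j.
  by rewrite !mem_enum inE.
have yinj : injective (fun i : 'I_n => nth i L i).
  move=> i j; rewrite (set_nth_default j) ?szL ?ltn_ord // => /eqP.
  by rewrite nth_uniq ?szL ?ltn_ord // => /eqP/val_inj.
exists (perm yinj) => i id; rewrite permE nth_cat -cardE (leq_ltn_trans id cF).
have : nth i (enum F) i \in enum F by rewrite mem_nth // -cardE (leq_ltn_trans id cF).
by rewrite mem_enum inE => /eqP.
Qed.

Lemma linear_span_asym (u v : A) : linear_span asym_gen (u * asym * v).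
Proof.
rewrite -[_ * v]mulr1 (mid_sumE _ 1 v); apply: linear_span_sum => x _.
apply: linear_spanZ; rewrite mulr1 -mulrA -[u]mul1r (mid_sumE 1 _ u).
apply: linear_span_sum => y _; apply: linear_spanZ; apply: linear_span_gen.
by exists x, y; rewrite mul1r mulrA.
Qed.

(* The column group contains a conjugate of the permutations of d+1 points of the
   first column, so the column antisymmetrizer is a multiple of asym. *)
Lemma long_isotypic_asym (la : partition n) (u : A) : (d < size (parts la))%N ->
  linear_span asym_gen (isotypic K la * u).
Proof.
move=> dsz; have [y yP] := first_column (partsP la) dsz.
(* Each of the (d+1)! terms acts on [C] by its sign, which cancels its sign in [asym]. *)
have colE C : (forall t, t \in col_stab n (parts la) -> [: t] * C = (-1) ^+ odd_perm t *: C) ->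
    [: y^-1] * asym * [: y] * C = #|[set s | perm_on first s]|%:R *: C.
  move=> CP.
  rewrite /asym !mulr_sumr !mulr_suml scaler_nat -sumr_const_set.
  apply: eq_bigr => s sS; rewrite -scalerAr -!scalerAl -!geltM -mulgA -conjgE.
  rewrite CP ?odd_permJ ?scalerA -?expr2 ?sqrr_sign ?scale1r //.
  apply/col_stabP => j; rewrite -[j](permKV y) permJ; move: (y^-1 j)%g => i.
  have [id|id] := leqP i d; last by rewrite (out_perm sS) // inE -ltnNge.
  by rewrite !yP //; move: (perm_closed i sS); rewrite !inE => ->.
have k0 : #|[set s : 'S_n | perm_on first s]|%:R != 0 :> K.
  by apply: natr_neq0 => //; apply/card_gt0P; exists 1%g; rewrite inE perm_on1.
have {}colE : col_sym K n (parts la) =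
   #|[set s : 'S_n | perm_on first s]|%:R^-1 *: ([: y^-1] * asym * [: y] * col_sym K n (parts la)).
  by rewrite colE ?scalerA ?mulVf ?scale1r //; apply: col_symMl.
rewrite isotypicE -scalerAl mulr_suml; apply: linear_spanZ.
apply: linear_span_sum => x _.
have -> : [: x^-1] * ysym K n (parts la) * [: x] * u =
   #|[set s : 'S_n | perm_on first s]|%:R^-1 *: 
  (([: x^-1] * [: y^-1]) * asym * ([: y] * col_sym K n (parts la) * row_sym K n (parts la) * [: x] * u)).
  by rewrite /ysym {1}colE -?scalerAl -?scalerAr -!scalerAl !mulrA.
apply: linear_spanZ; exact: linear_span_asym.
Qed.
End Antisymmetrizer.

(** * Multiplicities and dimensions of Hom spaces *)

Section HomDimension.
Variables (K : fieldType) (gT : finGroupType) (G : {group gT}).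
Hypothesis charK : [pchar K] =i pred0.

Lemma cardG_neq0 : #|G|%:R != 0 :> K.
Proof. exact: (natr_neq0 charK (cardG_gt0 G)). Qed.

Definition char_dot (dV dW : nat) (V : mx_representation K G dV)
    (W : mx_representation K G dW) : K :=
  #|G|%:R^-1 * \sum_(x in G) \tr (V x) * \tr (W (x^-1)%g).

Section Formula.
Variables (dV dW : nat) (V : mx_representation K G dV) (W : mx_representation K G dW).
Local Notation M := 'M[K]_(dV, dW).

Definition entry (ij : 'I_dV * 'I_dW) (B : M) : K^o := B ij.1 ij.2.
Lemma entry_linear ij : linear (entry ij).
Proof. by move=> a B C; rewrite /entry !mxE. Qed.
HB.instance Definition _ ij :=
  GRing.isLinear.Build K M K^o *:%R (entry ij) (entry_linear ij).

Lemma entry_sum (B : M) : B = \sum_ij entry ij B *: delta_mx ij.1 ij.2.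
Proof.
rewrite {1}[B]matrix_sum_delta pair_big /=; apply: eq_bigr => -[i j] _ //=.
Qed.

Definition hom_avg (B : M) : M := #|G|%:R^-1 *: \sum_(x in G) V x *m B *m W (x^-1)%g.
Lemma hom_avg_linear : linear hom_avg.
Proof.
move=> a B C; rewrite /hom_avg scalerA mulrC -scalerA -scalerDr; congr (_ *: _).
rewrite scaler_sumr -big_split /=; apply: eq_bigr => x _.
by rewrite mulmxDr mulmxDl -scalemxAr -scalemxAl.
Qed.
HB.instance Definition _ := GRing.isLinear.Build K M M *:%R hom_avg hom_avg_linear.

Lemma hom_avg_in B : hom_avg B \in hom_space V W.
Proof.
apply/mem_hom_space => x Gx; rewrite -scalemxAr -scalemxAl mulmx_sumr mulmx_suml.
congr (_ *: _); rewrite [RHS](reindex_inj (mulgI x)) /=.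
apply: eq_big => y; first by rewrite groupMl.
move=> Gy; rewrite repr_mxM // invMg repr_mxM ?groupV // -!mulmxA.
by rewrite -repr_mxM ?groupV // mulVg repr_mx1 mulmx1.
Qed.

Lemma hom_avg_id B : B \in hom_space V W -> hom_avg B = B.
Proof.
move/mem_hom_space => BH; rewrite /hom_avg (eq_bigr (fun=> B)).
  by rewrite sumr_const -scaler_nat scalerA mulVf ?scale1r ?cardG_neq0.
by move=> x Gx; rewrite BH // -mulmxA -repr_mxM ?groupV // mulgV repr_mx1 mulmx1.
Qed.

Lemma entry_conj (A : 'M[K]_dV) (B : 'M[K]_dW) i j :
  (A *m delta_mx i j *m B) i j = A i i * B j j.
Proof.
rewrite -(mul_delta_mx (0 : 'I_1)) mulmxA -colE -mulmxA -rowE.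
by rewrite mxE big_ord1 !mxE.
Qed.

(** Averaging projects onto the intertwiners, and B |-> V(x) B W(x^-1) has trace tr V(x) tr
    W(x^-1). *)
Lemma dim_hom_space : (\dim (hom_space V W))%:R = char_dot V W.
Proof.
pose T : 'End(M) := linfun hom_avg.
have TE B : T B = hom_avg B by rewrite lfunE.
have TT : (T \o T)%VF = T.
  by apply/lfunP => B; rewrite comp_lfunE !TE hom_avg_id ?hom_avg_in.
have <- : limg T = hom_space V W.
  apply/eqP; rewrite eqEsubv; apply/andP; split.
    by apply/subvP => _ /memv_imgP[B _ ->]; rewrite TE hom_avg_in.
  by apply/subvP => B BH; rewrite -(hom_avg_id BH) -TE memv_img ?memvf.
rewrite -(trace_idem (co := entry) entry_sum TT) /char_dot.
under eq_bigr => ij _ do rewrite TE /= /entry /hom_avg mxE summxE.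
rewrite -mulr_sumr; congr (_ * _); rewrite exchange_big /=; apply: eq_bigr => x _.
under eq_bigr => ij _ do rewrite entry_conj.
rewrite -(pair_bigA _ (fun i j => V x i i * W (x^-1)%g j j)) /= mulr_suml.
by apply: eq_bigr => i _; rewrite mulr_sumr.
Qed.
End Formula.

Lemma natr_inj_pchar0 (m m' : nat) : m%:R = m'%:R :> K -> m = m'.
Proof.
wlog le : m m' / (m <= m')%N; [move=> wl e | move/eqP].
  by have [/wl h|/ltnW/wl h] := leqP m m'; [exact: h | apply/esym/h/esym].
rewrite -subr_eq0 -opprB oppr_eq0 -natrB // (pcharf0P K).1 // subn_eq0 => le'.
by apply/eqP; rewrite eqn_leq le le'.
Qed.

(** By Maschke a submodule has a projection commuting with [G]. The space of endomorphisms has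
    dimension 1, so this projection is a scalar, and it is the identity when the submodule is
    nonzero. *)
Lemma char_dot1_irr d (V : mx_representation K G d) : char_dot V V = 1 -> mx_irreducible V.
Proof.
rewrite -dim_hom_space => /(@natr_inj_pchar0 _ 1%N) dim1.
have h1 : 1%:M \in hom_space V V by apply/mem_hom_space => x _; rewrite mulmx1 mul1mx.
have n1 : 1%:M != 0 :> 'M[K]_d.
  apply: contra_eq_neq dim1 => e; suff -> : hom_space V V = 0%VS by rewrite dimv0.
  apply/eqP; rewrite -subv0; apply/subvP => B _.
  by rewrite -[B]mulmx1 e mulmx0 mem0v.
split=> [||U modU _ nzU]; rewrite ?mxmodule1 //.
have p'G : [pchar K]^'.-group G by apply/pgroupP => p _ _; rewrite inE /= charK.
have [W modW sumW dxW] := mx_Maschke_pchar V p'G modU (submx1 U).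
move/mxdirect_addsP: dxW => dxW.
pose P := proj_mx U W.
have : P \in hom_space V V.
  have := proj_mx_hom dxW modU modW; rewrite sumW => /hom_mxP hP.
  by apply/mem_hom_space => x Gx; have := hP x Gx; rewrite !mul1mx => ->.
have -> : hom_space V V = <[1%:M]>%VS.
  apply/esym/eqP; rewrite eqEdim dim1 dim_vline n1 leqnn andbT.
  by rewrite -memvE.
case/vlineP => a Pa.
have a1 : a = 1.
  have := proj_mx_id dxW (submx_refl U); rewrite -/P Pa -scalemxAr mulmx1 => e.
  have /eqP : (a - 1) *: U = 0 by rewrite scalerBl e scale1r subrr.
  by rewrite scaler_eq0 (negbTE nzU) orbF subr_eq0 => /eqP.
by have := proj_mx_sub U W 1%:M; rewrite -/P Pa a1 scale1r mulmx1.
Qed.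

(** Schur: kernel and image of an intertwiner are submodules, so a nonzero one is an isomorphism. *)
Lemma hom_space_irr0 (dV dW : nat) (V : mx_representation K G dV) (W : mx_representation K G dW) :
  mx_irreducible V -> mx_irreducible W -> ~ mx_rsim V W -> hom_space V W = 0%VS.
Proof.
move=> [_ nzV simV] [_ nzW simW] nsim; apply/eqP; rewrite -subv0; apply/subvP => B.
move/mem_hom_space => BH; rewrite memv0; apply: contra_notT nsim => nzB.
have kerB : kermx B = 0.
  apply/eqP; apply: contraNT nzB => nzk.
  have modk : mxmodule V (kermx B).
    apply/mxmoduleP => x Gx; apply/sub_kermxP.
    by rewrite -mulmxA BH // mulmxA mulmx_ker mul0mx.
  have := simV _ modk (submx1 _) nzk; move/sub_kermxP; rewrite mul1mx => ->.
  by [].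
have freeB : row_free B by rewrite -kermx_eq0 kerB.
have fullB : row_full B.
  have modB : mxmodule W <<B>>%MS.
    apply/mxmoduleP => x Gx; rewrite (eqmxMr _ (genmxE B)) genmxE -BH //.
    exact: submxMl.
  have := simW _ modB (submx1 _); rewrite -sub1mx genmxE; apply.
  by rewrite -submx0 genmxE submx0.
have e : dV = dW by rewrite -(eqP freeB) (eqP fullB).
by exists B.
Qed.
End HomDimension.

Section MultiplicityFormula.
Variables (K : decFieldType) (gT : finGroupType) (G : {group gT}).
Hypothesis charK : [pchar K] =i pred0.

(** By complete reducibility the trace on [W] is the sum of the traces on its simple constituents
    with multiplicity, and [V] pairs with a simple module to 1 or 0. *)
Lemma multiplicityE (dV dW : nat) (V : mx_representation K G dV) (W : mx_representation K G dW) :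
  char_dot V V = 1 -> (multiplicity V W)%:R = char_dot V W.
Proof.
move=> V1; have irrV := char_dot1_irr charK V1.
have p'G : [pchar K]^'.-group G by apply/pgroupP => p _ _; rewrite inE /= charK.
have trW x : x \in G -> \tr (W x) = \sum_(C : DecSocleType W) \tr (socle_repr C x) *+ socle_mult C.
  move=> Gx; rewrite -(mxtrace_Socle (DecSocleType W)) //; symmetry.
  apply: mxtrace_submod1 => //.
  by rewrite (reducible_Socle1 (DecSocleType W) (mx_Maschke_pchar W p'G)).
have -> : char_dot V W = \sum_(C : DecSocleType W) char_dot V (socle_repr C) *+ socle_mult C.
  rewrite /char_dot; under eq_bigr => x Gx do rewrite trW ?groupV // mulr_sumr.
  rewrite exchange_big mulr_sumr /=; apply: eq_bigr => C _.
  rewrite -mulrnAr -sumrMnl; congr (_ * _); apply: eq_bigr => x _.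
  by rewrite mulrnAr.
rewrite /multiplicity natr_sum big_mkcond /=; apply: eq_bigr => C _.
case: asboolP => sim.
  suff -> : char_dot V (socle_repr C) = 1 by [].
  rewrite -V1 /char_dot; congr (_ * _); apply: eq_bigr => x Gx; congr (_ * _).
  by symmetry; apply: mxtrace_rsim; rewrite ?groupV.
rewrite -dim_hom_space // (hom_space_irr0 irrV (socle_irr C) sim).
by rewrite dimv0 mul0rn.
Qed.
End MultiplicityFormula.

(** * Littlewood-Richardson and Kronecker coefficients *)

Lemma sig_big (R : Type) (idx : R) (op : Monoid.com_law idx) (I : finType)
    (T : I -> finType) (F : {i : I & T i} -> R) :
  \big[op/idx]_j F j = \big[op/idx]_i \big[op/idx]_(a : T i) F (Tagged T a).
Proof.
rewrite (@sig_big_dep _ _ op I T xpredT (fun _ => xpredT) (fun i a => F (Tagged T a))) /=.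
by apply: eq_bigr => -[i a] _.
Qed.

Section SumsOfProducts.
Variable R : comPzSemiRingType.

Lemma sum_dffun_prod_gen (I : finType) (T : I -> finType) (F : forall i, T i -> R) :
  \sum_(f : {dffun forall i, T i}) \prod_i F i (f i) = \prod_i \sum_j F i j.
Proof.
rewrite (reindex (@dffun_of_fprod I T)); last exact/onW_bij/dffun_of_fprod_bij.
pose P i : {ffun T i -> R} := [ffun j => F i j].
transitivity (\sum_(t : fprod T) \prod_(i in I) P i (t i)).
  by apply: eq_bigr => t _; apply: eq_bigr => i _; rewrite !ffunE.
rewrite big_fprod.
rewrite -(bigA_distr_big_dep _ (fun i j => untag 0 (P i) j)).
apply: eq_bigr => i _; rewrite -(big_tag (fun i j => P i j)).
by apply: eq_bigr => j _; rewrite ffunE.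
Qed.

Lemma sum_tuple_prod (n : nat) (X : finType) (F : 'I_n -> X -> R) :
  \sum_(t : n.-tuple X) \prod_a F a (tnth t a) = \prod_a \sum_x F a x.
Proof.
rewrite bigA_distr_bigA /= (reindex (fun t : n.-tuple X => [ffun a => tnth t a])) /=.
  by apply: eq_bigr => t _; apply: eq_bigr => a _; rewrite ffunE.
exists (fun f : {ffun 'I_n -> X} => [tuple f a | a < n]) => [t _ | f _].
  by apply: eq_from_tnth => a; rewrite tnth_mktuple ffunE.
by apply/ffunP => a; rewrite ffunE tnth_mktuple.
Qed.

Lemma card_dffun_prod (I : finType) (T : I -> finType) :
  #|{dffun forall i, T i}|%:R = \prod_i #|T i|%:R :> R.
Proof.
rewrite -sumr_const; transitivity (\sum_(f : {dffun forall i, T i}) \prod_(i : I) (1 : R)).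
  by apply: eq_bigr => f _; rewrite big1.
rewrite (@sum_dffun_prod_gen _ T (fun _ _ => 1)).
by apply: eq_bigr => i _; rewrite sumr_const.
Qed.
End SumsOfProducts.

Section PermCharacter.
Variables (K : fieldType).

(** [n] and [n'] are equal only through [f]; once they are identified, [f] is a conjugating
    permutation. *)
Lemma chi_equiv n n' la (s : 'S_n) (t : 'S_n') (f : 'I_n -> 'I_n') :
  bijective f -> (forall x, f (s x) = t (f x)) -> chi K la s = chi K la t.
Proof.
move=> bf; have e : n = n' by move/bij_eq_card: (bf); rewrite !card_ord.
case: n' / e t f bf => t f bf ft.
have -> : t = (s ^ perm (bij_inj bf))%g.
  apply/permP => y; rewrite -[y](permKV (perm (bij_inj bf))) permJ.
  by rewrite !permE -ft.
by rewrite /chi tau_geltJ.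
Qed.

Section OrdPerm.
Variables (T : finType) (s : {perm T}).
Lemma ord_perm_inj : injective (fun x : 'I_#|T| => enum_rank (s (enum_val x))).
Proof. by move=> x y /enum_rank_inj/perm_inj/enum_val_inj. Qed.
Definition ord_perm : 'S_#|T| := perm ord_perm_inj.
End OrdPerm.

(** By conjugation invariance every numbering of [T] gives the same value, so the permuted points
    may be strings or pairs instead of numbers. *)
Definition chiT la (T : finType) (s : {perm T}) : K := chi K la (ord_perm s).

Lemma chiT_equiv la (T T' : finType) (s : {perm T}) (t : {perm T'}) (f : T -> T') :
  bijective f -> (forall x, f (s x) = t (f x)) -> chiT la s = chiT la t.
Proof.
move=> bf ft; apply: (@chi_equiv _ _ _ _ _ (fun x => enum_rank (f (enum_val x)))).
  exact: bij_comp (bij_comp (enum_rank_bij _) bf) (enum_val_bij _).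
by move=> x; rewrite !permE !enum_rankK ft.
Qed.

Lemma chiT_chi la n (s : 'S_n) (T : finType) (t : {perm T}) (f : 'I_n -> T) :
  bijective f -> (forall x, f (s x) = t (f x)) -> chi K la s = chiT la t.
Proof.
move=> bf ft; apply: (@chi_equiv _ _ _ _ _ (fun x => enum_rank (f x))).
  exact: bij_comp (enum_rank_bij _) bf.
by move=> x; rewrite !permE !enum_rankK ft.
Qed.
End PermCharacter.

Lemma card_sig (I : finType) (T : I -> finType) :
  #|{: {i : I & T i}}| = (\sum_i #|T i|)%N.
Proof.
transitivity (sumn [seq #|T i| | i <- enum I]); first exact: card_tagged.
by rewrite sumnE big_map big_enum.
Qed.

Section SigPerm.
Variables (J : finType) (m : J -> nat).

Definition sig_fun (x : {dffun forall j, 'S_(m j)}) (u : {j & 'I_(m j)}) : {j & 'I_(m j)} :=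
  Tagged (fun j => 'I_(m j)) (x (tag u) (tagged u)).

Lemma sig_fun_inj x : injective (sig_fun x).
Proof.
move=> [i a] [j b] /eqP; rewrite /sig_fun /= -tag_eqE /tag_eq /= => /andP[/eqP e].
case: j / e b => b; rewrite tagged_asE => /eqP /perm_inj -> //.
Qed.

Definition sig_perm x : {perm {j & 'I_(m j)}} := perm (@sig_fun_inj x).

Lemma sig_permE x j (a : 'I_(m j)) :
  sig_perm x (Tagged (fun j => 'I_(m j)) a) = Tagged (fun j => 'I_(m j)) (x j a).
Proof. by rewrite permE. Qed.
End SigPerm.

Section LRForm.
Variable K : fieldType.

(** The scalar product of an outer product of characters with a restricted character, its factors
    indexed by any finite type. Inverses are absent since these characters are invariant under
    inversion. *)
Definition lr_form (J : finType) (m : J -> nat) (l : J -> seq nat) (la : seq nat) : K :=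
  (\prod_j (m j)`!%:R)^-1 *
  \sum_(x : {dffun forall j, 'S_(m j)}) (\prod_j chi K (l j) (x j)) * chiT K la (sig_perm x).

Lemma lr_form_reindex (J J' : finType) (f : J -> J') (m : J' -> nat) (l : J' -> seq nat) la :
  bijective f -> lr_form (m \o f) (l \o f) la = lr_form m l la.
Proof.
move=> bf; have [g fK gK] := bf.
rewrite /lr_form (reindex f (onW_bij _ bf)) /=; congr (_ * _).
pose h (x : {dffun forall j', 'S_(m j')}) : {dffun forall j, 'S_(m (f j))} :=
  [ffun j => x (f j)].
have bh : bijective h.
  (* A family pulled back along [f] returns through a cast along [f (g j') = j']; the two facts
     [aux] remove it. *)
  pose h' (z : {dffun forall j, 'S_(m (f j))}) : {dffun forall j', 'S_(m j')} :=
    [ffun j' => eq_rect _ (fun j' => 'S_(m j')) (z (g j')) _ (gK j')].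
  exists h' => [x|z]; apply/ffunP => j; rewrite !ffunE.
    have aux j1 (e : j1 = j) : eq_rect _ (fun j' => 'S_(m j')) (x j1) _ e = x j.
      by case: j / e.
    exact: aux.
  have aux j1 (e : f j1 = f j) : eq_rect _ (fun j' => 'S_(m j')) (z j1) _ e = z j.
    have j1j : j1 = j by apply: (can_inj fK).
    by case: j / j1j e => e; rewrite (eq_irrelevance e erefl).
  exact: aux.
rewrite (reindex h (onW_bij _ bh)) /=; apply: eq_bigr => x _; congr (_ * _).
  by rewrite [RHS](reindex f (onW_bij _ bf)) /=; apply: eq_bigr => j _; rewrite ffunE.
pose F (u : {j & 'I_(m (f j))}) : {j & 'I_(m j)} := Tagged (fun j => 'I_(m j)) (tagged u).
have injF : injective F.
  move=> [i a] [j b] /eqP; rewrite /F /= -tag_eqE /tag_eq /= => /andP[/eqP/(can_inj fK) e].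
  by case: j / e b => b; rewrite tagged_asE => /eqP ->.
apply: (@chiT_equiv _ _ _ _ _ _ F).
  by apply: inj_card_bij => //; rewrite !card_sig (reindex f (onW_bij _ bf)).
by case=> j a; rewrite !sig_permE ffunE.
Qed.
End LRForm.

Section LRCoefficient.
Variable K : closedFieldType.
Hypothesis charK : [pchar K] =i pred0.

Lemma mxtrace_tensor (I : finType) (d : I -> nat) (A : forall i, 'M[K]_(d i)) :
  \tr (tensor_mx A) = \prod_i \tr (A i).
Proof.
rewrite /mxtrace -(sum_dffun_prod (fun i j => A i j j)) [RHS]big_enum_val /=.
by apply: eq_bigr => a _; rewrite mxE.
Qed.

Lemma specht_traceP n la (laP : is_partition n la) g : \tr (specht K n la g) = chi K la g.
Proof. exact: specht_trace. Qed.

Lemma chi_inv n la (laP : is_partition n la) (g : 'S_n) : chi K la g^-1 = chi K la g.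
Proof. by have [p <-] := partitionE laP; apply: chiV. Qed.

Lemma chi_dot1 n la (laP : is_partition n la) :
  n`!%:R^-1 * (\sum_(g : 'S_n) chi K la g * chi K la g^-1) = 1.
Proof.
have [p <-] := partitionE laP; under eq_bigr do rewrite chiV.
by rewrite chi_orth // eqxx.
Qed.

Lemma card_young_group k (m : 'I_k -> nat) :
  #|[set: {dffun forall i, 'S_(m i)}]|%:R = \prod_i (m i)`!%:R :> K.
Proof.
rewrite cardsT (@card_dffun_prod K _ (fun i => 'S_(m i))).
by apply: eq_bigr => i _; rewrite card_Sn.
Qed.

(** The norm of an outer product of characters is the product of the norms, so the outer product of
    Specht modules meets the norm condition of [multiplicityE]. *)
Lemma lr_multiplicity k (m : 'I_k -> nat) (l : 'I_k -> seq nat) la :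
    (forall i, is_partition (m i) (l i)) -> is_partition (\sum_i m i)%N la ->
  (multiplicity (box_tensor_repr (fun i => specht K (m i) (l i)))
    (young_restriction (specht K (\sum_i m i)%N la)))%:R = lr_form K m l la.
Proof.
move=> lP laP; rewrite multiplicityE //; last first.
  rewrite /char_dot card_young_group.
  transitivity (\prod_i ((m i)`!%:R^-1 * \sum_(g : 'S_(m i)) chi K (l i) g * chi K (l i) g^-1)).
    rewrite big_split /= prodfV; congr (_ * _).
    rewrite -(@sum_dffun_prod_gen K _ (fun i => 'S_(m i)) (fun i g => chi K (l i) g * chi K (l i) g^-1)).
    apply: eq_big => [x|x _]; first by rewrite inE.
    rewrite /= !mxtrace_tensor -big_split /=; apply: eq_bigr => i _.
    by rewrite !specht_traceP // ffunE.
  by rewrite big1 // => i _; apply: chi_dot1.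
rewrite /char_dot card_young_group /lr_form; congr (_ * _).
apply: eq_big => [x|x _]; first by rewrite inE.
rewrite /= mxtrace_tensor; congr (_ * _).
  by apply: eq_bigr => i _; rewrite specht_traceP.
rewrite specht_traceP // (_ : young_perm x^-1 = (young_perm x)^-1)%g; last first.
  by apply/eqP; rewrite eq_sym eq_invg_mul -young_permM mulgV young_perm1.
rewrite chi_inv //; apply: (@chiT_chi _ _ _ _ _ _ (fun j => tagnat.sig j)).
  exact: tagnat.sig_bij.
by move=> j; rewrite !permE /young_fun /tagnat.Rank tagnat.rankK.
Qed.

Lemma lr_coefE (J : finType) (m : J -> nat) (l : J -> seq nat) la (ls : seq (seq nat))
    (f : 'I_(size ls) -> J) : bijective f ->
    (forall i, nth_part i = l (f i)) -> (forall j, is_partition (m j) (l j)) ->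
    is_partition (\sum_j m j)%N la ->
  (lr_coef K la ls)%:R = lr_form K m l la.
Proof.
move=> bf lf lP laP; rewrite /lr_coef.
have mE i : sumn (nth_part i) = m (f i) by rewrite lf; apply: partition_sumn (lP _).
rewrite lr_multiplicity.
- rewrite -(lr_form_reindex K m l la bf); congr (lr_form K _ _ la); apply/funext => i //=.
- by move=> i; rewrite mE lf.
- rewrite (_ : (\sum_i sumn (nth_part i))%N = (\sum_j m j)%N) //.
  by rewrite [RHS](reindex f (onW_bij _ bf)); apply: eq_bigr => i _.
Qed.

Lemma kronecker_coefE m (ls : seq (seq nat)) : all (is_partition m) ls ->
  (kronecker_coef K m ls)%:R = m`!%:R^-1 * \sum_(s : 'S_m) \prod_(l <- ls) chi K l s.
Proof.
move=> /allP lsP; rewrite /kronecker_coef dim_hom_space // /char_dot cardsT card_Sn.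
congr (_ * _); apply: eq_big => [s|s _]; first by rewrite inE.
rewrite /= mxtrace1 mulr1 mxtrace_tensor (big_nth [::]) big_mkord.
by apply: eq_bigr => i _; rewrite specht_traceP //; apply/lsP/mem_nth.
Qed.
End LRCoefficient.

Lemma enum_bij (J : finType) (X : Type) (x0 : X) (phi : J -> X) (L : seq J) (ls : seq X) :
  uniq L -> (forall j, j \in L) -> ls = map phi L ->
  exists2 f : 'I_(size ls) -> J, bijective f & forall i : 'I_(size ls), nth x0 ls i = phi (f i).
Proof.
move=> uL cL ->; have e : size (map phi L) = size L by rewrite size_map.
exists (fun i => tnth (in_tuple L) (cast_ord e i)).
  apply: inj_card_bij.
    move=> i j /eqP; have [d _] : exists d : J, True by exists (tnth (in_tuple L) (cast_ord e i)).
    rewrite !(tnth_nth d) nth_uniq //=; [|by rewrite -e|by rewrite -e].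
    by move/eqP => ij; apply: val_inj.
  rewrite card_ord e -(card_uniqP uL); apply/subset_leq_card/subsetP => j _.
  exact: cL.
move=> i; have [d _] : exists d : J, True by exists (tnth (in_tuple L) (cast_ord e i)).
by rewrite (nth_map d) -?e // (tnth_nth d).
Qed.

Section FlatParts.
Variables (r : nat) (t nn : 'I_r -> nat).
Local Notation J := {i : 'I_r & 'I_(t i)}.
Local Notation S := {dffun forall i : 'I_r, 'S_(nn i)}.

Lemma flat_parts_bij (mu : partition_families nn t) :
  exists2 f : 'I_(size (flat_parts mu)) -> J, bijective f &
    forall i, nth_part i = parts (tnth (mu (tag (f i))) (tagged (f i))).
Proof.
pose L : seq J := [seq Tagged (fun i => 'I_(t i)) a | i <- enum 'I_r, a <- enum 'I_(t i)].
apply: (@enum_bij J _ [::] (fun j => parts (tnth (mu (tag j)) (tagged j))) L).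
- apply: allpairs_uniq_dep; first exact: enum_uniq.
    by move=> i _; apply: enum_uniq.
  by move=> [i a] [j b] _ _.
- case=> i a; apply/allpairsPdep; exists i, a; split; rewrite ?mem_enum //.
- rewrite map_flatten -map_comp /flat_parts; congr flatten.
  apply: eq_map => i /=; rewrite -map_comp -{1}[val (mu i)]map_tnth_enum -map_comp.
  by [].
Qed.

(** The diagonal embedding of each S_{n_i} into its t_i-th power: there an outer product of
    characters becomes the character of an inner tensor product. *)
Definition diag_family (h : S) : {dffun forall j : J, 'S_(nn (tag j))} := [ffun j => h (tag j)].
Definition diag_perm (h : S) : {perm {j : J & 'I_(nn (tag j))}} := sig_perm (diag_family h).
End FlatParts.

Lemma sum_bilinear (R : comPzRingType) (X Y Z : finType) (a : X -> R) (b : Y -> R) (k : R)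
    (u : X -> Z -> R) (v : Y -> Z -> R) :
  \sum_x \sum_y a x * b y * (k * \sum_z u x z * v y z) =
  k * \sum_z (\sum_x a x * u x z) * (\sum_y b y * v y z).
Proof.
under [X in _ = _ * X]eq_bigr do rewrite mulr_suml.
rewrite exchange_big [in RHS]exchange_big mulr_sumr [LHS]exchange_big /=.
apply: eq_bigr => x _; under [X in _ = _ * X]eq_bigr do rewrite mulr_sumr.
rewrite exchange_big mulr_sumr /=; apply: eq_bigr => y _.
by rewrite mulrCA mulr_sumr; congr (_ * _); apply: eq_bigr => z _; rewrite mulrACA.
Qed.

(** * The sum of coefficients as an average of characters *)

Section HilbertSumCharacters.
Variable K : closedFieldType.
Hypothesis charK : [pchar K] =i pred0.
Variables (r : nat) (nn : 'I_r -> nat).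
Local Notation S := {dffun forall i : 'I_r, 'S_(nn i)}.

Definition fam_char (t : 'I_r -> nat) (mu : partition_families nn t) i (s : 'S_(nn i)) : K :=
  \prod_(x <- mu i) chi K (parts x) s.

Section Families.
Variable t : 'I_r -> nat.
Local Notation J := {i : 'I_r & 'I_(t i)}.

Lemma sum_families_prod (G : forall j : J, partition (nn (tag j)) -> K) :
  \sum_(mu : partition_families nn t) \prod_j G j (tnth (mu (tag j)) (tagged j))
  = \prod_j \sum_x G j x.
Proof.
pose F i (u : (t i).-tuple (partition (nn i))) : K :=
  \prod_a G (Tagged (fun i => 'I_(t i)) a) (tnth u a).
transitivity (\sum_(mu : partition_families nn t) \prod_i F i (mu i)).
  apply: eq_bigr => mu _; rewrite sig_big; apply: eq_bigr => i _; exact: eq_bigr.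
rewrite (@sum_dffun_prod_gen K _ (fun i => (t i).-tuple (partition (nn i)) : finType) F).
rewrite [RHS]sig_big /=.
apply: eq_bigr => i _.
exact: (@sum_tuple_prod K (t i) (partition (nn i)) (fun a => G (Tagged (fun i => 'I_(t i)) a))).
Qed.

Lemma sum_nn_tag : (\sum_(j : J) nn (tag j) = \sum_i nn i * t i)%N.
Proof.
rewrite sig_big /=.
by apply: eq_bigr => i _; rewrite sum_nat_const card_ord mulnC.
Qed.

(** This expands the restriction of chi_la to a Young subgroup in irreducible characters, at the
    diagonal element. With [lr_form] inserted, the sum over [mu] goes first: by [tau_gelt2] it
    counts the y with y h y^-1 = x, so only conjugates of the diagonal element remain, where chi_la
    is constant. *)
Lemma sum_lr_coef n (la : partition n) (h : S) : (\sum_i nn i * t i = n)%N ->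
  \sum_(mu : partition_families nn t)
     (lr_coef K (parts la) (flat_parts mu))%:R * \prod_i fam_char mu (h i)
  = chiT K (parts la) (diag_perm t h).
Proof.
move=> nE; pose W : K := \prod_(j : J) (nn (tag j))`!%:R.
have W0 : W != 0.
  by apply/prodf_neq0 => j _; apply: (natr_neq0 charK); apply: fact_gt0.
pose G (x : {dffun forall j : J, 'S_(nn (tag j))}) (j : J) (rho : partition (nn (tag j))) : K :=
  chi K (parts rho) (x j) * chi K (parts rho) (h (tag j)).
have lrE (mu : partition_families nn t) :
    (lr_coef K (parts la) (flat_parts mu))%:R * \prod_i fam_char mu (h i) =
    W^-1 * \sum_(x : {dffun forall j : J, 'S_(nn (tag j))})
       chiT K (parts la) (sig_perm x) * \prod_j G x j (tnth (mu (tag j)) (tagged j)).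
  have [f bf fE] := flat_parts_bij mu.
  rewrite (@lr_coefE K charK J (fun j : J => nn (tag j)) (fun j => parts (tnth (mu (tag j)) (tagged j)))
    (parts la) (flat_parts mu) f bf fE); first last.
  - by rewrite sum_nn_tag nE partsP.
  - by move=> j; apply: partsP.
  rewrite /lr_form -mulrA mulr_suml; congr (_ * _); apply: eq_bigr => x _.
  rewrite mulrAC mulrC /G [X in _ = _ * X]big_split /=; congr (_ * (_ * _)).
  rewrite /fam_char; under eq_bigr do rewrite big_tuple.
  by rewrite sig_big.
under eq_bigr do rewrite lrE.
rewrite -mulr_sumr exchange_big /=.
pose conj (y : {dffun forall j : J, 'S_(nn (tag j))}) : {dffun forall j : J, 'S_(nn (tag j))} :=
  [ffun j => y j * h (tag j) * (y j)^-1]%g.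
have sumG x : \sum_(mu : partition_families nn t) \prod_j G x j (tnth (mu (tag j)) (tagged j))
    = \sum_(y : {dffun forall j : J, 'S_(nn (tag j))}) (conj y == x)%:R.
  rewrite sum_families_prod.
  transitivity (\prod_(j : J) \sum_(z : 'S_(nn (tag j))) ((z * h (tag j) * z^-1)%g == x j)%:R : K).
    apply: eq_bigr => j _; rewrite /G; under eq_bigr do rewrite -[chi K _ (h _)]chiV.
    rewrite -tau_gelt2 // tau_gelt; apply: eq_bigr => z _.
    by rewrite geltE invgK.
  rewrite -(@sum_dffun_prod_gen K J (fun j => 'S_(nn (tag j)))
       (fun j z => ((z * h (tag j) * z^-1)%g == x j)%:R)).
  apply: eq_bigr => y _; case: eqP => [<-|neq].
    by rewrite big1 // => j _; rewrite ffunE eqxx.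
  have [j nej] : exists j, conj y j != x j.
    apply/existsP; apply: contra_notT neq; rewrite negb_exists => /forallP e.
    by apply/ffunP => j; apply/eqP; have := e j; rewrite negbK.
  by rewrite (bigD1 j) //=; move: nej; rewrite ffunE => /negbTE ->; rewrite mul0r.
under eq_bigr do rewrite -mulr_sumr sumG mulr_sumr.
rewrite exchange_big /=.
have -> : \sum_(y : {dffun forall j : J, 'S_(nn (tag j))})
   \sum_x chiT K (parts la) (sig_perm x) * (conj y == x)%:R
   = \sum_(y : {dffun forall j : J, 'S_(nn (tag j))}) chiT K (parts la) (diag_perm t h).
  apply: eq_bigr => y _; rewrite (bigD1 (conj y)) //= eqxx mulr1 big1 ?addr0.
    apply: (@chiT_equiv _ _ _ _ _ _ (sig_perm y)); first exact: injF_bij perm_inj.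
    by case=> j a; rewrite !sig_permE !ffunE !permM permKV.
  by move=> x /negbTE neq; rewrite eq_sym neq mulr0.
(* All elements [y] of the Young subgroup contribute equally; their number is [W]. *)
rewrite sumr_const -mulr_natl (@card_dffun_prod K J (fun j => 'S_(nn (tag j)))).
rewrite (eq_bigr (fun j : J => (nn (tag j))`!%:R)) -/W ?mulKf // => j _.
by rewrite card_Sn.
Qed.
End Families.

Lemma fam_charJ t (mu : partition_families nn t) i (s x : 'S_(nn i)) :
  fam_char mu (s ^ x)%g = fam_char mu s.
Proof. by apply: eq_bigr => la _; rewrite /chi tau_geltJ. Qed.

Lemma kronecker_fam t (mu : partition_families nn t) i (rho : partition (nn i)) :
  (kronecker_coef K (nn i) (rcons [seq parts x | x <- mu i] (parts rho)))%:R =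
  (nn i)`!%:R^-1 * \sum_(s : 'S_(nn i)) fam_char mu s * chi K (parts rho) s.
Proof.
rewrite kronecker_coefE //; last first.
  rewrite all_rcons partsP /=; apply/allP => _ /mapP[x _ ->]; exact: partsP.
congr (_ * _); apply: eq_bigr => s _; rewrite -cats1 big_cat big_seq1 /=.
by rewrite big_map.
Qed.

(** Parseval for each label: the Kronecker coefficients are the coordinates of two class functions
    in the irreducible characters, and the sum over [rho] is their scalar product. *)
Lemma sum_kronecker p q (mu : partition_families nn p) (nu : partition_families nn q) :
  \sum_(rho : {dffun forall i, partition (nn i)})
     (\prod_i kronecker_coef K (nn i) (rcons [seq parts x | x <- mu i] (parts (rho i))))%N%:R
   * (\prod_i kronecker_coef K (nn i) (rcons [seq parts x | x <- nu i] (parts (rho i))))%N%:R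
  = (\prod_i (nn i)`!%:R)^-1 * \sum_(h : S) (\prod_i fam_char mu (h i)) * (\prod_i fam_char nu (h i)).
Proof.
pose F i (rho : partition (nn i)) : K :=
  (kronecker_coef K (nn i) (rcons [seq parts x | x <- mu i] (parts rho)))%:R *
  (kronecker_coef K (nn i) (rcons [seq parts x | x <- nu i] (parts rho)))%:R.
transitivity (\sum_(rho : {dffun forall i, partition (nn i)}) \prod_i F i (rho i)).
  by apply: eq_bigr => rho _; rewrite !natr_prod -big_split.
rewrite (@sum_dffun_prod_gen K _ (fun i => partition (nn i) : finType) F).
under [X in _ = _ * X]eq_bigr do rewrite -big_split.
rewrite (@sum_dffun_prod_gen K _ (fun i => 'S_(nn i)) (fun i s => fam_char mu s * fam_char nu s)).
rewrite -prodfV -big_split /=; apply: eq_bigr => i _.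
rewrite /F; under eq_bigr do rewrite !kronecker_fam -mulrA mulr_suml.
rewrite -mulr_sumr exchange_big /=; congr (_ * _); apply: eq_bigr => s _.
under eq_bigr do rewrite -mulrA.
rewrite -mulr_sumr; congr (_ * _).
rewrite [RHS](chi_expand charK); last by move=> k x; apply: fam_charJ.
by apply: eq_bigr => rho _; rewrite mulrC.
Qed.

(** Once the sum over [rho] is an average over [h], the sums over [mu] and [nu] separate and
    [sum_lr_coef] evaluates each. *)
Theorem hilbert_sum_chi p q (P : pred (seq nat)) :
    (\sum_i nn i * p i = \sum_i nn i * q i)%N ->
  (hilbert_sum K p q nn P)%:R =
  \sum_(la : partition (\sum_i nn i * p i)%N | P (parts la))
    ((\prod_i (nn i)`!%:R)^-1 *
     \sum_(h : S) chiT K (parts la) (diag_perm p h) * chiT K (parts la) (diag_perm q h)).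
Proof.
move=> pq; rewrite /hilbert_sum natr_sum; apply: eq_bigr => la _.
transitivity (\sum_(mu : partition_families nn p) \sum_(nu : partition_families nn q)
  (lr_coef K (parts la) (flat_parts mu))%:R * (lr_coef K (parts la) (flat_parts nu))%:R *
  ((\prod_i (nn i)`!%:R)^-1 * \sum_(h : S) (\prod_i fam_char mu (h i)) * (\prod_i fam_char nu (h i)))).
  rewrite natr_sum; apply: eq_bigr => mu _; rewrite natr_sum; apply: eq_bigr => nu _.
  rewrite -sum_kronecker natr_sum mulr_sumr; apply: eq_bigr => rho _.
  by rewrite !natrM !mulrA.
under [X in _ = _ * X]eq_bigr => h _ do rewrite -(sum_lr_coef la h erefl) -(sum_lr_coef la h (esym pq)).
exact: sum_bilinear.
Qed.
End HilbertSumCharacters.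

(** * The Hilbert function *)

Section IsotypicProducts.
Variables (K : fieldType) (n : nat).
Hypothesis charK : [pchar K] =i pred0.

Lemma isotypicM (la mu : partition n) :
  isotypic K la * isotypic K mu = if la == mu then isotypic K la else 0.
Proof.
rewrite isotypicE -scalerAl mulr_suml.
have -> : \sum_x gelt K x^-1%g * ysym K n (parts la) * gelt K x * isotypic K mu
   = \sum_x gelt K x^-1%g * (if la == mu then ysym K n (parts la) else 0) * gelt K x.
  apply: eq_bigr => x _; rewrite -mulrA -isotypic_central // mulrA.
  congr (_ * _); rewrite -mulrA; congr (_ * _).
  case: eqVneq => [<-|neq]; first exact: ysym_isotypic.
  by apply: ysym_isotypic0; rewrite // eq_sym.
by case: eqP => // _; rewrite big1 ?scaler0 // => x _; rewrite mulr0 mul0r.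
Qed.

Definition short_part d : galg K 'S_n :=
  \sum_(la : partition n | (size (parts la) <= d)%N) isotypic K la.

Lemma short_part_idem d : short_part d * short_part d = short_part d.
Proof.
rewrite {1}/short_part mulr_suml; apply: eq_bigr => la szd.
rewrite /short_part mulr_sumr (bigD1 la) //= isotypicM eqxx big1 ?addr0 // => mu /andP[_ neq].
by rewrite isotypicM eq_sym (negbTE neq).
Qed.

Lemma short_part_central d u : short_part d * u = u * short_part d.
Proof.
by rewrite mulr_suml mulr_sumr; apply: eq_bigr => la _; apply: isotypic_central.
Qed.

Lemma short_part_asym d u : (d < n)%N -> short_part d * (u * asym K n d) = 0.
Proof.
by move=> dn; rewrite mulr_suml big1 // => la sz; apply: short_isotypic_asym0.
Qed.

Lemma short_part_compl d u :
  linear_span (@asym_gen K n d) (u - short_part d * u).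
Proof.
have -> : u - short_part d * u
    = (\sum_(la : partition n | ~~ (size (parts la) <= d)%N) isotypic K la) * u.
  rewrite -{1}[u]mul1r -(sum_isotypic n charK) -mulrBl; congr (_ * _).
  by rewrite (bigID (fun la : partition n => size (parts la) <= d)%N) /= [X in X - _]addrC addrK.
rewrite mulr_suml; apply: linear_span_sum => la; rewrite -ltnNge => sz.
exact: long_isotypic_asym.
Qed.
Lemma tau_short_part d (g h : 'S_n) :
  tau (short_part d * gelt K g) (gelt K h) =
  \sum_(la : partition n | (size (parts la) <= d)%N) chi K (parts la) g * chi K (parts la) h.
Proof.
rewrite /short_part mulr_suml tau_linear_suml.
by apply: eq_bigr => la _; apply: tau_isotypic.
Qed.
End IsotypicProducts.

(** * Numbered strings, and the closed diagrams of one degree as orbits *)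

Section StandardNumbering.
Variables (r : nat) (nn : 'I_r -> nat).
Local Notation B := {i : 'I_r & 'I_(nn i)}.
Local Notation S := {dffun forall i : 'I_r, 'S_(nn i)}.
Local Notation strings t := {b : B & 'I_(t (tag b))}.

Definition std_list : seq B :=
  [seq Tagged (fun i => 'I_(nn i)) k | i <- enum 'I_r, k <- enum 'I_(nn i)].

Lemma std_list_uniq : uniq std_list.
Proof.
apply: allpairs_uniq_dep; first exact: enum_uniq.
  by move=> i _; apply: enum_uniq.
by move=> [i a] [j b] _ _.
Qed.

Lemma mem_std_list b : b \in std_list.
Proof. by case: b => i k; apply/allpairsPdep; exists i, k; split; rewrite ?mem_enum. Qed.

Lemma std_boxesE : std_boxes nn = map tag std_list.
Proof.
rewrite map_flatten -map_comp; congr flatten; apply: eq_map => i /=.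
apply/esym; rewrite -map_comp; apply/eqP.
have := all_pred1P i [seq (tag \o Tagged (fun i => 'I_(nn i))) k | k <- enum 'I_(nn i)].
rewrite size_map size_enum_ord => /elimT ->; first by [].
by apply/allP => _ /mapP[k _ ->] /=.
Qed.

Lemma sum_strings t : (\sum_(b : B) t (tag b) = \sum_i nn i * t i)%N.
Proof. by rewrite sig_big /=; apply: eq_bigr => i _; rewrite sum_nat_const card_ord. Qed.

Section Numbering.
Variables (t : 'I_r -> nat) (m : nat) (em : (\sum_i nn i * t i)%N = m).

Lemma string_num_lt (u : strings t) : (string_pos std_list u < m)%N.
Proof.
have := string_pos_lt mem_std_list u.
by rewrite (sumn_map_uniq _ std_list_uniq mem_std_list) sum_strings em.
Qed.

Definition string_num u : 'I_m := Ordinal (string_num_lt u).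

Lemma string_num_inj : injective string_num.
Proof. by move=> u v [] /(string_pos_inj mem_std_list). Qed.

Lemma string_num_surj x : exists u, string_num u = x.
Proof.
have [|u ux] := @string_pos_surj B std_list (fun b => t (tag b)) std_list_uniq x.
  by rewrite (sumn_map_uniq _ std_list_uniq mem_std_list) sum_strings em.
by exists u; apply: val_inj.
Qed.

Lemma string_num_bij : bijective string_num.
Proof.
apply: inj_card_bij; first exact: string_num_inj.
have [g gP] := choice string_num_surj.
by apply: (leq_card g); apply: (can_inj gP).
Qed.

Lemma string_perm_exists (h : S) :
  exists s : 'S_m, forall u, s (string_num u) = string_num (string_act h u).
Proof.
have [g fK gK] := string_num_bij.
have inj : injective (string_num \o string_act h \o g).
  by apply: inj_comp (can_inj gK); apply: inj_comp string_num_inj (@string_act_inj _ _ _ _).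
by exists (perm inj) => u; rewrite permE /= fK.
Qed.

Definition string_perm h : 'S_m := sval (cid (string_perm_exists h)).

Lemma string_permE h u : string_perm h (string_num u) = string_num (string_act h u).
Proof. exact: (svalP (cid (string_perm_exists h)) u). Qed.

Lemma string_permM h h' : string_perm (h * h')%g = (string_perm h * string_perm h')%g.
Proof.
apply/permP => x; have [u <-] := string_num_surj x.
by rewrite permM !string_permE string_actM.
Qed.

(** Strings are grouped by box, whereas the blocks of [diag_perm] are indexed by place with the
    boxes as points; [F] exchanges the two. *)
Lemma chi_string_perm (K : fieldType) la h :
  chi K la (string_perm h) = chiT K la (diag_perm t h).
Proof.
have [g fK gK] := string_num_bij.
pose F (u : strings t) : {j : {i : 'I_r & 'I_(t i)} & 'I_(nn (tag j))} :=
  existT (fun j : {i : 'I_r & 'I_(t i)} => 'I_(nn (tag j)))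
    (Tagged (fun i => 'I_(t i)) (tagged u)) (tagged (tag u)).
pose F' (v : {j : {i : 'I_r & 'I_(t i)} & 'I_(nn (tag j))}) : strings t :=
  existT (fun b : B => 'I_(t (tag b)))
    (Tagged (fun i => 'I_(nn i)) (tagged v)) (tagged (tag v)).
have bF : bijective F by exists F' => [[[i k] a]|[[i a] k]].
apply: (@chiT_chi _ _ _ _ _ _ (F \o g)); first exact: bij_comp bF (Bijective gK fK).
move=> x /=; rewrite -[x]gK string_permE !fK; case: (g x) => [[i k] a].
by rewrite permE /sig_fun /F /string_act /box_act /= ffunE.
Qed.
End Numbering.
End StandardNumbering.

Section DegreeComponents.
Variables (r : nat) (p q : 'I_r -> nat).

Lemma perm_std_boxes (nn : 'I_r -> nat) (v : seq 'I_r) :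
  (forall i, count_mem i v = nn i) -> perm_eq v (std_boxes nn).
Proof.
move=> cv; rewrite /perm_eq; apply/allP => i _ /=; apply/eqP; rewrite cv.
rewrite /std_boxes count_flatten -map_comp sumnE big_map big_enum /=.
rewrite (bigD1 i) //= count_nseq /= eqxx mul1n big1 ?addn0 // => j /negbTE ji.
by rewrite count_nseq /= ji.
Qed.

Lemma cdeg_balanced (x : closed_diagram p q) (nn : 'I_r -> nat) :
  (forall i, cdeg x i = nn i) -> (\sum_i nn i * p i = \sum_i nn i * q i)%N.
Proof.
move=> /perm_std_boxes pw; rewrite -!sumn_std_boxes.
by rewrite -(perm_sumn (perm_map p pw)) -(perm_sumn (perm_map q pw)) sumn_boxes.
Qed.

Variables (nn : 'I_r -> nat) (e : (\sum_i nn i * p i = \sum_i nn i * q i)%N).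
Local Notation n := (\sum_i nn i * p i)%N.
Local Notation B := {i : 'I_r & 'I_(nn i)}.
Local Notation S := {dffun forall i : 'I_r, 'S_(nn i)}.
Local Notation strings t := {b : B & 'I_(t (tag b))}.
Local Notation out_num := (@string_num _ nn p _ erefl).
Local Notation in_num := (@string_num _ nn q _ (esym e)).
Local Notation L := (@std_list _ nn).

Lemma std_presents (s : 'S_n) :
  exists k : strings p -> strings q, presents (Diagram (std_proof e s)) L k /\
    forall u, s (out_num u) = in_num (k u).
Proof.
have [|k [kP ks]] := @presents_exists _ p q nn (Diagram (std_proof e s)) L
    (@std_list_uniq _ nn) (@mem_std_list _ nn).
  exact: std_boxesE.
exists k; split=> // u; apply: val_inj; rewrite /= -ks /conn /=.
by rewrite -[string_pos L u]/(val (out_num u)) (nth_map (out_num u)) ?size_enum_ord ?ltn_ord // nth_ord_enum.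
Qed.

Lemma std_diagram_eq (s s' : 'S_n) :
  std_diagram e s = std_diagram e s' <->
  exists h : S, (string_perm erefl h * s' = s * string_perm (esym e) h)%g.
Proof.
have [k [kP ks]] := std_presents s; have [k' [kP' ks']] := std_presents s'.
split=> [/eq_closed_diagram bp | [h hs]].
  have [h hk] := box_perm_presents kP kP' bp; exists h; apply/permP => x.
  have [u <-] := string_num_surj erefl x.
  by rewrite !permM ks !string_permE ks' hk.
apply/eq_closed_diagram; apply: (presents_box_perm kP kP' (h := h)) => u.
apply: (@string_num_inj _ nn q _ (esym e)).
rewrite -ks' -(string_permE erefl) -permM hs permM ks.
exact: string_permE.
Qed.

Lemma cdeg_std (s : 'S_n) i : cdeg (std_diagram e s) i = nn i.
Proof.
rewrite cdeg_pi /boxes /= /std_boxes count_flatten -map_comp sumnE big_map big_enum /=.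
rewrite (bigD1 i) //= count_nseq /= eqxx mul1n big1 ?addn0 // => j /negbTE ji.
by rewrite count_nseq /= ji.
Qed.

(** The boxes of a diagram may come in any order; [L'] lists [B] in an order with matching labels,
    and the connection is read through it. *)
Lemma std_diagram_surj (x : closed_diagram p q) :
  (forall i, cdeg x i = nn i) -> exists s, x = std_diagram e s.
Proof.
move=> dx; pose E := repr x.
have : perm_eq (boxes E) (map tag L) by rewrite -std_boxesE perm_std_boxes.
case/perm_map_lift => L' pL eE.
have uL' : uniq L' by rewrite (perm_uniq pL) std_list_uniq.
have cL' b : b \in L' by rewrite (perm_mem pL) mem_std_list.
have [k [kP ks]] := presents_exists uL' cL' eE.
have k_inj : injective k.
  move=> u v kuv; apply: (string_pos_inj cL'); apply/eqP.
  have sz (w : strings p) : (string_pos L' w < size (conn E))%N.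
    by rewrite size_conn eE -map_comp; exact: (string_pos_lt cL').
  have uE : uniq (conn E).
    by case/andP: (diagramP E) => _ /perm_uniq ->; rewrite iota_uniq.
  by rewrite -(nth_uniq 0 (sz u) (sz v) uE) !ks kuv.
have [g fK gK] := string_num_bij (t := p) (nn := nn) erefl.
have s_inj : injective (in_num \o k \o g).
  apply: inj_comp (can_inj gK); apply: inj_comp k_inj; exact: string_num_inj.
exists (perm s_inj); rewrite -[x]reprK; apply/eq_closed_diagram.
have [k' [kP' ks']] := std_presents (perm s_inj).
(* Both presentations give the same map of strings on [B], so no box is moved. *)
apply: (presents_box_perm kP kP' (h := 1%g)) => u; rewrite !string_act1.
apply: (@string_num_inj _ nn q _ (esym e)).
by rewrite -ks' permE /= fK.
Qed.
End DegreeComponents.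

Lemma malgU_scale (R : nzRingType) (M : choiceType) (c : R) (m : M) :
  << c *g m >> = c *: << m >> :> {malg R[M]}.
Proof. by apply/malgP => k; rewrite mcoeffZ !mcoeffU mulrnAr mulr1. Qed.

Section QuotientDimension.
Variables (K : closedFieldType).
Hypothesis charK : [pchar K] =i pred0.
Variables (r : nat) (p q nn : 'I_r -> nat).
Hypothesis e : (\sum_i nn i * p i = \sum_i nn i * q i)%N.
Variable d : nat.
Local Notation n := (\sum_i nn i * p i)%N.
Local Notation A := (galg K 'S_n).
Local Notation S := {dffun forall i : 'I_r, 'S_(nn i)}.
Local Notation phi_out := (@string_perm _ nn p _ erefl).
Local Notation phi_in := (@string_perm _ nn q _ (esym e)).
Local Notation "[: g ]" := (gelt K g) (format "[: g ]").

Definition to_diag (x : A) : diagram_alg K p q := \sum_s x s *: << std_diagram e s >>.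

Lemma to_diag_linear : linear to_diag.
Proof.
move=> a x y; rewrite /to_diag scaler_sumr -big_split /=; apply: eq_bigr => s _.
by rewrite !ffunE scalerDl scalerA.
Qed.
HB.instance Definition _ :=
  GRing.isLinear.Build K A (diagram_alg K p q) *:%R to_diag to_diag_linear.

Lemma to_diag_gelt s : to_diag [: s] = << std_diagram e s >>.
Proof.
rewrite /to_diag (bigD1 s) //= geltE eqxx scale1r big1 ?addr0 // => y /negbTE ys.
by rewrite geltE ys scale0r.
Qed.

Lemma cardS_neq0 : #|S|%:R != 0 :> K.
Proof. by apply: (natr_neq0 charK); apply/card_gt0P; exists 1%g. Qed.

Definition relabel (h : S) : A -> A := mul2 [: (phi_out h)^-1] [: phi_in h].

Definition relabel_avg (x : A) : A := #|S|%:R^-1 *: \sum_h relabel h x.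
Lemma relabel_avg_linear : linear relabel_avg.
Proof.
move=> a x y; rewrite /relabel_avg scalerA mulrC -scalerA -scalerDr; congr (_ *: _).
rewrite scaler_sumr -big_split /=; apply: eq_bigr => h _.
by rewrite /relabel linearP.
Qed.
HB.instance Definition _ := GRing.isLinear.Build K A A *:%R relabel_avg relabel_avg_linear.

Lemma relabelM h h' x : relabel h' (relabel h x) = relabel (h * h')%g x.
Proof. by rewrite /relabel /mul2 !string_permM invMg !geltM !mulrA. Qed.

Lemma relabel_avg_relabel h x : relabel_avg (relabel h x) = relabel_avg x.
Proof.
congr (_ *: _); rewrite [RHS](reindex_inj (mulgI h)) /=.
by apply: eq_bigr => h' _; rewrite relabelM.
Qed.

Lemma relabel_avg_idem x : relabel_avg (relabel_avg x) = relabel_avg x.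
Proof.
rewrite {2}/relabel_avg linearZ linear_sum /=.
rewrite (eq_bigr (fun=> relabel_avg x)) => [|h _]; last exact: relabel_avg_relabel.
by rewrite sumr_const -scaler_nat scalerA mulVf ?scale1r ?cardS_neq0.
Qed.

Lemma to_diag_relabel h x : to_diag (relabel h x) = to_diag x.
Proof.
rewrite /relabel; apply: (galg_linear_ext (f := to_diag \o mul2 _ _)) => s.
rewrite /= /mul2 -!geltM !to_diag_gelt; congr << _ >>.
by apply/esym/std_diagram_eq; exists h; rewrite !mulgA mulgV mul1g.
Qed.

Lemma to_diag_avg x : to_diag (relabel_avg x) = to_diag x.
Proof.
rewrite /relabel_avg linearZ linear_sum /=.
rewrite (eq_bigr (fun=> to_diag x)) => [|h _]; last exact: to_diag_relabel.
by rewrite sumr_const -scaler_nat scalerA mulVf ?scale1r ?cardS_neq0.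
Qed.

(** Averaging realizes the coinvariants as invariants inside K[S_n], and the central idempotent
    [short_part] realizes the quotient by the ideal as a subspace. *)
Definition quo_proj (x : A) : A := short_part K n d * relabel_avg x.
Lemma quo_proj_linear : linear quo_proj.
Proof. by move=> a x y; rewrite /quo_proj linearP mulrDr scalerAr. Qed.
HB.instance Definition _ := GRing.isLinear.Build K A A *:%R quo_proj quo_proj_linear.

Lemma relabel_short_part h x : relabel h (short_part K n d * x) = short_part K n d * relabel h x.
Proof. by rewrite /relabel /mul2 !mulrA short_part_central. Qed.

Lemma relabel_avg_short_part x :
  relabel_avg (short_part K n d * x) = short_part K n d * relabel_avg x.
Proof.
rewrite /relabel_avg -scalerAr mulr_sumr; congr (_ *: _).
by apply: eq_bigr => h _; apply: relabel_short_part.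
Qed.

Lemma quo_proj_idem x : quo_proj (quo_proj x) = quo_proj x.
Proof.
by rewrite /quo_proj relabel_avg_short_part relabel_avg_idem mulrA short_part_idem.
Qed.

Lemma quo_proj_asym u : (d < n)%N -> asym_gen d u -> quo_proj u = 0.
Proof.
move=> dn [t1 [t2 ->]].
rewrite /quo_proj -relabel_avg_short_part mulrA short_part_asym // mul0r.
exact: linear0.
Qed.

Lemma quo_proj_relabel h x : quo_proj (relabel h x) = quo_proj x.
Proof. by rewrite /quo_proj relabel_avg_relabel. Qed.

Lemma to_diag_gen t1 t2 : to_diag ([: t2] * asym K n d * [: t1]) =
  \sum_(s : 'S_n | perm_on [set j : 'I_n | (j <= d)%N] s)
     (-1) ^+ (odd_perm s) *: << std_diagram e (t2 * s * t1)%g >>.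
Proof.
rewrite /asym mulr_sumr mulr_suml linear_sum; apply: eq_bigr => s _.
by rewrite -scalerAr -scalerAl linearZ /= -!geltM to_diag_gelt.
Qed.

Lemma to_diag_asym (u : A) : (d < n)%N -> linear_span (asym_gen d) u -> ideal_d d (to_diag u).
Proof.
move=> dn; apply: linear_span_map => {}u [t1 [t2 ->]].
exists nn, e, t1, t2; split; first exact: dn.
exact: to_diag_gen.
Qed.

Lemma relabel_avg_large x : (n <= d)%N -> relabel_avg x = quo_proj x.
Proof.
move=> nd; rewrite /quo_proj /short_part -[LHS]mul1r -(sum_isotypic n charK); congr (_ * _).
apply: eq_bigl => la; apply/esym/(leq_trans _ nd); apply: partition_size; exact: partsP.
Qed.

(** If d < n, the average of [x] differs from its projection by an element of the ideal. If n <= d,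
    then [short_part] is 1 and the average itself is 0. *)
Lemma ideal_d_of_proj x : quo_proj x = 0 -> ideal_d d (to_diag x).
Proof.
move=> x0; rewrite -to_diag_avg.
have := short_part_compl charK d (relabel_avg x); rewrite -/(quo_proj x) x0 subr0.
have [dn|nd] := ltnP d n; first exact: to_diag_asym.
by rewrite relabel_avg_large // x0 linear0 => _; apply: linear_span0.
Qed.

(* Dividing by the number of permutations that give the same diagram makes
   from_diag (to_diag x) = quo_proj x, with linearity for free. *)
Definition from_diag (v : diagram_alg K p q) : A :=
  \sum_(s : 'S_n) v@_(std_diagram e s) *:
    (#|[set s' | std_diagram e s' == std_diagram e s]|%:R^-1 *: quo_proj [: s]).

Lemma from_diag_linear : linear from_diag.
Proof.
move=> a x y; rewrite /from_diag scaler_sumr -big_split /=; apply: eq_bigr => s _.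
by rewrite mcoeffD mcoeffZ scalerDl [in RHS]scalerA.
Qed.
HB.instance Definition _ :=
  GRing.isLinear.Build K (diagram_alg K p q) A *:%R from_diag from_diag_linear.

Lemma from_to_diag x : from_diag (to_diag x) = quo_proj x.
Proof.
apply: (galg_linear_ext (f := from_diag \o to_diag)) => s.
rewrite /= to_diag_gelt /from_diag.
pose m := #|[set s' | std_diagram e s' == std_diagram e s]|.
transitivity (\sum_(s' | std_diagram e s' == std_diagram e s) m%:R^-1 *: quo_proj [: s]).
  rewrite [RHS]big_mkcond; apply: eq_bigr => s' _; rewrite mcoeffU eq_sym.
  case: eqP => [es | _]; last by rewrite scale0r.
  rewrite scale1r es; congr (_ *: _).
  have [h hs] := (std_diagram_eq e s' s).1 es.
  rewrite -(quo_proj_relabel h) /relabel /mul2 -!geltM; congr (quo_proj [: _]).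
  by rewrite -mulgA -hs mulKg.
rewrite sumr_const_set -/m -scaler_nat scalerA mulfV ?scale1r //.
by apply: (natr_neq0 charK); apply/card_gt0P; exists s; rewrite inE.
Qed.

Lemma from_diag_off D : ~ cdeg D =1 nn -> from_diag << D >> = 0.
Proof.
move=> neq; apply: big1 => s _; rewrite mcoeffU; case: eqP => [es|_]; last by rewrite scale0r.
by case: neq => i; rewrite es cdeg_std.
Qed.

(** [ideal_d] mixes generators of all degrees. Those of another degree have no coefficient that
    [from_diag] reads; those of degree [nn] come from translates of [asym]. *)
Lemma from_diag_ideal v : ideal_d d v -> from_diag v = 0.
Proof.
apply: linear_span_ker => u [nn' [e' [t1 [t2 [dn ->]]]]].
have [enn|neq] := pselect (nn' = nn).
  subst nn'; rewrite (eq_irrelevance e' e).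
  rewrite -to_diag_gen /= from_to_diag quo_proj_asym //; by exists t1, t2.
rewrite linear_sum; apply: big1 => s _; rewrite linearZ /= from_diag_off ?scaler0 //.
by move=> ce; case: neq; apply/funext => i; rewrite -(cdeg_std e' (t2 * s * t1)%g) ce.
Qed.

Lemma ideal_dP x : ideal_d d (to_diag x) <-> quo_proj x = 0.
Proof.
split; last exact: ideal_d_of_proj.
by move/from_diag_ideal; rewrite from_to_diag.
Qed.

(** For n <= d the projection is plain averaging, which [to_diag] does not see. *)
Lemma ideal_d_large x : (n <= d)%N -> ideal_d d (to_diag x) -> to_diag x = 0.
Proof.
by move=> nd /ideal_dP x0; rewrite -to_diag_avg relabel_avg_large // x0 linear0.
Qed.

Lemma to_diag_homogeneous x : homogeneous nn (to_diag x).
Proof.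
move=> D; rewrite -mcoeff_neq0 raddf_sum /= => nz i.
have [s _] : exists2 s, true & (x s *: << std_diagram e s >>)@_D != 0.
  by apply/exists_inP; apply: contraNT nz => /exists_inPn h; rewrite big1 // => s _; apply/eqP/negbNE/h.
rewrite mcoeffZ mcoeffU; case: (std_diagram e s =P D) => [<- _|_]; first exact: cdeg_std.
by rewrite mulr0 eqxx.
Qed.

Lemma homogeneous_to_diag v : homogeneous nn v -> exists x, v = to_diag x.
Proof.
move=> hv.
have -> : v = \sum_(k <- msupp v | k \in msupp v) << v@_k *g k >>.
  by rewrite -big_seq -monalgE.
apply: (big_ind (fun v => exists x, v = to_diag x)).
- by exists 0; rewrite linear0.
- by move=> _ _ [x ->] [y ->]; exists (x + y); rewrite linearD.
move=> D /hv dD; have [s ->] := std_diagram_surj e dD.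
exists (v@_(std_diagram e s) *: [: s]); rewrite linearZ /= to_diag_gelt.
exact: malgU_scale.
Qed.

Lemma quo_proj_dim (T : 'End(A)) : (forall x, T x = quo_proj x) ->
  \dim (limg T) = hilbert_sum K p q nn [pred la : seq nat | size la <= d]%N.
Proof.
move=> TE; apply: (natr_inj_pchar0 charK).
have TT : (T \o T)%VF = T by apply/lfunP => x; rewrite comp_lfunE !TE quo_proj_idem.
rewrite -(trace_idem (e := @gelt K 'S_n) (co := @coeff K 'S_n) (@galg_sumE K 'S_n) TT).
rewrite hilbert_sum_chi //.
have cS : #|S|%:R = \prod_i (nn i)`!%:R :> K.
  rewrite (@card_dffun_prod K _ (fun i => 'S_(nn i))).
  by apply: eq_bigr => i _; rewrite card_Sn.
(* For each h, the endomorphism x |-> [short_part] out(h)^-1 x in(h) has this [tau] as its trace. *)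
transitivity (#|S|%:R^-1 * \sum_h tau (short_part K n d * [: (phi_out h)^-1]) [: phi_in h]).
  rewrite /tau exchange_big mulr_sumr /=; apply: eq_bigr => x _.
  rewrite TE /coeff /quo_proj /relabel_avg -scalerAr scale_galgE mulr_sumr sum_ffunE.
  by congr (_ * _); apply: eq_bigr => h _; rewrite /relabel /mul2 !mulrA.
rewrite -[RHS]mulr_sumr cS; congr (_ * _); rewrite [RHS]exchange_big /=.
apply: eq_bigr => h _; rewrite tau_short_part //.
by apply: eq_bigr => la _; rewrite chiV // !chi_string_perm.
Qed.

(** By [ideal_dP] a basis of the image of [quo_proj] represents a basis of the quotient. *)
Lemma hilbert_mod_balanced :
  hilbert_mod K p q d nn (hilbert_sum K p q nn [pred la : seq nat | size la <= d]%N).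
Proof.
pose T : 'End(A) := linfun quo_proj.
have TE x : T x = quo_proj x by rewrite lfunE.
rewrite -(quo_proj_dim TE).
have Tid x : x \in limg T -> quo_proj x = x.
  by case/memv_imgP => y _ ->; rewrite TE quo_proj_idem.
pose X := vbasis (limg T).
have XT (i : 'I_(\dim (limg T))) : X`_i \in limg T.
  by apply: vbasis_mem; rewrite mem_nth ?size_tuple.
exists (fun i => to_diag X`_i); split=> [i|v]; first exact: to_diag_homogeneous.
case/homogeneous_to_diag => x ->.
have redE (c : {ffun 'I_(\dim (limg T)) -> K}) :
    ideal_d d (to_diag x - \sum_i c i *: to_diag X`_i) <-> quo_proj x = \sum_i c i *: X`_i.
  have -> : to_diag x - \sum_i c i *: to_diag X`_i = to_diag (x - \sum_i c i *: X`_i).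
    have <- : to_diag (\sum_i c i *: X`_i) = \sum_i c i *: to_diag X`_i.
      by rewrite linear_sum; apply: eq_bigr => i _; rewrite linearZ.
    exact/esym/linearB.
  rewrite ideal_dP linearB /= (Tid (\sum_i _)).
    by split=> [/eqP|->]; rewrite ?subrr // subr_eq0 => /eqP.
  by apply: memv_suml => i _; apply: memvZ.
have imx : quo_proj x \in limg T by rewrite -TE memv_img ?memvf.
exists [ffun i => coord X i (quo_proj x)]; split.
  apply/redE; rewrite {1}(coord_vbasis imx); apply: eq_bigr => i _.
  by rewrite ffunE.
move=> c /redE xc; apply/ffunP => i; rewrite ffunE xc.
by rewrite coord_sum_free //; apply: basis_free (vbasisP _).
Qed.
End QuotientDimension.

Lemma homogeneous_unbalanced (K : fieldType) (r : nat) (p q nn : 'I_r -> nat)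
    (v : diagram_alg K p q) :
  (\sum_i nn i * p i <> \sum_i nn i * q i)%N -> homogeneous nn v -> v = 0.
Proof.
move=> neq hv; apply/malgP => D; rewrite mcoeff0; apply/eqP.
by apply: contra_notT neq; rewrite mcoeff_neq0 => /hv/cdeg_balanced.
Qed.

Lemma has_dim_mod0 (K : fieldType) (V : lmodType K) (I S : V -> Prop) :
  I 0 -> (forall v, S v -> v = 0) -> has_dim_mod I S 0.
Proof.
move=> I0 S0; exists (fun=> 0); split=> [[]//|v /S0 ->].
exists [ffun=> 0]; split=> [|c _]; first by rewrite big_ord0 subr0.
by apply/ffunP => -[].
Qed.

(** The quotient for d = n: no partition of n has more than n rows, and the ideal is zero in this
    degree. *)
Lemma hilbert_balanced (K : closedFieldType) (charK : [pchar K] =i pred0)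
    (r : nat) (p q nn : 'I_r -> nat) :
  (\sum_i nn i * p i = \sum_i nn i * q i)%N ->
  hilbert K p q nn (hilbert_sum K p q nn predT).
Proof.
move=> e; have := hilbert_mod_balanced charK e (\sum_i nn i * p i)%N.
have -> : hilbert_sum K p q nn [pred la | size la <= \sum_i nn i * p i]%N
          = hilbert_sum K p q nn predT.
  by apply: eq_bigl => la /=; apply: partition_size (partsP la).
case=> b [hb ub]; exists b; split=> // v hv.
(* Writing the basis through [to_diag] lets [ideal_d_large] turn membership in the ideal into
   equality. *)
have bT i : exists y : galg K _, b i = to_diag e y by apply: homogeneous_to_diag.
have [y yb] := choice bT; have [x vx] := homogeneous_to_diag e hv.
have diffE (c : {ffun 'I_(hilbert_sum K p q nn predT) -> K}) :
    v - \sum_i c i *: b i = to_diag e (x - \sum_i c i *: y i).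
  have -> : \sum_i c i *: b i = to_diag e (\sum_i c i *: y i).
    by rewrite linear_sum; apply: eq_bigr => i _; rewrite linearZ /= -yb.
  by rewrite vx; apply/esym/linearB.
have [c [Ic uc]] := ub v hv; exists c; split=> [|c' c'0].
  by rewrite diffE in Ic *; apply: ideal_d_large Ic.
by apply: uc; rewrite c'0; apply: linear_span0.
Qed.

Local Open Scope nat_scope.

Theorem theorem9p1 (K : closedFieldType) (charK : [pchar K]%R =i pred0)
    (r : nat) (p q nn : 'I_r -> nat) :
  (\sum_i nn i * p i <> \sum_i nn i * q i ->
     hilbert K p q nn 0 /\ forall d : nat, hilbert_mod K p q d nn 0) /\
  (\sum_i nn i * p i = \sum_i nn i * q i ->
     hilbert K p q nn (hilbert_sum K p q nn predT) /\
     forall d : nat,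
       hilbert_mod K p q d nn
         (hilbert_sum K p q nn [pred la : seq nat | size la <= d])).
Proof.
split=> e; split=> [|d].
- by apply: has_dim_mod0 => // v; apply: homogeneous_unbalanced.
- by apply: has_dim_mod0 (linear_span0 _) _ => v; apply: homogeneous_unbalanced.
- exact: hilbert_balanced.
- exact: hilbert_mod_balanced.
Qed.
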